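(* Let $k$ be an uncountable algebraically closed field of characteristic $0$ and let $V$ be a biquadratic space over $k$. Then $V$ is universal and of length two if and only if $V$ is of one of the seven types Ia, Ib, Ic, IIa, IIb, IIc, III defined in the context.
   Context: All vector spaces are over $k$ and have dimension at most $\aleph_0$. For $r\ge 0$, an $r$-quadratic space (or multi-quadratic space) is a vector space $V$ with $r$ symmetric bilinear forms $\omega_1,\dots,\omega_r$; a biquadratic space $(V,\omega,\omega')$ is the case $r=2$. An embedding of such spaces is an injective linear map respecting all the forms, an isomorphism is a bijective embedding, and $\mathrm{Aut}(V)$ is the group of self-isomorphisms. The length of $V$ is its length as a representation of $\mathrm{Aut}(V)$, and $V$ is irreducible if this representation is irreducible. $V$ is universal if every finite dimensional space of the same kind embeds into it. $V$ is homogeneous if for any two embeddings $\sigma,\tau\colon W\to V$ of a finite dimensional space $W$ of the same kind there is $g\in\mathrm{Aut}(V)$ with $\sigma=g\circ\tau$. There is a biquadratic space of countable infinite dimension that is both universal and homogeneous, unique up to isomorphism; it is called the universal homogeneous biquadratic space. For a form $\omega$ on $V$ and $x\in V$, $\omega_x$ is the linear functional $\omega(x,-)$, and $\ker(\omega)=\{x : \omega_x=0\}$ is the nullspace. For a biquadratic space, $\ker(V)=\ker(\omega)\cap\ker(\omega')$. The total orthogonal complement of a subspace $W\subset V$ is the set of all vectors of $V$ orthogonal to $W$ under both $\omega$ and $\omega'$. For $p=[p_0:p_1]\in\mathbf{P}^1(k)$ put $\omega(p)=p_1\omega+p_0\omega'$ (defined up to non-zero scalar); so up to scalar $\omega(0)=\omega$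 and $\omega(\infty)=\omega'$. A subspace or quotient on which the forms are defined is regarded as a biquadratic space with the induced forms. A biquadratic space $V$ is of: Type Ia if there are $p\ne q$ in $\mathbf{P}^1$ such that $W=\ker(\omega(p))$ and $W'=\ker(\omega(q))$ are both infinite dimensional and $V=W\oplus W'$. Type Ib if there is $p\in\mathbf{P}^1$ such that $W=\ker(\omega(p))$ is non-zero, the total orthogonal complement $U$ of $W$ is the universal homogeneous biquadratic space, and $V=U\oplus W$. Type Ic if $U=\ker(V)$ is non-zero and $V/U$ is the universal homogeneous biquadratic space. Type IIa if $V$ is universal and there is $p\in\mathbf{P}^1$ such that: $W=\ker(\omega(p))$ is non-zero; $W$ is its own total orthogonal complement; and for each $q\ne p$ in $\mathbf{P}^1$ (after fixing representatives of $\omega(q)$ and $\omega(p)$) there is a linear isomorphism $T\colon V/W\to W$ with $\omega(q)_{T(x)}=\omega(p)_x$ for all $x\in V$. Type IIb if $V$ is universal and there is $p\in\mathbf{P}^1$ such that $\ker(\omega(p))$ is non-zero and the total orthogonal complement of $\ker(\omega(p))$ is $0$. Type IIc if $V$ is universal and there is $p\in\mathbf{P}^1$ such that: $\ker(\omega(p))$ is non-zero; the total orthogonal complement of $\ker(\omega(p))$ is $\ker(\omega(p))$ itself; $\omega_x+\omega'_y=0$ only if $x$ and $y$ are linearly dependent; and $\ker(V)=0$. Type III if there are a decomposition $V=U\oplus U'$ and a linear isomorphism $T\colon U\to U'$ such that: (a) for $x,y\in V$, $\omega_x=\omega'_y$ if and only if $x\in U$ and $y=T(x)$; and (b) $U$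 with the four forms $\eta_1=\omega|_U$, $\eta_2=\omega'|_U$, $\eta_3=T^*(\omega|_{U'})$, $\eta_4=T^*(\omega'|_{U'})$ is an irreducible $4$-quadratic space. *)

(* Defs.v *)
From HB Require Import structures.
From mathcomp Require Import all_boot all_order all_algebra.
From mathcomp Require Import generic_quotient ring_quotient sesquilinear.
From mathcomp Require Import boolp classical_sets cardinality.

Set Implicit Arguments.
Unset Strict Implicit.
Unset Printing Implicit Defensive.

Import GRing.Theory.

Local Open Scope ring_scope.
Local Open Scope quotient_scope.

Section Dimension.
Variables (k : fieldType) (V : lmodType k).
Implicit Type B : set V.

Definition is_free B : Prop :=
  forall n (b : 'I_n -> V) (c : 'I_n -> k), injective b ->
    (forall i, B (b i)) -> \sum_(i < n) c i *: b i = 0 -> forall i, c i = 0.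

Definition is_generating B : Prop :=
  forall v : V, exists n (b : 'I_n -> V) (c : 'I_n -> k),
    (forall i, B (b i)) /\ v = \sum_(i < n) c i *: b i.

Definition is_basis B : Prop := is_free B /\ is_generating B.

Definition finite_dim : Prop := exists B, is_basis B /\ finite_set B.

Definition infinite_dim : Prop := ~ finite_dim.

Definition countable_dim : Prop := exists B, is_basis B /\ countable B.

Definition countably_infinite_dim : Prop := countable_dim /\ infinite_dim.

Definition lin_dependent (x y : V) : Prop :=
  exists a b : k, (a != 0) || (b != 0) /\ a *: x + b *: y = 0.

End Dimension.

(* Since the logic is classical, the boolean predicates [submodClosed V] are  *)
(* all the linear subspaces of V.                                             *)
Section Subspaces.
Variables (k : fieldType) (V : lmodType k).
Implicit Types U W : submodClosed V.


Variant subsp W : predArgType := Subsp x & x \in W.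

Definition subsp_val W (u : subsp W) : V := let: Subsp x _ := u in x.

HB.instance Definition _ W := [isSub of subsp W for @subsp_val W].
HB.instance Definition _ W := [Choice of subsp W by <:].
HB.instance Definition _ W := [SubChoice_isSubLmodule of subsp W by <:].

Fact subsp_val_is_linear W : linear (@subsp_val W). Proof. by []. Qed.
HB.instance Definition _ W := GRing.isSemilinear.Build k (subsp W) V _
  (@subsp_val W) (GRing.semilinear_linear (@subsp_val_is_linear W)).

Definition nonzero_subspace W : Prop := exists2 x, x \in W & x != 0.

Definition zero_subspace W : Prop := forall x, x \in W -> x = 0.

Definition proper_subspace U W : Prop :=
  {subset U <= W} /\ exists2 x, x \in W & x \notin U.

Definition direct_sum U W : Prop :=
  (forall v : V, exists x y, [/\ x \in U, y \in W & v = x + y]) /\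
  (forall x, x \in U -> x \in W -> x = 0).

End Subspaces.

(* MathComp provides {ideal_quot W} only for [zmodClosed] predicates, which   *)
(* [submodClosed] ones do not inherit from, and only as an additive group.    *)
Section QuotientModule.
Variables (k : fieldType) (V : lmodType k) (W : submodClosed V).

Definition subspace_zmod : {pred V} := W.

Fact subspace_zmod_closed : zmod_closed subspace_zmod.
Proof. exact: GRing.submod_closedB (submodClosedP W). Qed.

HB.instance Definition _ :=
  GRing.isZmodClosed.Build V subspace_zmod subspace_zmod_closed.

Definition quotsp : Type := {ideal_quot subspace_zmod}.
HB.instance Definition _ := Choice.on quotsp.
HB.instance Definition _ := EqQuotient.on quotsp.
HB.instance Definition _ := GRing.Zmodule.on quotsp.

Local Notation Q := quotsp.

Definition quot_scale (a : k) : Q -> Q := lift_op1 Q ( *:%R a).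

Fact pi_quot_scale a : {morph \pi_Q : x / a *: x >-> quot_scale a x}.
Proof.
move=> x; unlock quot_scale; apply/eqP.
have Wx : x - repr (\pi_Q x) \in W.
  by rewrite [_ \in _](Quotient.idealrBE subspace_zmod) reprK.
rewrite -(Quotient.idealrBE subspace_zmod) -scalerBr.
exact: (rpredZ a Wx).
Qed.

Fact quot_scalerA a b v : quot_scale a (quot_scale b v) = quot_scale (a * b) v.
Proof. by rewrite -[v]reprK -!pi_quot_scale scalerA. Qed.

Fact quot_scale1r : left_id 1 quot_scale.
Proof. by move=> v; rewrite -[v]reprK -pi_quot_scale scale1r. Qed.

Fact quot_scalerDr : right_distributive quot_scale +%R.
Proof.
move=> a u v; rewrite -[u]reprK -[v]reprK -!pi_quot_scale.
by rewrite -!(raddfD (\pi_Q)) -pi_quot_scale scalerDr.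
Qed.

Fact quot_scalerDl v : {morph quot_scale^~ v : a b / a + b}.
Proof.
move=> a b; rewrite -[v]reprK -!pi_quot_scale.
by rewrite -!(raddfD (\pi_Q)) scalerDl.
Qed.

HB.instance Definition _ := GRing.Zmodule_isLmodule.Build k Q
  quot_scalerA quot_scale1r quot_scalerDr quot_scalerDl.

End QuotientModule.

Section Forms.
Variables (k : fieldType) (V : lmodType k).
Implicit Types (w : {symmetric V}) (W : submodClosed V).

Fact formC w x y : w x y = w y x.
Proof. by rewrite (hermC w) /= expr0 mul1r. Qed.

Fact form_linearr w x : linear_for *%R (w x).
Proof. by move=> a u v; rewrite linearPr. Qed.

Fact formBr w x y z : w x (y - z) = w x y - w x z.
Proof. exact: linearBr. Qed.

Section Build.
Variables (f : V -> V -> k) (fC : forall x y, f x y = f y x).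
Hypothesis fL : forall x, linear_for *%R (f x).

(* The two unused proofs are arguments so that HB can attach the symmetric    *)
(* bilinear structure to this constant; mk_form f _ _ x y reduces to f x y.   *)
Definition mk_form_fun of (forall x y, f x y = f y x)
  & (forall x, linear_for *%R (f x)) : V -> V -> k := f.
Local Notation g := (mk_form_fun fC fL).

Fact mk_form_bilinear :
  bilinear_for ( *%R : GRing.Scale.law k k) (idfun \; *%R : GRing.Scale.law k k) g.
Proof.
split=> [u' a x y|u a x y]; rewrite /mk_form_fun.
  by rewrite !(fC _ u') fL.
by rewrite fL.
Qed.

HB.instance Definition _ := bilinear_isBilinear.Build k V V k
  ( *%R : GRing.Scale.law k k) (idfun \; *%R : GRing.Scale.law k k) g mk_form_bilinear.

Fact mk_form_sym x y : g x y = (-1) ^+ false * idfun (g y x).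
Proof. by rewrite expr0 mul1r; apply: fC. Qed.

HB.instance Definition _ :=
  isHermitianSesquilinear.Build k V false idfun g mk_form_sym.

Definition mk_form : {symmetric V} := g.

End Build.
End Forms.

Section InducedForms.
Variables (k : fieldType) (V : lmodType k).
Implicit Type w : {symmetric V}.

Section Pullback.
Variables (W : lmodType k) (f : {linear W -> V}) (w : {symmetric V}).

Fact pullback_sym x y : w (f x) (f y) = w (f y) (f x).
Proof. exact: formC. Qed.

Fact pullback_linear x : linear_for *%R (fun y => w (f x) (f y)).
Proof. by move=> a u v; rewrite linearP form_linearr. Qed.

Definition pullback_form : {symmetric W} := mk_form pullback_sym pullback_linear.

End Pullback.

Section Combination.
Variables (a b : k) (w w' : {symmetric V}).

Fact comb_sym x y : a * w x y + b * w' x y = a * w y x + b * w' y x.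
Proof. by rewrite (formC w) (formC w'). Qed.

Fact comb_linear x : linear_for *%R (fun y => a * w x y + b * w' x y).
Proof.
by move=> c u v; rewrite !form_linearr !mulrDr addrACA !(mulrCA _ c).
Qed.

Definition comb_form : {symmetric V} := mk_form comb_sym comb_linear.

End Combination.

Definition form_ker_pred w : {pred V} := [pred x | `[< forall y, w x y = 0 >]].

Fact form_ker_closed w : submod_closed (form_ker_pred w).
Proof.
split=> [|a u v]; first by apply/asboolP => y; rewrite formC linear0r.
move=> /asboolP uK /asboolP vK; apply/asboolP => y.
by rewrite formC form_linearr ![w y _]formC uK vK mulr0 addr0.
Qed.

HB.instance Definition _ w :=
  GRing.isSubmodClosed.Build k V (form_ker_pred w) (form_ker_closed w).

Definition form_ker w : submodClosed V := form_ker_pred w.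

End InducedForms.

Record multiquadratic (k : fieldType) (r : nat) := MultiQuadratic {
  mq_space :> lmodType k;
  mq_form : 'I_r -> {symmetric mq_space}
}.

Notation biquadratic k := (multiquadratic k 2).

Section MultiQuadratic.
Variables (k : fieldType) (r : nat).
Implicit Types V W : multiquadratic k r.

Definition is_embedding W V (f : {linear W -> V}) : Prop :=
  injective f /\ forall i x y, mq_form V i (f x) (f y) = mq_form W i x y.

Definition is_aut V (g : {linear V -> V}) : Prop :=
  is_embedding g /\ bijective g.

Definition universal V : Prop :=
  forall W, finite_dim W -> exists f : {linear W -> V}, is_embedding f.

Definition homogeneous V : Prop :=
  forall W, finite_dim W ->
  forall sigma tau : {linear W -> V}, is_embedding sigma -> is_embedding tau ->
  exists2 g : {linear V -> V}, is_aut g & forall x, sigma x = g (tau x).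

Definition universal_homogeneous V : Prop :=
  [/\ countably_infinite_dim V, universal V & homogeneous V].

Definition subrep V (S : submodClosed V) : Prop :=
  forall g : {linear V -> V}, is_aut g -> forall x, x \in S -> g x \in S.

(* The length is the largest length of a strict chain of subrepresentations.  *)
Definition subrep_chain V (n : nat) : Prop :=
  exists S : nat -> submodClosed V,
    (forall i, (i <= n)%N -> subrep (S i)) /\
    (forall i, (i < n)%N -> proper_subspace (S i) (S i.+1)).

Definition has_length V (n : nat) : Prop :=
  subrep_chain V n /\ forall m, subrep_chain V m -> (m <= n)%N.

Definition irreducible V : Prop :=
  (exists x : V, x != 0) /\
  forall S : submodClosed V, subrep S -> zero_subspace S \/ forall x, x \in S.

Definition restrict V (S : submodClosed V) : multiquadratic k r :=
  MultiQuadratic (fun i => pullback_form (@subsp_val k V S) (mq_form V i)).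

Definition mq_ker_pred V : {pred V} :=
  [pred x | [forall i, x \in form_ker (mq_form V i)]].

Fact mq_ker_closed V : submod_closed (@mq_ker_pred V).
Proof.
split=> [|a u v]; first by apply/forallP => i; rewrite (rpred0 (form_ker _)).
move=> /forallP uK /forallP vK; apply/forallP => i.
exact: (submodClosedP (form_ker _)).2.
Qed.

HB.instance Definition _ V :=
  GRing.isSubmodClosed.Build k V (@mq_ker_pred V) (@mq_ker_closed V).

Definition mq_ker V : submodClosed V := @mq_ker_pred V.

Definition orth_pred V (S : submodClosed V) : {pred V} :=
  [pred x | `[< forall i y, y \in S -> mq_form V i x y = 0 >]].

Fact orth_closed V (S : submodClosed V) : submod_closed (orth_pred S).
Proof.
split=> [|a u v]; first by apply/asboolP => i y _; rewrite formC linear0r.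
move=> /asboolP uK /asboolP vK; apply/asboolP => i y Sy.
by rewrite formC form_linearr ![mq_form V i y _]formC uK // vK // mulr0 addr0.
Qed.

HB.instance Definition _ V (S : submodClosed V) :=
  GRing.isSubmodClosed.Build k V (orth_pred S) (orth_closed S).

Definition orth V (S : submodClosed V) : submodClosed V := orth_pred S.

Section QuotientByKernel.
Variables (V : multiquadratic k r) (i : 'I_r).
Local Notation Q := (quotsp (mq_ker V)).

Let qf (u v : Q) : k := mq_form V i (repr u) (repr v).

Fact quot_repr (x y : V) : mq_form V i x (repr (\pi_Q y)) = mq_form V i x y.
Proof.
have : repr (\pi_Q y) - y \in subspace_zmod (mq_ker V).
  by rewrite Quotient.idealrBE reprK.
move=> /forallP /(_ i) /asboolP Ky; apply/eqP.
by rewrite -subr_eq0 -formBr formC Ky.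
Qed.

Fact quot_form_sym u v : qf u v = qf v u.
Proof. exact: formC. Qed.

Fact quot_form_linear u : linear_for *%R (qf u).
Proof.
move=> a v v'; rewrite /qf -[in LHS](reprK v) -[in LHS](reprK v').
rewrite -form_linearr -(quot_repr _ (a *: repr v + repr v')).
by rewrite raddfD /= pi_quot_scale.
Qed.

Definition quot_form : {symmetric Q} := mk_form quot_form_sym quot_form_linear.

Fact quot_formE x y : quot_form (\pi_Q x) (\pi_Q y) = mq_form V i x y.
Proof.
rewrite -[LHS]/(mq_form V i (repr (\pi_Q x)) (repr (\pi_Q y))) quot_repr.
by rewrite (formC (mq_form V i)) quot_repr formC.
Qed.

End QuotientByKernel.

Definition quot_ker V : multiquadratic k r :=
  MultiQuadratic (@quot_form V).

End MultiQuadratic.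

(* Homogeneous coordinates [p0 : p1] of a point of the projective line.       *)
Record point (k : fieldType) := Point {
  pt0 : k;
  pt1 : k;
  pt_neq0 : (pt0 != 0) || (pt1 != 0)
}.

Definition same_point (k : fieldType) (p q : point k) : Prop :=
  exists2 c : k, c != 0 & pt0 q = c * pt0 p /\ pt1 q = c * pt1 p.

Section Biquadratic.
Variables (k : fieldType) (V : biquadratic k).

Definition omega : {symmetric V} := mq_form V ord0.
Definition omega' : {symmetric V} := mq_form V ord_max.

Definition omega_at (p : point k) : {symmetric V} :=
  comb_form (pt1 p) (pt0 p) omega omega'.

Definition ker_at (p : point k) : submodClosed V := form_ker (omega_at p).

Definition type_Ia : Prop :=
  exists p q : point k, [/\ ~ same_point p q,
    infinite_dim (subsp (ker_at p)), infinite_dim (subsp (ker_at q)) &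
    direct_sum (ker_at p) (ker_at q)].

Definition type_Ib : Prop :=
  exists p : point k, [/\ nonzero_subspace (ker_at p),
    universal_homogeneous (restrict (orth (ker_at p))) &
    direct_sum (orth (ker_at p)) (ker_at p)].

Definition type_Ic : Prop :=
  nonzero_subspace (mq_ker V) /\ universal_homogeneous (quot_ker V).

Definition type_IIa : Prop :=
  universal V /\
  exists p : point k, let W := ker_at p in
    [/\ nonzero_subspace W, orth W =i W &
        forall q : point k, ~ same_point p q ->
        exists2 T : {linear quotsp W -> subsp W}, bijective T &
          forall x y : V,
            omega_at q (subsp_val (T (\pi_(quotsp W) x))) y = omega_at p x y].

Definition type_IIb : Prop :=
  universal V /\
  exists p : point k,
    nonzero_subspace (ker_at p) /\ zero_subspace (orth (ker_at p)).

Definition type_IIc : Prop :=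
  universal V /\
  exists p : point k,
    [/\ nonzero_subspace (ker_at p), orth (ker_at p) =i ker_at p,
        forall x y : V, (forall z, omega x z + omega' y z = 0) ->
          lin_dependent x y &
        zero_subspace (mq_ker V)].

Definition type_III : Prop :=
  exists (U U' : submodClosed V) (T : {linear subsp U -> subsp U'}),
    [/\ direct_sum U U',
        bijective T,
        forall x y : V, (forall z, omega x z = omega' y z) <->
          exists u : subsp U, x = subsp_val u /\ y = subsp_val (T u) &
        irreducible (MultiQuadratic (fun i : 'I_4 =>
          tnth [tuple pullback_form (@subsp_val k V U) omega;
                      pullback_form (@subsp_val k V U) omega';
                      pullback_form T (pullback_form (@subsp_val k V U') omega);
                      pullback_form T (pullback_form (@subsp_val k V U') omega')]
               i))].

End Biquadratic.

(* Main.v *)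
From HB Require Import structures.
From mathcomp Require Import all_boot all_order all_algebra.
From mathcomp Require Import boolp classical_sets cardinality.
From mathcomp Require Import ring.
Require Import Defs.

Set Implicit Arguments.
Unset Strict Implicit.
Unset Printing Implicit Defensive.

Import GRing.Theory.
Local Open Scope classical_set_scope.
Local Open Scope ring_scope.

(** Write a for omega(p), b for omega(q) with p <> q in P^1, and a_x for the
    functional a(x,-). Everything turns on the linear relations a_x + b_y = 0.

    Two facts control them. First, over an algebraically closed field of
    characteristic not 2, a pencil all of whose nonzero members have infinite
    rank (such a pencil is called [full]) lets one find vectors with prescribed
    norms a(u,u), b(u,u) in any translate of the orthogonal complement of a
    finite set ([full_translate]); so a space is universal exactly when its
    pencil is full ([full_universal], [universal_full]). Together with duality
    ([linear_system]) this extends finite partial isometries one vector at a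
    time, and a back-and-forth argument produces automorphisms
    ([back_and_forth]) whenever the only relations are those forced by
    W = ker a. With no relation at all the space is universal homogeneous
    ([no_relation_universal_homogeneous]). Second, an equivariant operator T on
    an irreducible space of countable dimension has a non-bijective T - c, since
    otherwise the uncountably many vectors (T - c)^-1 v would be linearly
    independent ([exists_singular_shift]); hence an irreducible space on which
    no omega(p) vanishes has no relations ([irreducible_no_relation]).

    Suppose V is universal of length two. If some W = ker a is nonzero, then it
    is a composition factor, and so is its total orthogonal complement O unless
    O is 0 or V. When O = V the quotient by the kernel of V is irreducible, hence
    universal homogeneous: type Ic. O = 0 is type IIb. If O is a complement of
    W, it is irreducible, so either universal homogeneous (type Ib) or killed by
    another omega(q) (type Ia). If O = W, the relations a_x = b_y either exist
    for every x and then give the isomorphism V/W -> W of type IIa, or only for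
    x in W, which is type IIc. If every omega(p) is nondegenerate, V has a
    relation, for otherwise it would be irreducible; then omega_x = omega'_y
    is the graph of an injective equivariant partial operator T. Shifts T - c
    would give infinite chains of subrepresentations unless the domain U and
    the image U' of T are distinct composition factors, and V = U + U' is of
    type III.

    Conversely each type carries enough automorphisms: reflections in vectors
    of ker a (Ia, Ib, IIb), reflections over the dual numbers k[T]/(T^2) (IIa),
    transvections by vectors of ker(V) (Ic), lifts from the direct summands or
    the quotient (Ib, Ic, III), and back-and-forth (the top factor in IIb and
    IIc, the bottom one in IIc, and every universal homogeneous piece). *)

(** * Linear spans and linear maps from graphs *)
Section Spans.
Variables (k : fieldType) (V : lmodType k).
Implicit Types (s t : seq V) (x y : V) (P : V -> Prop).

(** Defined by recursion on the list, so that extending a partial isometry by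
    one vector is just consing a pair on a list of pairs. *)
Fixpoint in_span s x : Prop :=
  if s is a :: s' then exists c : k, in_span s' (x - c *: a) else x = 0.

Definition subspace P : Prop := P 0 /\ forall c x y, P x -> P y -> P (c *: x + y).

Lemma subspace0 P : subspace P -> P 0. Proof. by case. Qed.

Lemma subspaceZ P c x : subspace P -> P x -> P (c *: x).
Proof. by case=> P0 PL Px; rewrite -[c *: x]addr0; apply: PL. Qed.

Lemma subspaceD P x y : subspace P -> P x -> P y -> P (x + y).
Proof. by case=> P0 PL Px Py; rewrite -[x]scale1r; apply: PL. Qed.

Lemma subspaceN P x : subspace P -> P x -> P (- x).
Proof. by move=> sP Px; rewrite -scaleN1r; apply: subspaceZ. Qed.

Lemma subspaceB P x y : subspace P -> P x -> P y -> P (x - y).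
Proof. by move=> sP Px Py; apply: subspaceD => //; apply: subspaceN. Qed.

Lemma subspace_span s : subspace (in_span s).
Proof.
elim: s => [|a s [s0 sL]]; first by split=> //= c x y -> ->; rewrite scaler0 addr0.
split; first by exists 0; rewrite scale0r subr0.
move=> c x y [d dx] [e ey]; exists (c * d + e).
have -> : c *: x + y - (c * d + e) *: a = c *: (x - d *: a) + (y - e *: a).
  by rewrite scalerDl scalerBr scalerA opprD addrACA.
exact: sL.
Qed.

Lemma span_tail a s x : in_span s x -> in_span (a :: s) x.
Proof. by move=> sx; exists 0; rewrite scale0r subr0. Qed.

Lemma span_mem s x : x \in s -> in_span s x.
Proof.
elim: s => // a s IH; rewrite inE => /predU1P[-> | /IH]; last exact: span_tail.
by exists 1; rewrite scale1r subrr; apply: subspace0 (subspace_span s).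
Qed.

Lemma span_head a s : in_span (a :: s) a.
Proof. by apply: span_mem; rewrite mem_head. Qed.

Lemma span_consP a s x : in_span (a :: s) x <-> exists c y, in_span s y /\ x = c *: a + y.
Proof.
split=> [[c sc] | [c [y [sy ->]]]]; last by exists c; rewrite addrAC subrr add0r.
by exists c, (x - c *: a); split; rewrite // addrC subrK.
Qed.

Lemma span_min s P : subspace P -> (forall x, x \in s -> P x) ->
  forall x, in_span s x -> P x.
Proof.
move=> sP; elim: s => [|a s IH] sub x; first by move=> ->; apply: subspace0.
move=> /span_consP[c [y [/IH Py ->]]]; apply: subspaceD => //.
  by apply: subspaceZ => //; apply: sub; rewrite mem_head.
by apply: Py => z zs; apply: sub; rewrite inE zs orbT.
Qed.

Lemma span_sub s t : {subset s <= t} -> forall x, in_span s x -> in_span t x.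
Proof. by move=> st; apply: span_min (subspace_span t) _ => x /st; apply: span_mem. Qed.

Lemma span_sum s n (b : 'I_n -> V) (c : 'I_n -> k) :
  (forall i, c i != 0 -> in_span s (b i)) -> in_span s (\sum_i c i *: b i).
Proof.
move=> sb; apply: (big_ind (in_span s)).
- exact: subspace0 (subspace_span s).
- by move=> x y; apply: subspaceD (subspace_span s).
move=> i _; have [->|ci] := eqVneq (c i) 0.
  by rewrite scale0r; apply: subspace0 (subspace_span s).
by apply: subspaceZ (subspace_span s) _; apply: sb.
Qed.

Lemma span_nth s x : in_span s x ->
  exists c : 'I_(size s) -> k, x = \sum_i c i *: s`_i.
Proof.
elim: s x => [|a s IH] x /=; first by move=> ->; exists (fun=> 0); rewrite big_ord0.
case=> d /IH[c cE]; exists (fun i => if unlift ord0 i is Some j then c j else d).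
rewrite big_ord_recl unlift_none /=; apply: (addIr (- (d *: a))).
rewrite cE [RHS]addrAC subrr add0r; apply: eq_bigr => i _.
by rewrite liftK.
Qed.

(** In a classical setting a subspace given by a proposition is a bundled
    boolean one. *)
Definition submod_of P (sP : subspace P) : {pred V} := [pred x | `[< P x >]].

Fact submod_of_closed P (sP : subspace P) : submod_closed (submod_of sP).
Proof.
split=> [|c x y]; first by apply/asboolP; apply: subspace0.
by move=> /asboolP Px /asboolP Py; apply/asboolP; apply: (proj2 sP).
Qed.

HB.instance Definition _ P (sP : subspace P) :=
  GRing.isSubmodClosed.Build k V (submod_of sP) (submod_of_closed sP).

Definition to_submod P (sP : subspace P) : submodClosed V := submod_of sP.

Lemma to_submodP P (sP : subspace P) x : x \in to_submod sP <-> P x.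
Proof. by split=> /asboolP. Qed.

Lemma subspace_submod (S : submodClosed V) : subspace (fun x => x \in S).
Proof. by split=> [|c x y]; [apply: rpred0 | move=> Sx Sy; rewrite rpredD ?rpredZ]. Qed.

End Spans.

Section LinearGraphs.
Variable k : fieldType.

Section LinearFunction.
Variables (U V : lmodType k) (f : U -> V) (fL : linear f).
(** The linearity proof is an argument so that the bundled structure can be
    attached to this constant. *)
Definition lin_of_fun of linear f : U -> V := f.
HB.instance Definition _ := GRing.isSemilinear.Build k U V _
  (lin_of_fun fL) (GRing.semilinear_linear (fL : linear (lin_of_fun fL))).
Definition lin_of : {linear U -> V} := lin_of_fun fL.
End LinearFunction.

Lemma span_map (U V : lmodType k) (f : {linear U -> V}) s x :
  in_span s x -> in_span (map f s) (f x).
Proof.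
move: x; apply: span_min; last by move=> x xs; apply: span_mem; apply: map_f.
split; first by rewrite linear0; apply: subspace0 (subspace_span _).
by move=> c x y fx fy; rewrite linearP; apply: (proj2 (subspace_span _)).
Qed.

(** Automorphisms, projections and quotient maps are all built below from their
    graphs, which are easier to describe than the functions. *)
Lemma linear_graph (U V : lmodType k) (G : (U * V)%type -> Prop) :
  subspace G -> (forall x, exists y, G (x, y)) ->
  (forall y, G (0, y) -> y = 0) ->
  exists2 f : {linear U -> V}, (forall x, G (x, f x)) &
    forall x y, G (x, y) -> y = f x.
Proof.
move=> sG tot fun0; have [f Gf] := choice tot.
have uniqf x y : G (x, y) -> y = f x.
  move=> Gxy; apply/eqP; rewrite -subr_eq0; apply/eqP; apply: fun0.
  have := subspaceB sG Gxy (Gf x); rewrite /= -/(_ - _).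
  by congr G; congr pair; rewrite subrr.
have fL : linear f.
  move=> c x y; apply/esym; apply: uniqf.
  exact: (proj2 sG) c _ _ (Gf x) (Gf y).
by exists (lin_of fL).
Qed.

End LinearGraphs.

Section SubmoduleMembership.
Variables (k : fieldType) (V : lmodType k) (S : submodClosed V).
Implicit Types x y : V.

Lemma memB x y : x \in S -> y \in S -> x - y \in S.
Proof. exact: (subspaceB (subspace_submod S)). Qed.

Lemma memN x : (- x \in S) = (x \in S).
Proof.
have N z : z \in S -> - z \in S by exact: (subspaceN (subspace_submod S)).
by apply/idP/idP => /N; rewrite ?opprK.
Qed.

Lemma memDr x y : x \in S -> (x + y \in S) = (y \in S).
Proof.
move=> Sx; apply/idP/idP => Sy; last exact: rpredD.
by rewrite -[y](addKr x) addrC memB.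
Qed.

Lemma memZ c x : c != 0 -> (c *: x \in S) = (x \in S).
Proof.
move=> c0; apply/idP/idP => Sx; last exact: rpredZ.
by rewrite -[x](scalerK c0) rpredZ.
Qed.

End SubmoduleMembership.

(** * Symmetric forms and finite systems of linear equations *)
Section FormCalculus.
Variables (k : fieldType) (V : lmodType k) (w : {symmetric V}).

Lemma formDr x y z : w x (y + z) = w x y + w x z.
Proof. by have := form_linearr w x 1 y z; rewrite scale1r mul1r. Qed.

Lemma form0r x : w x 0 = 0.
Proof. by apply: (addIr (w x 0)); rewrite -formDr addr0 add0r. Qed.

Lemma formZr c x y : w x (c *: y) = c * w x y.
Proof. by have := form_linearr w x c y 0; rewrite !addr0 form0r addr0. Qed.

Lemma formNr x y : w x (- y) = - w x y.
Proof. by rewrite -scaleN1r formZr mulN1r. Qed.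

Lemma formDl x y z : w (x + y) z = w x z + w y z.
Proof. by rewrite formC formDr !(formC w z). Qed.

Lemma formZl c x y : w (c *: x) y = c * w x y.
Proof. by rewrite formC formZr (formC w y). Qed.

Lemma form0l x : w 0 x = 0. Proof. by rewrite formC form0r. Qed.

Lemma formNl x y : w (- x) y = - w x y.
Proof. by rewrite formC formNr (formC w y). Qed.

Definition formE := (formDr, formDl, formZr, formZl, formNr, formNl, form0r, form0l).

Lemma subspace_rad : subspace (fun x => forall y, w x y = 0).
Proof.
split=> [y | c x y wx wy z]; first exact: form0l.
by rewrite formDl formZl wx wy mulr0 addr0.
Qed.

End FormCalculus.

Section Doubling.
Variables (k : fieldType) (Z : lmodType k).

(** Pairs (y1, y2) of vectors of the span of s stand for functionals
    a_y1 + b_y2; this list spans them. *)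
Definition dbl (s : seq Z) : seq (Z * Z) :=
  [seq (e, 0) | e <- s] ++ [seq (0, e) | e <- s].

Lemma span_dbl s (y : Z * Z) : in_span (dbl s) y <-> in_span s y.1 /\ in_span s y.2.
Proof.
have s0 := subspace0 (subspace_span s).
split.
  move: y; apply: span_min.
    split=> // c x y [x1 x2] [y1 y2].
    by split; apply: (proj2 (subspace_span s)).
  move=> x; rewrite mem_cat => /orP[] /mapP[e es ->]; split=> //=; exact: span_mem.
case: y => y1 y2 /= [sy1 sy2].
have -> : (y1, y2) = (y1, 0) + (0, y2) by congr pair; rewrite /= ?addr0 ?add0r.
apply: subspaceD (subspace_span _) _ _.
  move: y1 sy1; apply: span_min.
    split=> [|c x y sx sy]; first exact: subspace0 (subspace_span _).
    have -> : (c *: x + y, 0) = c *: (x, 0) + (y, 0) :> Z * Z.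
      by congr pair; rewrite /= scaler0 addr0.
    exact: (proj2 (subspace_span _)).
  by move=> x xs; apply: span_mem; rewrite mem_cat map_f.
move: y2 sy2; apply: span_min.
  split=> [|c x y sx sy]; first exact: subspace0 (subspace_span _).
  have -> : (0, c *: x + y) = c *: (0, x) + (0, y) :> Z * Z.
    by congr pair; rewrite /= scaler0 addr0.
  exact: (proj2 (subspace_span _)).
by move=> x xs; apply: span_mem; rewrite mem_cat (map_f (pair 0)) ?orbT.
Qed.

End Doubling.

Section ScalarFunctions.
Variables (k : fieldType) (U : lmodType k).
Implicit Types f : U -> k.

Lemma linear_for0 f : linear_for *%R f -> f 0 = 0.
Proof.
move=> fL; have := fL 1 0 0; rewrite /= scaler0 addr0 mul1r => E.
by apply: (addIr (f 0)); rewrite -E add0r.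
Qed.

Lemma linear_forZ f c x :
  linear_for *%R f -> f (c *: x) = c * f x.
Proof. by move=> fL; have := fL c x 0; rewrite addr0 (linear_for0 fL) addr0. Qed.

Lemma linear_forD f x y :
  linear_for *%R f -> f (x + y) = f x + f y.
Proof. by move=> fL; have := fL 1 x y; rewrite scale1r mul1r. Qed.

Lemma linear_forB f x y :
  linear_for *%R f -> f (x - y) = f x - f y.
Proof.
by move=> fL; rewrite linear_forD // -scaleN1r linear_forZ // mulN1r.
Qed.

End ScalarFunctions.

Section Duality.
Variables (k : fieldType) (Y V : lmodType k) (B : Y -> V -> k).
Hypothesis Bl : forall u, linear_for *%R (B^~ u).
Hypothesis Br : forall y, linear_for *%R (B y).
Variable X : V -> Prop.
Hypothesis sX : subspace X.

Let Br0 y : B y 0 = 0. Proof. exact: linear_for0. Qed.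
Let BrZ y c u : B y (c *: u) = c * B y u. Proof. exact: linear_forZ. Qed.
Let BrD y u v : B y (u + v) = B y u + B y v. Proof. exact: linear_forD. Qed.
Let BrB y u v : B y (u - v) = B y u - B y v. Proof. exact: linear_forB. Qed.

Let Bl0 u : B 0 u = 0. Proof. exact: linear_for0 (Bl u). Qed.
Let BlZ y c u : B (c *: y) u = c * B y u. Proof. exact: linear_forZ (Bl u). Qed.
Let BlD y z u : B (y + z) u = B y u + B z u. Proof. exact: linear_forD (Bl u). Qed.
Let BlB y z u : B (y - z) u = B y u - B z u. Proof. exact: linear_forB (Bl u). Qed.

Lemma annihilator_dec (s : seq Y) a :
  (exists w, [/\ X w, forall y, y \in s -> B y w = 0 & B a w = 1]) \/
  (forall w, X w -> (forall y, y \in s -> B y w = 0) -> B a w = 0).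
Proof.
case: (pselect (exists w, [/\ X w, forall y, y \in s -> B y w = 0 & B a w <> 0])).
  move=> [w [Xw sw /eqP aw]]; left; exists ((B a w)^-1 *: w); split.
  - exact: subspaceZ.
  - by move=> y ys; rewrite BrZ (sw y) // mulr0.
  by rewrite BrZ mulVf.
move=> none; right=> w Xw sw; apply: contrapT => aw.
by apply: none; exists w.
Qed.

(** Induction on s: subtracting a multiple of B a from f makes it vanish on the
    common kernel of the shorter list. *)
Lemma functional_in_span (s : seq Y) (f : V -> k) : linear_for *%R f ->
  (forall u, X u -> (forall y, y \in s -> B y u = 0) -> f u = 0) ->
  exists y, in_span s y /\ forall u, X u -> f u = B y u.
Proof.
elim: s f => [|a s IH] f fL f0.
  by exists 0; split=> // u Xu; rewrite f0 // linear_for0.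
have [[w [Xw sw aw]] | nw] := annihilator_dec s a; last first.
  have [||y [sy fy]] := IH f => // [u Xu su|]; last first.
    by exists y; split=> //; apply: span_tail.
  by apply: f0 => // y; rewrite inE => /predU1P[-> | /su //]; apply: nw.
have [||y [sy fy]] := IH (fun u => f u - f w * B a u).
- by move=> c u v /=; rewrite fL Br /=; ring.
- move=> u Xu su.
  have -> : f u - f w * B a u = f (u - B a u *: w).
    by rewrite (linear_forB _ _ fL) (linear_forZ _ _ fL) mulrC.
  apply: f0; first by apply: subspaceB => //; apply: subspaceZ.
  move=> y; rewrite inE BrB BrZ => /predU1P[-> | ys].
    by rewrite aw mulr1 subrr.
  by rewrite su // sw // mulr0 subrr.
exists (f w *: a + y); split.
  apply: (proj2 (subspace_span _)); [exact: span_head | exact: span_tail].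
move=> u Xu; rewrite BlD BlZ -fy //.
by rewrite addrC subrK.
Qed.

(** Finite-dimensional duality inside an infinite-dimensional space: finitely
    many linear equations are solvable in X as soon as their right-hand sides
    satisfy the relations which the left-hand sides satisfy on X. *)
Lemma linear_system s (l : Y -> k) : linear_for *%R l ->
  (forall y, in_span s y -> (forall u, X u -> B y u = 0) -> l y = 0) ->
  exists2 u, X u & forall y, in_span s y -> B y u = l y.
Proof.
move=> lL; elim: s => [_ | a s IH comp].
  by exists 0 => [|y -> //]; rewrite ?Br0 ?(linear_for0 lL) //; case: sX.
have [y sy|u0 Xu0 u0E] := IH; first by apply: comp; apply: span_tail.
suff [u Xu [uE ua]] : exists2 u, X u & (forall y, in_span s y -> B y u = l y) /\ B a u = l a.
  exists u => // y /span_consP[c [z [sz ->]]].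
  by rewrite Bl lL /= ua uE.
have [[w [Xw sw aw]] | nw] := annihilator_dec s a; last first.
  have [y [sy ay]] := functional_in_span (Br a) nw.
  exists u0 => //; split=> //; rewrite ay // u0E //; apply/eqP.
  rewrite eq_sym -subr_eq0 -(linear_forB _ _ lL); apply/eqP; apply: comp.
    apply: subspaceB (subspace_span _) _ _; [exact: span_head | exact: span_tail].
  by move=> u Xu; rewrite BlB ay // subrr.
exists (u0 + (l a - B a u0) *: w); first by apply: subspaceD => //; apply: subspaceZ.
split=> [y sy|]; rewrite BrD BrZ; last by rewrite aw; ring.
rewrite u0E //; suff -> : B y w = 0 by ring.
move: y sy; apply: span_min => //; split=> [|c x y xw yw]; first exact: linear_for0 (Bl w).
by rewrite Bl /= xw yw mulr0 addr0.
Qed.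

End Duality.

Lemma finite_codimension (k : fieldType) (Y V : lmodType k) (B : Y -> V -> k) (s : seq Y) :
  (forall y, linear_for *%R (B y)) ->
  exists t, forall x, exists2 e, in_span t e & forall y, y \in s -> B y (x - e) = 0.
Proof.
move=> Br; elim: s => [|a s [t tE]].
  by exists [::] => x; exists 0.
have sT : subspace (fun _ : V => True) by [].
have [[w [_ sw aw]] | nw] := annihilator_dec Br sT s a; last first.
  exists t => x; have [e te ex] := tE x; exists e => // y.
  by rewrite inE => /predU1P[-> | /ex //]; apply: nw.
exists (w :: t) => x; have [e te ex] := tE x.
exists (B a (x - e) *: w + e).
  by apply/span_consP; exists (B a (x - e)), e.
move=> y; rewrite opprD addrA addrAC (linear_forB _ _ (Br y)) (linear_forZ _ _ (Br y)) inE.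
move=> /predU1P[-> | ys]; first by rewrite aw mulr1 subrr.
by rewrite sw // mulr0 subr0 ex.
Qed.

(** * Quadratic equations in full pencils *)
Section FullPencils.
Variables (k : fieldType) (V : lmodType k).
Implicit Types (a b : {symmetric V}) (F : seq V).

Definition perp a b F x : Prop := forall e, e \in F -> a e x = 0 /\ b e x = 0.

Lemma subspace_perp a b F : subspace (perp a b F).
Proof.
split=> [e _ | c x y xF yF e eF]; first by rewrite !formE.
by rewrite !formE; have [-> ->] := xF e eF; have [-> ->] := yF e eF; rewrite mulr0 addr0.
Qed.

Lemma perp_span a b F x e : perp a b F x -> in_span F e -> a e x = 0 /\ b e x = 0.
Proof.
move=> xF; move: e; apply: span_min => //.
split=> [|c y z [y1 y2] [z1 z2]]; first by rewrite !formE.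
by rewrite !formE y1 y2 z1 z2 mulr0 addr0.
Qed.

Lemma perp_cons a b F e x : perp a b (e :: F) x -> [/\ a e x = 0, b e x = 0 & perp a b F x].
Proof.
move=> xF; have [e1 e2] := xF e (mem_head _ _); split=> // y yF.
by apply: xF; rewrite inE yF orbT.
Qed.

(** A form has infinite rank exactly when it is nonzero on every subspace of
    finite codimension. Only subspaces of the form F^perp are tested, as these
    suffice and pass to smaller ones at once. *)
Definition full a b : Prop := forall c d, (c != 0) || (d != 0) ->
  forall F, exists2 x, perp a b F x & c * a x x + d * b x x != 0.

Lemma full_sym a b : full a b -> full b a.
Proof.
move=> fab c d cd F; have [|x xF cdx] := fab d c _ F; first by rewrite orbC.
by exists x; [move=> e /xF[] | rewrite addrC].
Qed.

End FullPencils.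

Section QuadraticEquations.
Variables (k : closedFieldType) (k2 : 2%:R != 0 :> k).

Lemma square_root (c : k) : exists r, r * r = c.
Proof.
have [//|r] := @solve_monicpoly k 2 (fun i => if i is 0 then c else 0).
by rewrite !big_ord_recl big_ord0 /= expr2 expr0 mulr1 mul0r !addr0; exists r.
Qed.

Variable V : lmodType k.
Implicit Types (a b : {symmetric V}) (F : seq V).

Lemma polarization a (x y : V) : a x x = 0 -> a y y = 0 -> a (x + y) (x + y) = 0 -> a x y = 0.
Proof.
move=> x0 y0; rewrite !formE x0 y0 add0r addr0 (formC a y) => /eqP.
by rewrite -mulr2n -mulr_natr mulf_eq0 (negPf k2) orbF => /eqP.
Qed.

Lemma form_sqD a (x y : V) : a x y = 0 -> a (x + y) (x + y) = a x x + a y y.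
Proof. by move=> xy; rewrite !formE (formC a y) xy addr0 add0r. Qed.

(** On the line y + t v the quadratic form b has two distinct zeros when the
    discriminant is nonzero, while g(y + t v) is affine in t because g(v,v) = 0;
    vanishing at both zeros, it vanishes identically. *)
Lemma two_roots_vanish (b g : {symmetric V}) (v y : V) :
  b v v != 0 -> g v v = 0 ->
  (forall t, b (y + t *: v) (y + t *: v) = 0 -> g (y + t *: v) (y + t *: v) = 0) ->
  b y v * b y v - b y y * b v v != 0 -> g y y = 0.
Proof.
move=> bv gv bg disc; have [r rE] := square_root (b y v * b y v - b y y * b v v).
have rn0 : r != 0 by apply: contraNneq disc => r0; rewrite -rE r0 mul0r.
have key s : s * s = r * r -> g y y + 2%:R * ((s - b y v) / b v v) * g y v = 0.
  move=> sE; pose t := (s - b y v) / b v v; have := bg t.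
  rewrite !formE gv (formC g v) (formC b v).
  have -> : b y y + t * b y v + (t * b y v + t * (t * b v v)) = 0.
    have -> : b y y + t * b y v + (t * b y v + t * (t * b v v)) =
              (s * s - (b y v * b y v - b y y * b v v)) / b v v.
      by rewrite /t; field.
    by rewrite sE rE subrr mul0r.
  move=> /(_ erefl) <-; rewrite -/t; ring.
have e1 := key r erefl; have e2 := key (- r) (mulrNN r r).
have gyv : g y v = 0.
  have : 2%:R * (2%:R * (r / b v v * g y v)) = 0.
    apply: etrans (subrr 0); rewrite -{1}e1 -e2; field; exact: bv.
  move/eqP; rewrite !mulf_eq0 !(negPf k2) (negPf rn0) invr_eq0 (negPf bv) /=.
  by move/eqP.
by move: e1; rewrite gyv mulr0 addr0.
Qed.

Lemma poly_all_roots (p : {poly k}) : (forall s, p.[s] = 0) -> p = 0.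
Proof.
move=> p0; apply/eqP; apply/negPn/negP => /closed_nonrootP[x].
by rewrite /root p0 eqxx.
Qed.

(** If every b-isotropic vector of F^perp were a-isotropic, then a would be a
    multiple of b on F^perp: for v with b(v,v) nonzero, g = a - c b with
    g(v,v) = 0 vanishes at every y of nonzero discriminant by
    [two_roots_vanish]. But on the line through some x0 of nonzero discriminant
    in a direction x with g(x,x) nonzero, the discriminant D and g are nonzero
    polynomials, so their product cannot have all values 0. *)
Lemma full_norm10 a b F : full a b ->
  exists u, [/\ perp a b F u, a u u = 1 & b u u = 0].
Proof.
move=> fab; apply: contrapT => none.
have iso u : perp a b F u -> b u u = 0 -> a u u = 0.
  move=> uF bu; apply: contrapT => /eqP au; apply: none.
  have [r rE] := square_root (a u u)^-1.
  exists (r *: u); split; first exact: subspaceZ (subspace_perp a b F) uF.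
    by rewrite !formE mulrA rE mulVf.
  by rewrite !formE bu !mulr0.
have [|v vF] := fab 0 1 _ F; first by rewrite oner_eq0 orbT.
rewrite mul0r add0r mul1r => bv; pose c := a v v / b v v.
pose g := comb_form 1 (- c) a b.
have gE x y : g x y = a x y - c * b x y by rewrite /g /= /mk_form_fun mul1r mulNr.
have gv : g v v = 0 by rewrite gE /c divfK ?subrr.
have [|x xF] := fab 1 (- c) _ F; first by rewrite oner_eq0.
rewrite mul1r mulNr -gE => gx.
have [|x0 /perp_cons[_ bx0 x0F]] := fab 0 1 _ (v :: F); first by rewrite oner_eq0 orbT.
rewrite mul0r add0r mul1r => bx00.
pose q (f : {symmetric V}) : {poly k} :=
  (f x x) *: 'X^2 + (2%:R * f x0 x) *: 'X + (f x0 x0)%:P.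
have qE f s : (q f).[s] = f (x0 + s *: x) (x0 + s *: x).
  by rewrite /q !(hornerD, hornerZ, hornerXn, hornerX, hornerC) !formE (formC f x); ring.
pose D : {poly k} := (b x v *: 'X) ^+ 2 - b v v *: q b.
have DE s : D.[s] = b (x0 + s *: x) v * b (x0 + s *: x) v - b (x0 + s *: x) (x0 + s *: x) * b v v.
  rewrite /D hornerD hornerN horner_exp !hornerZ hornerX qE !formE (formC b x0 v) bx0; ring.
have Dn0 : D != 0.
  apply/eqP => D0; have := DE 0; rewrite D0 horner0 scale0r addr0 (formC b x0 v) bx0.
  by rewrite mul0r sub0r => /esym/eqP; rewrite oppr_eq0 mulf_eq0 (negPf bv) (negPf bx00).
have qn0 : q g != 0.
  apply/eqP => q0; have : (q g)`_2 = 0 by rewrite q0 coef0.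
  by rewrite /q !coefE /= !mulr0 !addr0 mulr1 => /eqP; apply/negP.
suff /eqP : D * q g = 0 by rewrite mulf_eq0 (negPf Dn0) (negPf qn0).
apply: poly_all_roots => s; rewrite hornerM qE DE.
set y := x0 + s *: x.
have [->|dn0] := eqVneq (b y v * b y v - b y y * b v v) 0; first by rewrite mul0r.
rewrite (two_roots_vanish bv gv _ dn0) ?mulr0 // => t bt.
rewrite gE bt mulr0 subr0; apply: iso => //.
have sF := subspace_perp a b F.
apply: (subspaceD sF); last exact: (subspaceZ _ sF).
by apply: (subspaceD sF) => //; apply: (subspaceZ _ sF).
Qed.

Lemma full_norm01 a b F : full a b ->
  exists u, [/\ perp a b F u, a u u = 0 & b u u = 1].
Proof.
move=> /full_sym/(full_norm10 F)[u [uF bu au]].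
by exists u; split=> // e /uF[].
Qed.

(** Taking u - x0 orthogonal to x0 and F removes the linear terms, so that it is
    enough to add orthogonal vectors of norms (1,0) and (0,1). Two of each are
    used: u1 and u2 have coefficient 1 and detect c and d in the last clause,
    while v1 and v2 adjust the norms. The last clause says that a_u and b_u are
    independent modulo the functionals coming from F; it is what makes u a
    generic vector. *)
Lemma full_translate a b F x0 (m n : k) : full a b ->
  exists u, [/\ perp a b F (u - x0), a u u = m, b u u = n &
    forall c d p q, in_span F p -> in_span F q ->
      (forall z, c * a u z + d * b u z + a p z + b q z = 0) -> c = 0 /\ d = 0].
Proof.
move=> fab; pose F0 := x0 :: F.
have [u1 [u1F au1 bu1]] := full_norm10 F0 fab.
have [v1 [v1F av1 bv1]] := full_norm10 (u1 :: F0) fab.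
have [u2 [u2F au2 bu2]] := full_norm01 (v1 :: u1 :: F0) fab.
have [v2 [v2F av2 bv2]] := full_norm01 (u2 :: v1 :: u1 :: F0) fab.
have [r rE] := square_root (m - a x0 x0 - 1).
have [s sE] := square_root (n - b x0 x0 - 1).
pose w := u1 + r *: v1 + u2 + s *: v2.
have [] := perp_cons u1F; have [] := perp_cons v1F; have [] := perp_cons u2F.
have [] := perp_cons v2F.
move=> a1 b1 /perp_cons[a2 b2 /perp_cons[a3 b3 /perp_cons[a4 b4 v2F']]].
move=> a5 b5 /perp_cons[a6 b6 /perp_cons[a7 b7 u2F']].
move=> a8 b8 /perp_cons[a9 b9 v1F'] a10 b10 u1F'.
have sF := subspace_perp a b F.
have wF : perp a b F w.
  rewrite /w; apply: (subspaceD sF); last exact: (subspaceZ _ sF).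
  by do 2?apply: (subspaceD sF) => //; apply: (subspaceZ _ sF).
exists (x0 + w); split.
- by rewrite addrC addKr.
- rewrite /w !addrA !form_sqD; try by rewrite ?formE ?a1 ?a2 ?a3 ?a4 ?a5 ?a6 ?a7 ?a8 ?a9 ?a10; ring.
  by rewrite !formE au1 av1 au2 av2 mulr1 rE; ring.
- rewrite /w !addrA !form_sqD; try by rewrite ?formE ?b1 ?b2 ?b3 ?b4 ?b5 ?b6 ?b7 ?b8 ?b9 ?b10; ring.
  by rewrite !formE bu1 bv1 bu2 bv2 mulr1 sE; ring.
move=> c d p q Fp Fq rel; split.
  have := rel u1; have [-> _] := perp_span u1F' Fp; have [_ ->] := perp_span u1F' Fq.
  rewrite /w !formE (formC a v1) (formC b v1) (formC a u2 u1) (formC b u2 u1).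
  rewrite (formC a v2) (formC b v2) a10 b10 a8 b8 a6 b6 a3 b3 au1 bu1.
  by rewrite !(mulr0, addr0, add0r, mulr1).
have := rel u2; have [-> _] := perp_span u2F' Fp; have [_ ->] := perp_span u2F' Fq.
rewrite /w !formE (formC a v2) (formC b v2) a7 b7 a6 b6 a5 b5 a1 b1 au2 bu2.
by rewrite !(mulr0, addr0, add0r, mulr1).
Qed.

End QuadraticEquations.

(** A spanning list of least length is a basis. *)
Lemma finite_dimP (k : fieldType) (V : lmodType k) :
  finite_dim V <-> exists s : seq V, forall x, in_span s x.
Proof.
split=> [[B [[_ gen] /finite_seqP[s BE]]] | ].
  exists s => x; have [n [b [c [Bb ->]]]] := gen x.
  by apply: span_sum => i _; apply: span_mem; have := Bb i; rewrite BE.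
move=> exs; pose spans n := `[< exists2 s : seq V, size s = n & forall x, in_span s x >].
have exn : exists n, spans n.
  by have [s sE] := exs; exists (size s); apply/asboolP; exists s.
case: (ex_minnP exn) => n /asboolP[s sn sE] nmin.
exists [set` s]; split; last by apply/finite_seqP; exists s.
split=> [m b c binj Bb sum0 i | x]; last first.
  have [c ->] := span_nth (sE x).
  by exists (size s), (fun i => s`_i), c; split=> // i; apply: mem_nth.
apply: contrapT => /eqP ci; pose s' := [seq x <- s | x != b i].
have [s'E|] := pselect (forall x, in_span s' x); last first.
  case=> x; move: (sE x); apply: span_min (subspace_span _) _ _ => y ys.
  have [->|ybi] := eqVneq y (b i); last by apply: span_mem; rewrite mem_filter ybi.
  have -> : b i = - (c i)^-1 *: \sum_(j < m) (if j == i then 0 else c j) *: b j.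
    apply: (scalerI ci); rewrite scalerA mulrN mulfV // scaleN1r; apply/eqP.
    rewrite -addr_eq0 -[X in _ == X]sum0 (bigD1 i) //= [X in _ == X](bigD1 i) //=.
    rewrite eqxx scale0r add0r; apply/eqP; congr (_ + _); apply: eq_bigr => j ji.
    by rewrite (negPf ji).
  apply: subspaceZ (subspace_span _) _; apply: span_sum => j.
  have [_|ji _] := eqVneq j i; first by rewrite eqxx.
  apply: span_mem; rewrite mem_filter; apply/andP; split; last exact: Bb.
  by apply: contra ji => /eqP/binj->.
have /nmin : spans (size s') by apply/asboolP; exists s'.
rewrite -sn size_filter -(count_predC (fun x => x != b i)) -[leqRHS]addn0 leq_add2l leqn0.
by rewrite -leqn0 leqNgt -has_count => /hasP; apply; exists (b i); [exact: Bb | rewrite /= eqxx].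
Qed.

Lemma infinite_dimP (k : fieldType) (V : lmodType k) :
  infinite_dim V <-> forall s : seq V, exists x, ~ in_span s x.
Proof.
split=> [inf s | inf /finite_dimP[s sE]]; last by have [x] := inf s; apply.
apply: contrapT => none; apply/inf/finite_dimP; exists s => x.
by apply: contrapT => nx; apply: none; exists x.
Qed.

Lemma perp_codimension (k : fieldType) (V : lmodType k) (a b : {symmetric V}) F :
  exists t, forall x, exists2 e, in_span t e & perp a b F (x - e).
Proof.
pose B (y : V * V) u := a y.1 u + b y.2 u.
have Br y : linear_for *%R (B y) by move=> c u v; rewrite /B !formE; ring.
have [t tE] := finite_codimension (dbl F) Br.
exists t => x; have [e te ex] := tE x; exists e => // f fF; split.
  have := ex (f, 0); rewrite /B /= form0l addr0; apply.
  by rewrite mem_cat (map_f (fun e => (e, 0))).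
have := ex (0, f); rewrite /B /= form0l add0r; apply.
by rewrite mem_cat (map_f (pair 0)) ?orbT.
Qed.

(** * Extending partial isometries by one vector *)
Section Polarization.
Variables (k : closedFieldType) (k2 : 2%:R != 0 :> k).

(** If g = c a + d b were isotropic on F^perp, it would vanish identically
    there, and adding to F finitely many vectors t which span modulo F^perp
    would put (F ++ t)^perp in the kernel of g, so that the kernel has finite
    codimension. *)
Lemma full_of_infinite_rank (V : lmodType k) (a b : {symmetric V}) (c d : k) :
  (forall t, exists x, forall e, in_span t e ->
     exists z, c * a (x - e) z + d * b (x - e) z != 0) ->
  forall F, exists2 x, perp a b F x & c * a x x + d * b x x != 0.
Proof.
move=> inf F; apply: contrapT => none; pose g := comb_form c d a b.
have gE x y : g x y = c * a x y + d * b x y by [].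
have g0 x : perp a b F x -> g x x = 0.
  by move=> xF; apply: contrapT => /eqP gx; apply: none; exists x.
have g00 x y : perp a b F x -> perp a b F y -> g x y = 0.
  move=> xF yF; apply: (polarization k2); rewrite ?g0 //.
  exact: subspaceD (subspace_perp a b F) _ _.
have [t tE] := perp_codimension a b F.
have [t' t'E] := perp_codimension a b (F ++ t).
have [x xinf] := inf t'; have [e te xe] := t'E x.
have [z] := xinf e te; rewrite -gE => /eqP; apply.
have xF : perp a b F (x - e) by move=> f fF; apply: xe; rewrite mem_cat fF.
have [f tf zf] := tE z; rewrite -(subrK f z) formDr g00 // add0r.
rewrite gE !(formC _ (x - e)).
have [|-> ->] := @perp_span _ _ a b t (x - e) f _ tf; last by rewrite !mulr0 addr0.
by move=> h ht; apply: xe; rewrite mem_cat ht orbT.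
Qed.

Lemma quadratic_inj (U V : lmodType k) (f : {linear U -> V})
    (w : {symmetric U}) (w' : {symmetric V}) :
  (forall x, w' (f x) (f x) = w x x) -> forall x y, w' (f x) (f y) = w x y.
Proof.
move=> q x y; have := q (x + y); rewrite linearD !formE !q (formC w y) (formC w' (f y)).
move=> E; have /eqP : 2%:R * (w' (f x) (f y) - w x y) = 0.
  by apply: etrans (subrr (w x x + w x y + (w x y + w y y))); rewrite -{1}E; ring.
by rewrite mulf_eq0 (negPf k2) /= subr_eq0 => /eqP.
Qed.

End Polarization.

Section Extension.
Variables (k : closedFieldType) (k2 : 2%:R != 0 :> k).
Variables (V1 V2 : lmodType k).
Variables (a1 b1 : {symmetric V1}) (a2 b2 : {symmetric V2}).
Implicit Type s : seq (V1 * V2).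

Lemma span_snd s v : in_span s v -> in_span [seq e.2 | e <- s] v.2.
Proof.
move: v; apply: span_min => [|v vs]; last by apply/span_mem/map_f.
split=> [|c x y]; first exact: subspace0 (subspace_span _).
exact: (proj2 (subspace_span _)).
Qed.

(** The extension step: s is a list of pairs (source, target) and x a new
    source. A vector u0 with the right pairings against the targets exists by
    duality, and [full_translate] then corrects its norms. *)
Lemma paired_vector s x : full a2 b2 ->
  (forall v v', in_span s v -> in_span s v' ->
     (forall z, a2 v.2 z + b2 v'.2 z = 0) -> a1 v.1 x + b1 v'.1 x = 0) ->
  exists u, [/\ a2 u u = a1 x x, b2 u u = b1 x x,
    forall v, in_span s v -> a2 v.2 u = a1 v.1 x /\ b2 v.2 u = b1 v.1 x &
    forall c d v v', in_span s v -> in_span s v' ->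
      (forall z, c * a2 u z + d * b2 u z + a2 v.2 z + b2 v'.2 z = 0) ->
      c = 0 /\ d = 0].
Proof.
move=> fab comp.
pose Z := (V1 * V2)%type.
(* The two components of y : Z * Z carry the equations for a2 and for b2. *)
pose B (y : Z * Z) u := a2 y.1.2 u + b2 y.2.2 u.
pose l (y : Z * Z) := a1 y.1.1 x + b1 y.2.1 x.
have Bl u : linear_for *%R (B^~ u) by move=> c y z; rewrite /B /= !formE; ring.
have Br y : linear_for *%R (B y) by move=> c u v; rewrite /B /= !formE; ring.
have lL : linear_for *%R l by move=> c y z; rewrite /l /= !formE; ring.
have sT : subspace (fun _ : V2 => True) by [].
have [|u0 _ u0E] := linear_system Bl Br sT (s := dbl s) lL.
  move=> y /span_dbl[y1 y2] y0; apply: comp => // z; exact: (y0 z).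
have [u [uF au bu ind]] := full_translate k2 [seq e.2 | e <- s] u0 (a1 x x) (b1 x x) fab.
exists u; split=> // [v vs | c d v v' /span_snd vs /span_snd vs']; last exact: ind.
have s0 := subspace0 (subspace_span s).
have [h1 h2] := perp_span uF (span_snd vs).
rewrite -(subrK u0 u) !(formDr _ _ (u - u0)) h1 h2 !add0r; split.
  have := u0E (v, 0); rewrite /B /l /= !form0l !addr0; apply.
  by apply/span_dbl.
have := u0E (0, v); rewrite /B /l /= !form0l !add0r; apply.
by apply/span_dbl.
Qed.

End Extension.

Lemma bijective_of_surj (T T' : choiceType) (f : T -> T') :
  injective f -> (forall y, exists x, f x = y) -> bijective f.
Proof.
move=> finj /choice[g gK]; exists g => // x.
by apply: finj; rewrite gK.
Qed.

Lemma lin_injective (k : fieldType) (U V : lmodType k) (f : {linear U -> V}) :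
  (forall x, f x = 0 -> x = 0) -> injective f.
Proof.
move=> f0 x y fxy; apply/eqP; rewrite -subr_eq0; apply/eqP; apply: f0.
by rewrite linearB fxy subrr.
Qed.

Definition countably_spanned (k : fieldType) (V : lmodType k) : Prop :=
  exists b : nat -> V, forall x, exists n, in_span (mkseq b n) x.

(** * Back-and-forth *)
Section BackAndForth.
Variables (k : closedFieldType) (k2 : 2%:R != 0 :> k).
Variables (V : lmodType k) (a b : {symmetric V}).
Let W x := forall z, a x z = 0.

Hypothesis rel0 : forall x y, (forall z, a x z + b y z = 0) -> y = 0.
Hypothesis fab : full a b.

(** In the second case b is nondegenerate on W, in the third it is zero on W. In
    these two cases the orthogonal complement of W for b is 0 or W, so a partial
    isometry which preserves W preserves it too, as extending by a vector of W
    requires. *)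
Hypothesis perpW :
  [\/ forall x, W x -> x = 0,
      forall x, (forall w, W w -> b x w = 0) -> x = 0 |
      (forall w w', W w -> W w' -> b w w' = 0) /\
      (forall x, (forall w, W w -> b x w = 0) -> W x)].

Definition partial_aut (s : seq (V * V)) : Prop := forall v, in_span s v ->
  [/\ v.1 = 0 <-> v.2 = 0, W v.1 <-> W v.2,
      a v.1 v.1 = a v.2 v.2 & b v.1 v.1 = b v.2 v.2].

Let sW : subspace W. Proof. exact: subspace_rad. Qed.

Lemma partial_aut_cons s x y : partial_aut s ->
  (forall v, in_span s v -> a v.1 x = a v.2 y /\ b v.1 x = b v.2 y) ->
  a x x = a y y -> b x x = b y y ->
  (forall v, in_span s v ->
     (x + v.1 = 0 <-> y + v.2 = 0) /\ (W (x + v.1) <-> W (y + v.2))) ->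
  partial_aut ((x, y) :: s).
Proof.
move=> gs xy axy bxy zW v /span_consP[c [w [ws ->]]].
have [w0 wW aw bw] := gs w ws; have [axw bxw] := xy w ws.
split=> /=; last 2 first.
- by rewrite !formE (formC a x) (formC a y) axy aw axw.
- by rewrite !formE (formC b x) (formC b y) bxy bw bxw.
- have [->|cn0] := eqVneq c 0; first by rewrite !scale0r !add0r.
  have cw (z z' : V) : (c *: z + z' = 0) <-> (z + c^-1 *: z' = 0).
    split=> E; last by rewrite -[z'](scalerKV cn0) -scalerDr E scaler0.
    by apply: (scalerI cn0); rewrite scalerDr scalerKV // E scaler0.
  by rewrite !cw; apply: (proj1 (zW _ (subspaceZ c^-1 (subspace_span s) ws))).
have [->|cn0] := eqVneq c 0; first by rewrite !scale0r !add0r.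
have cw (z z' : V) : W (c *: z + z') <-> W (z + c^-1 *: z').
  split=> E; last by rewrite -[z'](scalerKV cn0) -scalerDr; apply: (subspaceZ _ sW).
  have -> : z + c^-1 *: z' = c^-1 *: (c *: z + z') by rewrite scalerDr scalerK.
  exact: (subspaceZ _ sW).
by rewrite !cw; apply: (proj2 (zW _ (subspaceZ c^-1 (subspace_span s) ws))).
Qed.

Lemma partial_aut_sub s t : (forall v, in_span t v -> in_span s v) ->
  partial_aut s -> partial_aut t.
Proof. by move=> ts gs v /ts; apply: gs. Qed.

(** By [rel0] the only relations between the functionals of the targets come from
    targets in W, and these match sources in W, for which a_x gives the same
    relation. *)
Lemma extend_generic s x : partial_aut s ->
  (forall v, in_span s v -> ~ W (x + v.1)) -> exists y, partial_aut ((x, y) :: s).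
Proof.
move=> gs xW.
have [|u [au bu su ind]] := @paired_vector _ k2 _ _ a b a b s x fab.
  move=> v v' vs v's rel.
  have v'20 := rel0 rel; have [v'0 _ _ _] := gs _ v's.
  have Wv : W v.2 by move=> z; have := rel z; rewrite v'20 form0l addr0.
  have [_ vW _ _] := gs _ vs.
  by rewrite (proj2 v'0 v'20) form0l addr0 (proj2 vW Wv).
exists u; apply: partial_aut_cons => // [v vs | v vs].
  by have [-> ->] := su v vs.
have nW : ~ W (u + v.2).
  move=> Wuv; have s0 := subspace0 (subspace_span s).
  have [z|/eqP] := ind 1 0 v 0 vs s0; last by rewrite oner_eq0.
  by have := Wuv z; rewrite !formE mul0r mul1r !addr0.
have W0 := subspace0 sW; split; split=> E.
- by case: (xW v vs); rewrite E.
- by case: nW; rewrite E.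
- by case: (xW v vs).
by case: nW.
Qed.

(** Nondegeneracy of b on W lets one pair vectors of W with any functional given
    by a vector, in particular with one taking the value 1 on a vector e which
    is orthogonal to F and not in W. *)
Lemma rad_norm_vector (F : seq V) :
  (forall x, (forall w, W w -> b x w = 0) -> x = 0) ->
  exists z, [/\ W z, forall f, in_span F f -> b f z = 0 & b z z != 0].
Proof.
move=> nd.
have Bl u : linear_for *%R (b^~ u) by move=> c y z /=; rewrite !formE.
have Br y : linear_for *%R (b y) by move=> c u v; rewrite !formE.
have solve (s : seq V) l : linear_for *%R l ->
    exists2 u, W u & forall y, in_span s y -> b y u = l y.
  move=> lL; apply: (linear_system Bl Br sW lL) => y _ /nd ->.
  exact: linear_for0.
have [|e eF] := fab (c := 1) (d := 0) _ F; first by rewrite oner_eq0.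
rewrite mul0r mul1r addr0 => ae.
have [|z Wz zE] := solve (e :: F) (fun y => (a e e)^-1 * a e y).
  by move=> c u v; rewrite !formE; ring.
have zF f : in_span F f -> b f z = 0.
  move=> Ff; rewrite zE; last exact: span_tail.
  by have [fe _] := perp_span eF Ff; rewrite (formC a e f) fe mulr0.
have ez : b e z = 1 by rewrite zE ?mulVf //; apply: span_head.
have [bz|bz] := eqVneq (b z z) 0; last by exists z.
have [|z' Wz' z'E] := solve (z :: F) (b e); first by [].
have z'F f : in_span F f -> b f z' = 0.
  move=> Ff; rewrite z'E; last exact: span_tail.
  by have [_ fe] := perp_span eF Ff; rewrite formC.
have zz' : b z z' = 1 by rewrite z'E //; apply: span_head.
have [bz'|bz'] := eqVneq (b z' z') 0; last by exists z'.
exists (z + z'); split; first exact: (subspaceD sW).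
  by move=> f Ff; rewrite formDr zF // z'F // addr0.
by rewrite !formE bz bz' (formC b z') zz' add0r addr0 -mulr2n.
Qed.

(** The target must lie in W, must pair as w does and must avoid the span of the
    targets. The vector e, orthogonal to all targets but not a-isotropic, takes
    care of the last point: a target pairing to 1 with e is outside the span. *)
Lemma extend_rad s w : partial_aut s -> W w ->
  (forall v, in_span s v -> v.1 <> w) -> exists y, partial_aut ((w, y) :: s).
Proof.
move=> gs Ww ws; have s0 := subspace0 (subspace_span s).
have [|e eF] := fab (c := 1) (d := 0) _ [seq v.2 | v <- s]; first by rewrite oner_eq0.
rewrite mul0r mul1r addr0 => ae.
have eperp v : in_span s v -> a v.2 e = 0 /\ b v.2 e = 0.
  by move=> vs; apply: (perp_span eF); apply: span_snd.
have perpWsub x : (forall u, W u -> b x u = 0) -> W x.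
  case: perpW => [W0|nd /nd ->|[_ nd] /nd //]; last exact: (subspace0 sW).
  by case: (ws 0 s0); rewrite (W0 w Ww).
have iso v : in_span s v -> (forall u, W u -> b v.2 u = 0) -> b v.1 w = 0.
  move=> vs vW; have [v0 Wv _ _] := gs v vs.
  case: perpW => [W0|nd|[isoW _]]; first by rewrite (W0 w Ww) form0r.
    by rewrite (proj2 v0 (nd _ vW)) form0l.
  by apply: isoW => //; apply/Wv/perpWsub.
pose B (y : V * V) u := b y.2 u.
(* The first coordinate is a source, the second a target; the entry (0, e)
   encodes the extra equation b(e,u) = 1. *)
pose l (y : V * V) := b y.1 w + (a e e)^-1 * a e y.2.
have Bl u : linear_for *%R (B^~ u) by move=> c y z; rewrite /B /= !formE.
have Br y : linear_for *%R (B y) by move=> c u v; rewrite /B /= !formE.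
have lL : linear_for *%R l by move=> c y z; rewrite /l /= !formE; ring.
have [|y0 Wy0 y0E] := linear_system Bl Br sW (s := (0, e) :: s) lL.
  move=> y /span_consP[c [v [vs ->]]]; rewrite /B /l /= scaler0 add0r => h.
  have := perpWsub _ h e; rewrite !formE (proj1 (eperp v vs)) addr0 => /eqP.
  rewrite mulf_eq0 (negPf ae) orbF => /eqP c0; move: h; rewrite c0 scale0r add0r => h.
  by rewrite (iso v vs h) add0r (formC a e v.2) (proj1 (eperp v vs)) mul0r addr0 mulr0.
have y0s v : in_span s v -> b v.2 y0 = b v.1 w.
  move=> vs; rewrite -[LHS]/(B v y0) y0E; last exact: span_tail.
  by rewrite /l (formC a e v.2) (proj1 (eperp v vs)) mulr0 addr0.
have y0e : b e y0 = 1.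
  have := y0E (0, e); rewrite /B /l /= form0l add0r mulVf //; apply.
  exact: span_head.
have finish y : W y -> (forall v, in_span s v -> b v.2 y = b v.1 w) -> b e y = 1 ->
    b w w = b y y -> partial_aut ((w, y) :: s).
  move=> Wy ys ye nwy; apply: partial_aut_cons => // [v vs||v vs].
  - by rewrite (ys v vs) !(formC a _ w) !(formC a _ y) Ww Wy.
  - by rewrite Ww Wy.
  have [_ Wv _ _] := gs v vs; split.
    split=> E; exfalso.
      apply: (ws (- v)); first exact: subspaceN (subspace_span s) vs.
      by apply/eqP; rewrite /= -subr_eq0 -opprD oppr_eq0 addrC E.
    have := formDr b e y v.2; rewrite E form0r ye (formC b e) (proj2 (eperp v vs)).
    by rewrite addr0 => /esym/eqP; rewrite oner_eq0.
  have WD x y' : W x -> W (x + y') <-> W y'.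
    move=> Wx; split=> [Wxy|]; last exact: (subspaceD sW).
    by rewrite -(addKr x y'); apply: (subspaceD sW) => //; apply: (subspaceN sW).
  by rewrite !WD.
case: perpW => [W0|nd|[isoW _]]; first by case: (ws 0 s0); rewrite (W0 w Ww).
  have [z [Wz zF bz]] := rad_norm_vector (e :: y0 :: [seq v.2 | v <- s]) nd.
  have [r rE] := square_root ((b w w - b y0 y0) / b z z).
  exists (y0 + r *: z); apply: finish.
  - by apply: (subspaceD sW) => //; apply: (subspaceZ _ sW).
  - move=> v vs; rewrite !formE y0s // zF ?mulr0 ?addr0 //.
    by do 2!apply: span_tail; apply: span_snd.
  - by rewrite !formE y0e zF ?mulr0 ?addr0 //; apply: span_head.
  have y0z : b y0 z = 0 by apply: zF; apply: span_tail; apply: span_head.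
  by rewrite !formE (formC b z) y0z !mulr0 addr0 add0r mulrA rE divfK // addrC subrK.
by exists y0; apply: finish => //; rewrite !isoW.
Qed.

(** If x lies in W modulo the sources, only its component in W is extended. *)
Lemma extend_forth s x : partial_aut s -> exists y, partial_aut ((x, y) :: s).
Proof.
move=> gs; have sS := subspace_span s.
have [[v [vs Wxv]]|none] := pselect (exists v, in_span s v /\ W (x + v.1)); last first.
  by apply: extend_generic => // v vs Wxv; apply: none; exists v.
have [[v' [v's E]]|none] := pselect (exists v', in_span s v' /\ v'.1 = x + v.1).
  exists (v' - v).2; apply: partial_aut_sub gs => u /span_consP[c [z [zs ->]]].
  have -> : x = (v' - v).1 by rewrite /= E addrK.
  rewrite -surjective_pairing; apply: (proj2 sS) => //; exact: subspaceB.
have [//||y gy] := extend_rad (w := x + v.1) gs.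
  by move=> v' v's E; apply: none; exists v'.
exists (y - v.2); apply: partial_aut_sub gy => u /span_consP[c [z [zs ->]]].
apply/span_consP; exists c, (z - c *: v); split.
  by apply: (subspaceB sS) => //; apply: (subspaceZ _ sS).
apply: injective_projections => /=; first by rewrite scalerDr addrACA subrr addr0.
by rewrite scalerBr -addrA [- _ + _]addrC.
Qed.

Lemma span_swap (s : seq (V * V)) v :
  in_span s v -> in_span [seq (e.2, e.1) | e <- s] (v.2, v.1).
Proof.
move: v; apply: span_min => [|v vs].
  split=> [|c x y]; first exact: subspace0 (subspace_span _).
  exact: (proj2 (subspace_span _) c (x.2, x.1) (y.2, y.1)).
by apply: span_mem; apply: (map_f (fun e => (e.2, e.1))).
Qed.

Lemma partial_aut_swap s : partial_aut s -> partial_aut [seq (e.2, e.1) | e <- s].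
Proof.
move=> gs v /span_swap; rewrite -map_comp map_id_in; last by case.
by move=> /gs[/= v0 Wv av bv]; split; [apply: iff_sym | apply: iff_sym | |].
Qed.

Lemma extend_back s y : partial_aut s -> exists x, partial_aut ((x, y) :: s).
Proof.
move=> /partial_aut_swap/(extend_forth y)[x /partial_aut_swap gx].
exists x; move: gx; by rewrite /= -map_comp map_id_in => [|[]].
Qed.

Lemma extend_both s x y : partial_aut s ->
  exists x' y', partial_aut ((x', y) :: (x, y') :: s).
Proof.
by move=> /(extend_forth x)[y' /(extend_back y)[x' gx']]; exists x', y'.
Qed.

(** The union of the spans of an increasing sequence of partial automorphisms is
    the graph of an automorphism. *)
Lemma back_and_forth s : countably_spanned V -> partial_aut s ->
  exists g : {linear V -> V}, [/\ bijective g,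
    forall x y, a (g x) (g y) = a x y, forall x y, b (g x) (g y) = b x y &
    forall v, in_span s v -> g v.1 = v.2].
Proof.
move=> [e eE] gs.
have step (n : nat) (t : seq (V * V)) : exists t', partial_aut t ->
    exists x' y', t' = [:: (x', e n), (e n, y') & t] /\ partial_aut t'.
  have [gt|] := pselect (partial_aut t); last by exists t.
  have [x' [y' gt']] := extend_both (e n) (e n) gt.
  by exists [:: (x', e n), (e n, y') & t] => _; exists x', y'.
have /choice[F FE] : forall nt : nat * seq (V * V), exists t', partial_aut nt.2 ->
    exists x' y', t' = [:: (x', e nt.1), (e nt.1, y') & nt.2] /\ partial_aut t'.
  by move=> [n t]; apply: step.
pose S := fix S n := if n is m.+1 then F (m, S m) else s.
have gS n : partial_aut (S n).
  by elim: n => //= n IH; have [//|x' [y' []]] := FE (n, S n).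
have SS n : exists x' y', S n.+1 = [:: (x', e n), (e n, y') & S n].
  by have [x' [y' [SE _]]] := FE (n, S n) (gS n); exists x', y'.
have Smono m n v : in_span (S m) v -> in_span (S (m + n)%N) v.
  elim: n => [|n IH] Sv; first by rewrite addn0.
  by rewrite addnS; have [x' [y' ->]] := SS (m + n)%N; do 2!apply: span_tail; apply: IH.
pose G (v : V * V) := exists n, in_span (S n) v.
have sG : subspace G.
  split; first by exists 0; apply: subspace0 (subspace_span _).
  move=> c x y [m xm] [n yn]; exists (m + n)%N.
  apply: (proj2 (subspace_span _) c x y); first exact: Smono.
  by rewrite addnC; apply: Smono.
have tot1 x : exists y, G (x, y).
  have [n] := eE x; move: x; apply: span_min => [|x /mapP[i _ ->]].
    split=> [|c x y [x' Gx] [y' Gy]]; first by exists 0; apply: (subspace0 sG).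
    by exists (c *: x' + y'); apply: (proj2 sG) Gx Gy.
  have [x' [y' SE]] := SS i; exists y', i.+1; rewrite SE; apply: span_tail.
  exact: span_head.
have tot2 y : exists x, G (x, y).
  have [n] := eE y; move: y; apply: span_min => [|x /mapP[i _ ->]].
    split=> [|c x y [x' Gx] [y' Gy]]; first by exists 0; apply: (subspace0 sG).
    by exists (c *: x' + y'); apply: (proj2 sG) Gx Gy.
  have [x' [y' SE]] := SS i; exists x', i.+1; rewrite SE; exact: span_head.
have [|g Gg gG] := linear_graph sG tot1.
  by move=> y [n /gS[/= y0 _ _ _]]; apply: (proj1 y0).
exists g; split.
- apply: bijective_of_surj => [|y]; last by have [x /gG] := tot2 y; exists x.
  apply: lin_injective => x gx; have [n /gS[/= x0 _ _ _]] := Gg x.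
  exact: (proj2 x0).
- by apply: (quadratic_inj k2) => x; have [n /gS[/=]] := Gg x.
- by apply: (quadratic_inj k2) => x; have [n /gS[/=]] := Gg x.
by move=> v vs; apply/esym/gG; exists 0; rewrite -surjective_pairing.
Qed.

End BackAndForth.

(** * Universality and full pencils *)
Section Universality.
Variables (k : closedFieldType) (k2 : 2%:R != 0 :> k).
Implicit Types V W : biquadratic k.

Lemma ord2_ind (P : 'I_2 -> Prop) : P ord0 -> P ord_max -> forall i, P i.
Proof.
move=> P0 P1 i; have [->//|] := eqVneq i ord0; case: i => -[|[|//]] //= h _.
by rewrite (_ : Ordinal h = ord_max) //; apply: val_inj.
Qed.

Lemma embedding_of_forms W V (f : {linear W -> V}) : injective f ->
  (forall x, omega V (f x) (f x) = omega W x x) ->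
  (forall x, omega' V (f x) (f x) = omega' W x x) -> is_embedding f.
Proof.
by move=> finj f1 f2; split=> //; apply: ord2_ind; apply: (quadratic_inj k2).
Qed.

(** The embedding is built one vector at a time. The images are kept generic, in
    the sense that the functionals omega_v and omega'_v of the images are
    independent; then the next image has no compatibility condition to meet. *)
Lemma full_universal V : full (omega V) (omega' V) -> universal V.
Proof.
move=> fV W /finite_dimP[t tE].
pose good (s : seq (W * V)) := [/\
  forall v, in_span s v ->
    omega V v.2 v.2 = omega W v.1 v.1 /\ omega' V v.2 v.2 = omega' W v.1 v.1,
  forall v v', in_span s v -> in_span s v' ->
    (forall z, omega V v.2 z + omega' V v'.2 z = 0) -> v.1 = 0 /\ v'.1 = 0 &
  forall v, in_span s v -> v.1 = 0 -> v.2 = 0].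
have step s x : good s ->
    exists s', [/\ good s', forall v, in_span s v -> in_span s' v & exists y, in_span s' (x, y)].
  move=> gs; have [g1 g2 g3] := gs; have sS := subspace_span s.
  have [[y sxy]|new] := pselect (exists y, in_span s (x, y)).
    by exists s; split=> //; exists y.
  have [|u [au bu su ind]] := @paired_vector _ k2 _ _ (omega W) (omega' W) _ _ s x fV.
    by move=> v v' vs v's /(g2 _ _ vs v's)[-> ->]; rewrite !form0l addr0.
  exists ((x, u) :: s); split; last 2 first.
  - by move=> v; apply: span_tail.
  - by exists u; apply: span_head.
  split.
  - move=> v /span_consP[c [w [ws ->]]] /=; have [a1 b1] := g1 w ws.
    have [a2 b2] := su w ws; rewrite !formE !(formC _ u) !(formC _ x).
    by rewrite a1 b1 au bu a2 b2.
  - move=> v v' /span_consP[c [w [ws ->]]] /span_consP[c' [w' [w's ->]]] /= rel.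
    have [z|c0 c'0] := ind c c' w w' ws w's.
      by have := rel z; rewrite !formE => <-; ring.
    rewrite c0 c'0 !scale0r !add0r; apply: g2 => // z.
    by have := rel z; rewrite c0 c'0 !scale0r !add0r.
  move=> v /span_consP[c [w [ws ->]]] /=.
  have [->|cn0] := eqVneq c 0; first by rewrite !scale0r !add0r; apply: g3.
  move=> E; case: new; exists (- c^-1 *: w.2).
  have -> : (x, - c^-1 *: w.2) = - c^-1 *: w; last exact: subspaceZ.
  apply: injective_projections => //=; apply: (scalerI cn0).
  by rewrite scalerA mulrN mulfV // scaleN1r; apply/eqP; rewrite -addr_eq0 E.
have [s [gs st]] : exists s, good s /\ forall x, x \in t -> exists y, in_span s (x, y).
  elim: t {tE} => [|x t [s [gs st]]].
    exists [::]; split=> //; split=> [v ->|v v' -> -> |v ->] //.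
    by rewrite /= !form0l.
  have [s' [gs' ss' [y xy]]] := step s x gs.
  exists s'; split=> // z; rewrite inE => /predU1P[->|/st[y' /ss' zy]]; first by exists y.
  by exists y'.
have [g1 g2 g3] := gs; have sS := subspace_span s.
have tot x : exists y, in_span s (x, y).
  move: (tE x); move: x; apply: span_min => //.
  split=> [|c x y [x' xs] [y' ys]]; first by exists 0; apply: subspace0 sS.
  by exists (c *: x' + y'); apply: (proj2 sS) xs ys.
have [y ys|f fs _] := linear_graph sS tot; first exact: (g3 _ ys).
exists f; apply: embedding_of_forms => [|x|x]; last 2 first.
- by have [] := g1 _ (fs x).
- by have [] := g1 _ (fs x).
apply: lin_injective => x fx; have := fs x; rewrite fx => x0.
by have [] := g2 _ _ x0 x0; first by move=> z; rewrite !form0l addr0.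
Qed.

Section DotForm.
Variables (n : nat) (c : k).
Let dot (u v : 'rV[k]_n) : k := c * \sum_i u 0 i * v 0 i.

Fact dot_sym u v : dot u v = dot v u.
Proof. by congr (_ * _); apply: eq_bigr => i _; rewrite mulrC. Qed.

Fact dot_linear u : linear_for *%R (dot u).
Proof.
move=> d v w; rewrite /dot mulrCA -mulrDr; congr (_ * _); rewrite mulr_sumr -big_split /=.
by apply: eq_bigr => i _; rewrite !mxE; ring.
Qed.

Definition dot_form : {symmetric 'rV[k]_n} := mk_form dot_sym dot_linear.

Lemma dot_form_delta u i : dot_form u (delta_mx 0 i) = c * u 0 i.
Proof.
rewrite /dot_form /= /mk_form_fun /dot (bigD1 i) //= mxE !eqxx mulr1 big1 ?addr0 //.
by move=> j ji; rewrite mxE (negPf ji) andbF mulr0.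
Qed.

End DotForm.

Lemma rV_finite_dim n : finite_dim 'rV[k]_n.
Proof.
apply/finite_dimP; exists [seq delta_mx 0 i | i : 'I_n] => u.
rewrite (row_sum_delta u); apply: span_sum => i _.
by apply: span_mem; apply: map_f; rewrite mem_enum.
Qed.

(** If the kernel of c omega + d omega' had codimension at most n, then the image
    of an embedded (n+1)-dimensional space on which this form restricts to the
    standard dot product would meet it. *)
Lemma universal_full V : universal V -> full (omega V) (omega' V).
Proof.
move=> uV c d cd; apply: (full_of_infinite_rank k2) => t.
have [c1 [d1 cd1]] : exists c1 d1, c * c1 + d * d1 = 1.
  case/orP: cd => h; [exists c^-1, 0 | exists 0, d^-1].
    by rewrite mulfV // mulr0 addr0.
  by rewrite mulfV // mulr0 add0r.
(* The factors c1 and d1 make c omega + d omega' the standard dot product. *)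
pose n := (size t).+1.
pose E : biquadratic k :=
  MultiQuadratic (fun i : 'I_2 => dot_form n (if i == ord0 then c1 else d1)).
have [f [finj fE]] := uV E (rV_finite_dim n).
apply: contrapT => none.
have small i : exists M : 'rV_(size t), forall z,
    let x := f (delta_mx 0 i) - \sum_j M 0 j *: t`_j in
    c * omega V x z + d * omega' V x z = 0.
  apply: contrapT => noM; apply: none; exists (f (delta_mx 0 i)) => e te.
  apply: contrapT => allz; apply: noM; have [m eE] := span_nth te.
  exists (\row_j m j) => z /=.
  have -> : \sum_j (\row_j m j) 0 j *: t`_j = e.
    by rewrite eE; apply: eq_bigr => j _; rewrite mxE.
  by apply: contrapT => /eqP nz; apply: allz; exists z.
have [M ME] := choice small.
pose A := \matrix_i M i.
have : kermx A != 0.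
  rewrite -mxrank_eq0 mxrank_ker subn_eq0 -ltnNge.
  exact: leq_ltn_trans (rank_leq_col A) (ltnSn _).
move=> /rowV0Pn[u /sub_kermxP uA un0]; case/eqP: un0.
have urel z : c * omega V (f u) z + d * omega' V (f u) z = 0.
  have fu : f u = \sum_i u 0 i *: (f (delta_mx 0 i) - \sum_j M i 0 j *: t`_j).
    rewrite {1}(row_sum_delta u) linear_sum; under [RHS]eq_bigr do rewrite scalerBr.
    rewrite sumrB [X in _ - X](_ : _ = 0) ?subr0; last first.
      under eq_bigr do rewrite scaler_sumr; rewrite exchange_big /= big1 // => j _.
      under eq_bigr do rewrite scalerA; rewrite -scaler_suml.
      have := congr1 (fun B : 'rV_ _ => B 0 j) uA; rewrite !mxE => uj.
      by under eq_bigr => i _ do [have -> : M i 0 j = A i j by rewrite mxE]; rewrite uj scale0r.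
    by apply: eq_bigr => i _; rewrite linearZ.
  rewrite fu; have sP := subspace_rad (comb_form c d (omega V) (omega' V)).
  apply: (big_ind (fun x => c * omega V x z + d * omega' V x z = 0)).
  - by rewrite !form0l !mulr0 addr0.
  - by move=> x y xz yz; rewrite !formDl !mulrDr addrACA xz yz addr0.
  by move=> i _; rewrite !formZl !(mulrCA _ (u 0 i)) -mulrDr ME mulr0.
apply/rowP => i; rewrite mxE -[u 0 i]mul1r -cd1.
have := urel (f (delta_mx 0 i)); rewrite /omega /omega' !fE /= !dot_form_delta /=.
by move=> <-; ring.
Qed.

End Universality.

(** * Subrepresentations and length two *)
Section Length.
Variables (k : fieldType) (r : nat) (V : multiquadratic k r).
Implicit Types (S W A B C D : submodClosed V) (g : {linear V -> V}).

Lemma aut_inv g : is_aut g -> exists h : {linear V -> V},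
  [/\ is_aut h, cancel g h & cancel h g].
Proof.
move=> [[ginj gE] [h gK hK]].
have hL : linear h by move=> c x y; apply: ginj; rewrite hK linearP !hK.
exists (lin_of hL); split=> //; split; last by exists g.
by split=> [|i x y]; [exact: can_inj hK | rewrite -gE !hK].
Qed.

Lemma nonzero_subspaceP S : ~ zero_subspace S -> nonzero_subspace S.
Proof.
move=> nz; apply: contrapT => none; apply: nz => x Sx.
by apply: contrapT => /eqP x0; apply: none; exists x.
Qed.

Definition zero_sub : submodClosed V := to_submod (subspace_span [::]).

Lemma zero_subP x : x \in zero_sub <-> x = 0. Proof. exact: to_submodP. Qed.

Lemma subspace_True : subspace (fun _ : V => True). Proof. by []. Qed.

Definition full_sub : submodClosed V := to_submod subspace_True.

Lemma in_full_sub x : x \in full_sub. Proof. exact/to_submodP. Qed.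

Lemma subrep_zero : subrep zero_sub.
Proof. by move=> g _ x /zero_subP->; apply/zero_subP; rewrite linear0. Qed.

Lemma subrep_full : subrep full_sub.
Proof. by move=> g _ x _; apply: in_full_sub. Qed.

Lemma subrep_orth S : subrep S -> subrep (orth S).
Proof.
move=> repS g gaut x /asboolP xS; have [h [haut gK hK]] := aut_inv gaut.
apply/asboolP => i y Sy; rewrite -[y]hK gaut.1.2; apply: xS; exact: repS.
Qed.

Lemma proper_subspaceP A B : {subset A <= B} -> ~ {subset B <= A} -> proper_subspace A B.
Proof.
move=> AB BA; split=> //; apply: contrapT => none; apply: BA => x Bx.
by apply: contrapT => /negP Ax; apply: none; exists x.
Qed.

(** The only way in which the upper bound on the length is used. *)
Lemma length2_no_chain3 A B C D : has_length V 2 ->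
  subrep A -> subrep B -> subrep C -> subrep D ->
  proper_subspace A B -> proper_subspace B C -> proper_subspace C D -> False.
Proof.
move=> [_ bound] rA rB rC rD AB BC CD.
suff /bound : subrep_chain V 3 by [].
exists (nth A [:: A; B; C; D]); split=> i.
  by case: i => [|[|[|[|]]]].
by case: i => [|[|[|]]].
Qed.

Lemma length2_proper : has_length V 2 ->
  exists W, [/\ subrep W, nonzero_subspace W & exists x, x \notin W].
Proof.
move=> [[S [rS pS]] _]; have [_ [y Sy nSy]] := pS 0%N isT; have [_ [x _ nSx]] := pS 1%N isT.
exists (S 1%N); split; [exact: rS | exists y => // | by exists x].
by apply: contraNneq nSy => ->; rewrite rpred0.
Qed.

Lemma length2_below W S : has_length V 2 -> subrep W -> (exists x, x \notin W) ->
  subrep S -> {subset S <= W} -> zero_subspace S \/ {subset W <= S}.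
Proof.
move=> len rW [x nWx] rS SW; have [?|nz] := pselect (zero_subspace S); first by left.
right; apply: contrapT => WS.
apply: (@length2_no_chain3 zero_sub S W full_sub) => //.
- exact: subrep_zero.
- apply: proper_subspaceP => [y /zero_subP->|S0]; first exact: rpred0.
  by apply: nz => y /S0/zero_subP.
- exact: proper_subspaceP.
by split=> [y _|]; [|exists x]; rewrite ?in_full_sub.
Qed.

Lemma length2_above W S : has_length V 2 -> subrep W -> nonzero_subspace W ->
  subrep S -> {subset W <= S} -> {subset S <= W} \/ forall x, x \in S.
Proof.
move=> len rW [x Wx xn0] rS WS; have [?|nSW] := pselect {subset S <= W}; first by left.
right=> y; apply: contrapT => /negP nSy.
apply: (@length2_no_chain3 zero_sub W S full_sub) => //.
- exact: subrep_zero.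
- split=> [z /zero_subP->|]; first exact: rpred0.
  by exists x => //; apply/negP => /zero_subP/eqP; apply/negP.
- exact: proper_subspaceP.
by split=> [z _|]; [|exists y]; rewrite ?in_full_sub.
Qed.

(** A subrepresentation S is recorded by whether it meets W and whether it leaves
    W. By the modular law one of the two answers changes from no to yes at each
    step of a strict chain, so there are at most two steps. *)
Lemma length2_intro W : subrep W -> nonzero_subspace W -> (exists x, x \notin W) ->
  (forall S, subrep S -> {subset S <= W} -> nonzero_subspace S -> {subset W <= S}) ->
  (forall S x, subrep S -> {subset W <= S} -> x \in S -> x \notin W ->
     forall y, y \in S) ->
  has_length V 2.
Proof.
move=> rW [w Ww wn0] [v nWv] below above; split.
  exists (nth zero_sub [:: zero_sub; W; full_sub]); split=> -[|[|[|]]] //= _.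
  - exact: subrep_zero.
  - exact: subrep_full.
  - split=> [z /zero_subP->|]; first exact: rpred0.
    by exists w => //; apply/negP => /zero_subP/eqP; apply/negP.
  by split=> [z _|]; [|exists v]; rewrite ?in_full_sub.
move=> m [S [rS pS]]; rewrite leqNgt; apply/negP => m3.
pose meets i := exists2 x, x \in S i & (x \in W) && (x != 0).
pose leaves i := exists2 x, x \in S i & x \notin W.
have Smono i : (i < m)%N -> {subset S i <= S i.+1} by move=> /pS[].
have meetsE i : (i <= m)%N -> meets i -> {subset W <= S i}.
  move=> im [x Sx /andP[Wx xn0]] y Wy.
  pose P z := z \in S i /\ z \in W.
  have sP : subspace P.
    split=> [|c a b [a1 a2] [b1 b2]]; first by split; apply: rpred0.
    by split; rewrite rpredD ?rpredZ.
  have rP : subrep (to_submod sP).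
    move=> g gaut z /to_submodP[Sz Wz]; apply/to_submodP.
    by split; [apply: rS | apply: rW].
  have /(_ y Wy)/to_submodP[] // : {subset W <= to_submod sP}.
  apply: below => // [z /to_submodP[]//|].
  by exists x => //; apply/to_submodP.
have leavesE i : (i <= m)%N -> leaves i -> forall y, exists2 x, x \in S i & y - x \in W.
  move=> im [x Sx nWx] y; pose P z := exists2 x, x \in S i & z - x \in W.
  have sP : subspace P.
    split=> [|c a b [a' Sa Wa] [b' Sb Wb]]; first by exists 0; rewrite ?subr0 ?rpred0.
    exists (c *: a' + b'); first by rewrite rpredD ?rpredZ.
    have -> : c *: a + b - (c *: a' + b') = c *: (a - a') + (b - b').
      by rewrite scalerBr opprD addrACA.
    by rewrite rpredD ?rpredZ.
  have rP : subrep (to_submod sP).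
    move=> g gaut z /to_submodP[z' Sz Wz]; apply/to_submodP.
    by exists (g z'); [apply: rS | rewrite -linearB; apply: rW].
  suff /to_submodP : y \in to_submod sP by [].
  apply: (above _ x) => //; last by apply/to_submodP; exists x; rewrite ?subrr ?rpred0.
  by move=> z Wz; apply/to_submodP; exists 0; rewrite ?subr0 ?rpred0.
have grow i : (i < m)%N -> (~ meets i /\ meets i.+1) \/ (~ leaves i /\ leaves i.+1).
  move=> im; have [_ [x Sx nSx]] := pS i im.
  have [mi|nmi] := pselect (meets i); last first.
    have [mi1|nmi1] := pselect (meets i.+1); first by left.
    right; split; last first.
      exists x => //; apply/negP => Wx; apply: nmi1; exists x => //.
      by rewrite Wx; apply: contraNneq nSx => ->; rewrite rpred0.
    move=> /(leavesE i (ltnW im))/(_ x)[y Sy Wxy].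
    apply: nmi1; exists (x - y); first by apply: memB => //; apply: (Smono _ im).
    by rewrite Wxy subr_eq0; apply: contraNneq nSx => ->.
  right; split; last first.
    by exists x => //; apply/negP => /(meetsE i (ltnW im) mi); apply/negP.
  move=> /(leavesE i (ltnW im))/(_ x)[y Sy /(meetsE i (ltnW im) mi) Sxy].
  by move: nSx; rewrite -(subrK y x) rpredD.
have mup i : (i < m)%N -> meets i -> meets i.+1.
  by move=> im [x Sx xW]; exists x => //; apply: Smono.
have lup i : (i < m)%N -> leaves i -> leaves i.+1.
  by move=> im [x Sx xW]; exists x => //; apply: Smono.
have m0 : (0 < m)%N by apply: leq_trans m3.
have m1 : (1 < m)%N by apply: leq_trans m3.
have := grow _ m0; have := grow _ m1; have := grow _ m3.
have := mup _ m0; have := mup _ m1; have := lup _ m0; have := lup _ m1.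
tauto.
Qed.

End Length.

(** * Change of basis in the pencil *)
Section Points.
Variables (k : fieldType).
Implicit Types (p q : point k) (V W : biquadratic k).

Lemma point_det p q : ~ same_point p q -> pt1 p * pt0 q - pt0 p * pt1 q != 0.
Proof.
move=> npq; apply/eqP => /eqP; rewrite subr_eq0 => /eqP E; apply: npq.
have [p0|p0] := eqVneq (pt0 p) 0.
  have p1 : pt1 p != 0 by have := pt_neq0 p; rewrite p0 eqxx.
  move: E; rewrite p0 mul0r => /eqP; rewrite mulf_eq0 (negPf p1) /= => /eqP q0.
  have q1 : pt1 q != 0 by have := pt_neq0 q; rewrite q0 eqxx.
  exists (pt1 q / pt1 p); first by rewrite mulf_neq0 ?invr_eq0.
  by rewrite q0 p0 mulr0 divfK.
have [q0|q0] := eqVneq (pt0 q) 0.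
  have := pt_neq0 q; rewrite q0 eqxx /= => q1; move: E; rewrite q0 mulr0 => /esym/eqP.
  by rewrite mulf_eq0 (negPf p0) (negPf q1).
exists (pt0 q / pt0 p); first by rewrite mulf_neq0 ?invr_eq0.
by rewrite divfK //; split=> //; apply: (mulfI p0); rewrite -E; field.
Qed.

Lemma other_point p : exists q, ~ same_point p q.
Proof.
have [p0|p0] := eqVneq (pt0 p) 0.
  have h : ((1 : k) != 0) || ((0 : k) != 0) by rewrite oner_eq0.
  exists (Point h) => -[c cn0 [/= c1 _]].
  by move: c1; rewrite p0 mulr0 => /eqP; rewrite oner_eq0.
have h : ((0 : k) != 0) || ((1 : k) != 0) by rewrite oner_eq0 orbT.
exists (Point h) => -[c cn0 [/= /esym/eqP]].
by rewrite mulf_eq0 (negPf cn0) (negPf p0).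
Qed.

Lemma omega_atE V p x y :
  omega_at V p x y = pt1 p * omega V x y + pt0 p * omega' V x y.
Proof. by []. Qed.

Lemma omega_of_at V p q x y : ~ same_point p q ->
  omega V x y = (pt0 q * omega_at V p x y - pt0 p * omega_at V q x y) /
                (pt1 p * pt0 q - pt0 p * pt1 q).
Proof. by move=> /point_det d; rewrite !omega_atE; field. Qed.

Lemma omega'_of_at V p q x y : ~ same_point p q ->
  omega' V x y = (pt1 p * omega_at V q x y - pt1 q * omega_at V p x y) /
                (pt1 p * pt0 q - pt0 p * pt1 q).
Proof. by move=> /point_det d; rewrite !omega_atE; field. Qed.

Lemma point_columns_free p q c e : ~ same_point p q ->
  c * pt1 p + e * pt1 q = 0 -> c * pt0 p + e * pt0 q = 0 -> c = 0 /\ e = 0.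
Proof.
move=> /point_det d h1 h0; split; apply: (mulIf d); rewrite mul0r.
  apply: etrans (_ : pt0 q * (c * pt1 p + e * pt1 q) - pt1 q * (c * pt0 p + e * pt0 q) = 0).
    by ring.
  by rewrite h1 h0 !mulr0 subrr.
apply: etrans (_ : pt1 p * (c * pt0 p + e * pt0 q) - pt0 p * (c * pt1 p + e * pt1 q) = 0).
  by ring.
by rewrite h1 h0 !mulr0 subrr.
Qed.

Lemma point_rows_free p q c d : ~ same_point p q ->
  c * pt1 p + d * pt0 p = 0 -> c * pt1 q + d * pt0 q = 0 -> c = 0 /\ d = 0.
Proof.
move=> /point_det dn0 hp hq; split; apply: (mulIf dn0); rewrite mul0r.
  apply: etrans (_ : pt0 q * (c * pt1 p + d * pt0 p) - pt0 p * (c * pt1 q + d * pt0 q) = 0).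
    by ring.
  by rewrite hp hq !mulr0 subrr.
apply: etrans (_ : pt1 p * (c * pt1 q + d * pt0 q) - pt1 q * (c * pt1 p + d * pt0 p) = 0).
  by ring.
by rewrite hp hq !mulr0 subrr.
Qed.

Lemma full_at V p q : ~ same_point p q ->
  full (omega V) (omega' V) <-> full (omega_at V p) (omega_at V q).
Proof.
move=> npq; have d := point_det npq; split=> fV c e ce F.
  have [|x xF] := fV (c * pt1 p + e * pt1 q) (c * pt0 p + e * pt0 q) _ F.
    rewrite -negb_and; apply: contraTN ce => /andP[/eqP h1 /eqP h0].
    by have [-> ->] := point_columns_free npq h1 h0; rewrite eqxx.
  move=> nz; exists x; first by move=> f /xF[f1 f2]; rewrite !omega_atE f1 f2 !mulr0 addr0.
  by apply: contraNneq nz => <-; rewrite !omega_atE; apply/eqP; ring.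
have [|x xF] := fV (c * pt0 q - e * pt1 q) (e * pt1 p - c * pt0 p) _ F.
  rewrite -negb_and; apply: contraTN ce => /andP[/eqP h1 /eqP h2].
  have [||-> /eqP] := @point_rows_free p q e (- c) npq.
  - by rewrite mulNr.
  - by rewrite mulNr -opprB h1 oppr0.
  by rewrite oppr_eq0 => ->; rewrite eqxx.
move=> nz; exists x.
  move=> f /xF[f1 f2]; rewrite (omega_of_at _ _ npq) (omega'_of_at _ _ npq) f1 f2.
  by rewrite !mulr0 subr0 mul0r.
apply: contraNneq nz; rewrite (omega_of_at _ _ npq) (omega'_of_at _ _ npq) => E.
apply/eqP; apply: (mulIf (invr_neq0 d)); rewrite mul0r -E; field; exact: d.
Qed.

Lemma aut_at V p (g : {linear V -> V}) : is_aut g ->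
  forall x y, omega_at V p (g x) (g y) = omega_at V p x y.
Proof. by move=> [[_ gE] _] x y; rewrite !omega_atE /omega /omega' !gE. Qed.

Lemma aut_of_at V p q (g : {linear V -> V}) : ~ same_point p q -> bijective g ->
  (forall x y, omega_at V p (g x) (g y) = omega_at V p x y) ->
  (forall x y, omega_at V q (g x) (g y) = omega_at V q x y) -> is_aut g.
Proof.
move=> npq gbij gp gq; split=> //; split; first exact: bij_inj.
apply: ord2_ind => x y.
  by rewrite -[LHS]/(omega V _ _) -[RHS]/(omega V _ _) !(omega_of_at _ _ npq) gp gq.
by rewrite -[LHS]/(omega' V _ _) -[RHS]/(omega' V _ _) !(omega'_of_at _ _ npq) gp gq.
Qed.

Lemma ker_atP V p x : x \in ker_at V p <-> forall y, omega_at V p x y = 0.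
Proof. by split=> /asboolP. Qed.

Lemma subrep_ker_at V p : subrep (ker_at V p).
Proof.
move=> g gaut x /ker_atP xK; apply/ker_atP => y.
by have [h [_ _ hK]] := aut_inv gaut; rewrite -(hK y) aut_at.
Qed.

Lemma orthP V p q (S : submodClosed V) x : ~ same_point p q ->
  x \in orth S <->
  forall y, y \in S -> omega_at V p x y = 0 /\ omega_at V q x y = 0.
Proof.
move=> npq; split=> [/asboolP xS y Sy|xS].
  by rewrite !omega_atE /omega /omega' !xS // !mulr0 addr0.
apply/asboolP; apply: ord2_ind => y /xS[p0 q0].
  by rewrite -/(omega V) (omega_of_at _ _ npq) p0 q0 !mulr0 subr0 mul0r.
by rewrite -/(omega' V) (omega'_of_at _ _ npq) p0 q0 !mulr0 subr0 mul0r.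
Qed.

Lemma mq_kerP V p q x : ~ same_point p q ->
  x \in mq_ker V <-> x \in ker_at V p /\ x \in ker_at V q.
Proof.
move=> npq; split=> [/forallP xK|[/ker_atP xp /ker_atP xq]].
  have h i y : mq_form V i x y = 0 by have /asboolP := xK i; apply.
  by split; apply/ker_atP => y; rewrite omega_atE /omega /omega' !h !mulr0 addr0.
apply/forallP; apply: ord2_ind; apply/asboolP => y.
  by rewrite -/(omega V) (omega_of_at _ _ npq) xp xq !mulr0 subr0 mul0r.
by rewrite -/(omega' V) (omega'_of_at _ _ npq) xp xq !mulr0 subr0 mul0r.
Qed.

End Points.

(** * Countable dimension *)
Section CountableDimension.
Variable k : fieldType.
Implicit Types U V : lmodType k.

Lemma countable_dim_spanned V : countable_dim V -> countably_spanned V.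
Proof.
move=> [B [[_ gen] cB]].
have /countable_injP[f finj] := cB.
have /choice[b bP] : forall n, exists x, forall y, B y -> f y = n -> x = y.
  move=> n; have [[x [Bx xn]]|none] := pselect (exists x, B x /\ f x = n).
    by exists x => y By yn; apply: finj; rewrite ?inE // xn.
  by exists 0 => y By yn; case: none; exists y.
exists b => x; have [n [v [c [Bv ->]]]] := gen x.
exists (\max_i f (v i)).+1; apply: span_sum => i _.
rewrite -(bP _ _ (Bv i) erefl); apply/span_mem/mapP; exists (f (v i)) => //.
by rewrite mem_iota add0n /= ltnS (bigmax_sup i).
Qed.

Lemma countably_spanned_image U V (f : {linear U -> V}) :
  (forall y, exists x, f x = y) -> countably_spanned U -> countably_spanned V.
Proof.
move=> fsurj [b bE]; exists (f \o b) => y; have [x <-] := fsurj y.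
have [n nE] := bE x; exists n; have := span_map f nE.
by rewrite /mkseq -map_comp.
Qed.

(** The members of the sequence which are not in the span of the earlier ones
    form a basis. *)
Lemma countably_spanned_dim V : countably_spanned V -> countable_dim V.
Proof.
move=> [b bE]; pose new n := ~ in_span (mkseq b n) (b n).
pose B := [set b n | n in new].
exists B; split; last first.
  by apply: sub_countable (card_image_le b new) _; exact: countableP.
split=> [m v c vinj vB sum0 i | x]; last first.
  have sB n : exists s : seq V, (forall y, y \in s -> B y) /\
      forall y, in_span (mkseq b n) y -> in_span s y.
    elim: n => [|n [s [sB sE]]]; first by exists [::].
    have mk m : mkseq b m.+1 = rcons (mkseq b m) (b m).
      by rewrite /mkseq -addn1 iotaD map_cat cats1.
    have [old|nw] := pselect (in_span (mkseq b n) (b n)).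
      exists s; split=> // y; move: y; apply: span_min => [|y]; first exact: subspace_span.
      rewrite mk mem_rcons inE => /predU1P[->|/span_mem]; exact: sE.
    exists (b n :: s); split=> [y|y].
      by rewrite inE => /predU1P[->|/sB//]; exists n.
    move: y; apply: span_min => [|y]; first exact: subspace_span.
    rewrite mk mem_rcons inE => /predU1P[->|/span_mem/sE/span_tail//].
    exact: span_head.
  have [n nE] := bE x; have [s [sB' sE]] := sB n.
  have [c cE] := span_nth (sE _ nE).
  by exists (size s), (fun i => s`_i), c; split=> // i; apply/sB'/mem_nth.
apply: contrapT => /eqP ci.
have /choice[idx idxE] : forall i, exists n, new n /\ b n = v i.
  by move=> j; have [n nn nE] := vB j; exists n.
pose i0 := [arg max_(j > i | c j != 0) idx j].
have [cj jmax] : c i0 != 0 /\ forall j, c j != 0 -> (idx j <= idx i0)%N.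
  by rewrite /i0; case: arg_maxnP => // j.
have [nw bi0] := idxE i0; apply: nw; rewrite bi0.
have -> : v i0 = - (c i0)^-1 *: \sum_(j < m) (if j == i0 then 0 else c j) *: v j.
  apply: (scalerI cj); rewrite scalerA mulrN mulfV // scaleN1r; apply/eqP.
  rewrite -addr_eq0 -[X in _ == X]sum0 (bigD1 i0) //= [X in _ == X](bigD1 i0) //=.
  rewrite eqxx scale0r add0r; apply/eqP; congr (_ + _); apply: eq_bigr => j ji.
  by rewrite (negPf ji).
apply: subspaceZ (subspace_span _) _; apply: span_sum => j.
have [_|ji cj0] := eqVneq j i0; first by rewrite eqxx.
have [_ <-] := idxE j; apply/span_mem/mapP; exists (idx j) => //.
rewrite mem_iota add0n /= ltn_neqAle jmax // andbT.
apply: contra ji => /eqP E; apply/eqP/vinj.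
by have [_ <-] := idxE j; have [_ <-] := idxE i0; rewrite E.
Qed.

(** Running through the sequence, keep a vector when it is independent of W and
    of the vectors already kept. *)
Lemma complement V (W : submodClosed V) : countably_spanned V ->
  exists C : submodClosed V, direct_sum W C.
Proof.
move=> [b bE].
pose ext (s : seq V) x := if `[< exists2 w, w \in W & in_span s (x - w) >] then s else x :: s.
pose S := fix S n := if n is m.+1 then ext (S m) (b m) else [::].
pose indep (s : seq V) := forall x, x \in W -> in_span s x -> x = 0.
have Sind n : indep (S n).
  elim: n => [x _ //|n IH] /=; rewrite /ext; case: asboolP => // new x Wx.
  move=> /span_consP[c [y [sy xE]]].
  have [c0|c0] := eqVneq c 0; first by apply: IH => //; rewrite xE c0 scale0r add0r.
  case: new; exists (c^-1 *: x); first exact: rpredZ.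
  rewrite xE scalerDr scalerK // opprD addNKr.
  by apply: subspaceN (subspace_span _) _; apply: subspaceZ (subspace_span _) _.
have Smono m n x : in_span (S m) x -> in_span (S (m + n)%N) x.
  elim: n => [|n IH] Sx; first by rewrite addn0.
  rewrite addnS /= /ext; case: asboolP => _; first exact: IH.
  exact/span_tail/IH.
pose C x := exists n, in_span (S n) x.
have sC : subspace C.
  split; first by exists 0; apply: subspace0 (subspace_span _).
  move=> c x y [m xm] [n yn]; exists (m + n)%N.
  apply: (proj2 (subspace_span _) c x y); first exact: Smono.
  by rewrite addnC; apply: Smono.
exists (to_submod sC); split=> [v|x Wx /to_submodP[n]]; last exact: Sind.
suff [w [c [Ww Cc ->]]] : exists w c, [/\ w \in W, C c & v = w + c].
  by exists w, c; split=> //; apply/to_submodP.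
have [n] := bE v; move: v; apply: span_min => [|v /mapP[i _ ->]].
  split=> [|c x y [w1 [c1 [Ww1 Cc1 ->]]] [w2 [c2 [Ww2 Cc2 ->]]]].
    by exists 0, 0; split; rewrite ?rpred0 ?addr0 //; apply: subspace0 sC.
  exists (c *: w1 + w2), (c *: c1 + c2); split; [by rewrite rpredD ?rpredZ|exact: (proj2 sC)|].
  by rewrite scalerDr addrACA.
have [[w Ww sw]|nw] := pselect (exists2 w, w \in W & in_span (S i) (b i - w)).
  by exists w, (b i - w); split=> //; [exists i | rewrite addrC subrK].
exists 0, (b i); split; rewrite ?rpred0 ?add0r //.
exists i.+1; rewrite /= /ext; case: asboolP => // _; exact: span_head.
Qed.

Lemma projection V (U W : submodClosed V) : direct_sum U W ->
  exists f : {linear V -> subsp U}, forall v, v - subsp_val (f v) \in W.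
Proof.
move=> [dec disj]; pose G (v : V * subsp U) := v.1 - subsp_val v.2 \in W.
have [||y Gy|f Gf _] := @linear_graph _ V (subsp U) G; last by exists f.
- split; first by rewrite /G /= subrr rpred0.
  move=> c x y Gx Gy; rewrite /G /= opprD addrACA -scalerBr.
  by rewrite rpredD ?rpredZ.
- move=> v; have [x [y [Ux Wy ->]]] := dec v.
  by exists (Subsp Ux); rewrite /G /= addrAC subrr add0r.
apply: val_inj => /=; apply: disj; first by case: (y).
by move: Gy; rewrite /G /= sub0r memN.
Qed.

End CountableDimension.

(** * Universal homogeneous spaces *)
Section Homogeneity.
Variables (k : closedFieldType) (k2 : 2%:R != 0 :> k).
Implicit Types V : biquadratic k.

(** Writes x as a difference of two vectors with the same prescribed norms, the
    device by which orbits of vectors are shown to span. Equality of the norms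
    of u and u + x is a linear condition on u, namely a(x,u) = - a(x,x)/2. *)
Lemma difference_of_conjugates (V : lmodType k) (a b : {symmetric V}) x (m n : k) :
  full a b -> (forall c d, (forall z, c * a x z + d * b x z = 0) -> c = 0 /\ d = 0) ->
  exists u, [/\ a u u = m /\ b u u = n, a (u + x) (u + x) = m /\ b (u + x) (u + x) = n,
    ~ (forall z, a u z = 0) & ~ (forall z, a (u + x) z = 0)].
Proof.
move=> fab indx.
pose B (y : V * V) u := a y.1 u + b y.2 u.
pose l (y : V * V) := - (a y.1 x + b y.2 x) / 2%:R.
have Bl u : linear_for *%R (B^~ u) by move=> c y z; rewrite /B /= !formE; ring.
have Br y : linear_for *%R (B y) by move=> c u v; rewrite /B /= !formE; ring.
have lL : linear_for *%R l by move=> c y z; rewrite /l /= !formE; ring.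
have sT : subspace (fun _ : V => True) by [].
have [|u0 _ u0E] := linear_system Bl Br sT (s := dbl [:: x]) lL.
  move=> y /span_dbl[/span_consP[c [_ [-> y1]]] /span_consP[d [_ [-> y2]]]] yB.
  rewrite /l y1 y2 !addr0 !formE; have [z|-> ->] := indx c d; last first.
    by rewrite !mul0r addr0 oppr0 mul0r.
  by have := yB z I; rewrite /B y1 y2 !addr0 !formE.
have [u [uF au bu ind]] := full_translate k2 [:: x] u0 m n fab.
have xx : in_span [:: x] x := span_head _ _.
have s0 : in_span [:: x] 0 := subspace0 (subspace_span _).
have [ax bx] : a x u = - a x x / 2%:R /\ b x u = - b x x / 2%:R.
  have [h1 h2] := perp_span uF xx.
  rewrite -(subrK u0 u) !(formDr _ _ (u - u0)) h1 h2 !add0r; split.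
    have := u0E (x, 0) (proj2 (span_dbl _ (x, 0)) (conj xx s0)).
    by rewrite /B /l /= !form0l !addr0.
  have := u0E (0, x) (proj2 (span_dbl _ (0, x)) (conj s0 xx)).
  by rewrite /B /l /= !form0l !add0r.
exists u; split.
- by [].
- rewrite !formE (formC a u) (formC b u) ax bx au bu; split; field; exact: k2.
- move=> au0; have [z|/eqP] := ind 1 0 0 0 s0 s0; last by rewrite oner_eq0.
  by rewrite !form0l au0; ring.
move=> au0; have [z|/eqP] := ind 1 0 x 0 xx s0; last by rewrite oner_eq0.
by have := au0 z; rewrite formDl => E; rewrite form0l -[RHS]E; ring.
Qed.

Lemma homogeneous_transitive V x y : homogeneous V -> x != 0 -> y != 0 ->
  (forall i, mq_form V i x x = mq_form V i y y) ->
  exists2 g : {linear V -> V}, is_aut g & g x = y.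
Proof.
move=> hV x0 y0 xy.
have mulL (z : V) : linear (fun c : k^o => c *: z).
  by move=> c d e; rewrite scalerDl scalerA.
pose W : biquadratic k :=
  MultiQuadratic (fun i => pullback_form (lin_of (mulL x)) (mq_form V i)).
have emb z : z != 0 -> (forall i, mq_form V i x x = mq_form V i z z) ->
    @is_embedding k 2 W V (lin_of (mulL z)).
  move=> z0 xz; split=> [c d /eqP|i c d].
    by rewrite /= /lin_of_fun -subr_eq0 -scalerBl scaler_eq0 (negPf z0) orbF subr_eq0 => /eqP.
  by rewrite [RHS]/= /mk_form_fun /= /lin_of_fun !formE xz.
have Wfin : finite_dim W.
  apply/finite_dimP; exists [:: (1 : k^o)] => c /=; exists c.
  by rewrite /= -[c *: _]/(c * 1) mulr1 subrr.
have [g gaut gE] := hV W Wfin _ _ (emb y y0 xy) (emb x x0 (fun i => erefl)).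
by exists g => //; have := gE 1; rewrite /= /lin_of_fun !scale1r.
Qed.

(** Nonzero vectors with the same norms are conjugate, so a subrepresentation
    containing x contains all nonzero vectors with the norms of x, and these
    span. Universality is needed to find, for z, two such vectors with
    difference z: they are found for a vector z' with the norms of z and
    transported by an automorphism taking z' to z. *)
Lemma universal_homogeneous_irreducible V : universal_homogeneous V -> irreducible V.
Proof.
move=> [[_ inf] uV hV]; split.
  by have [x /eqP] := proj1 (infinite_dimP V) inf [::]; exists x.
move=> S rS; have [|nz] := pselect (zero_subspace S); [by left | right].
have [x Sx x0] := nonzero_subspaceP nz.
have fV := universal_full k2 uV.
have nrad0 (z : V) : ~ (forall t, omega V z t = 0) -> z != 0.
  by move=> nz'; apply/eqP => z0; apply: nz' => t; rewrite z0 form0l.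
have conj y : y != 0 -> omega V x x = omega V y y -> omega' V x x = omega' V y y -> y \in S.
  move=> y0 e1 e2; have [|g gaut <-] := homogeneous_transitive hV x0 y0.
    exact: ord2_ind.
  exact: rS.
move=> z; have [->|z0] := eqVneq z 0; first exact: rpred0.
have [z' [_ az' bz' indz']] := full_translate k2 [::] 0 (omega V z z) (omega' V z z) fV.
have indz c d : (forall t, c * omega V z' t + d * omega' V z' t = 0) -> c = 0 /\ d = 0.
  by move=> rel; apply: (indz' c d 0 0) => // t; rewrite !form0l !addr0.
have z'0 : z' != 0.
  apply: nrad0 => z'r; have [t|/eqP] := indz 1 0; last by rewrite oner_eq0.
  by rewrite z'r; ring.
have [u [[au bu] [auz buz] nu nuz]] :=
  difference_of_conjugates (omega V x x) (omega' V x x) fV indz.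
have [|g gaut gz] := homogeneous_transitive hV z'0 z0; first exact: ord2_ind.
have [[ginj gE] _] := gaut.
have -> : z = g (u + z') - g u by rewrite linearD gz addrC addKr.
apply: memB; apply: conj.
- by rewrite -(linear0 g) (inj_eq ginj) nrad0.
- by rewrite /omega gE.
- by rewrite /omega' gE.
- by rewrite -(linear0 g) (inj_eq ginj) nrad0.
- by rewrite /omega gE.
by rewrite /omega' gE.
Qed.

Definition no_relation V : Prop :=
  forall x y, (forall z, omega V x z + omega' V y z = 0) -> x = 0 /\ y = 0.

(** Without relations the functionals omega_x and omega'_e can be prescribed
    independently: some u pairs to zero with a spanning set under omega', hence
    is 0, and yet omega(x,u) is nonzero. *)
Lemma no_relation_infinite V : no_relation V -> (exists x : V, x != 0) -> infinite_dim V.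
Proof.
move=> nr [x x0]; apply/infinite_dimP => s; apply: contrapT => gen.
have {}gen z : in_span s z by apply: contrapT => nz; apply: gen; exists z.
pose B (y : V * V) u := omega V y.1 u + omega' V y.2 u.
have [t xt] : exists t, omega V x t != 0.
  apply: contrapT => none; case/eqP: x0; have [] // := nr x 0 => z.
  rewrite form0l addr0; apply: contrapT => /eqP nz; apply: none; by exists z.
pose l (y : V * V) := omega V y.1 t.
have Bl u : linear_for *%R (B^~ u) by move=> c y z; rewrite /B /= !formE; ring.
have Br y : linear_for *%R (B y) by move=> c u v; rewrite /B /= !formE; ring.
have lL : linear_for *%R l by move=> c y z; rewrite /l /= !formE.
have sT : subspace (fun _ : V => True) by [].
have [|u _ uE] := linear_system Bl Br sT (s := (x, 0) :: [seq (0, e) | e <- s]) lL.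
  by move=> y _ yB; rewrite /l; have [z|-> _] := nr y.1 y.2; [exact: yB | rewrite form0l].
have xu : omega V x u = omega V x t.
  by have := uE (x, 0) (span_head _ _); rewrite /B /l /= form0l addr0.
have u0 : u = 0.
  have [z|] // := nr 0 u; rewrite form0l add0r formC; move: (gen z); move: z.
  apply: span_min => [|e es]; first by split=> [|c y z y0 z0]; rewrite !formE ?y0 ?z0 ?mulr0 ?addr0.
  have se : (0, e) \in (x, 0) :: [seq (0, e) | e <- s].
    by rewrite inE (map_f (pair 0)) ?orbT.
  by have := uE (0, e) (span_mem se); rewrite /B /l /= !form0l add0r.
by move: xt; rewrite -xu u0 form0r eqxx.
Qed.

Lemma no_relation_full V : no_relation V -> (exists x : V, x != 0) ->
  full (omega V) (omega' V).
Proof.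
move=> nr nz c d cd; apply: (full_of_infinite_rank k2) => t.
have [x xt] := proj1 (infinite_dimP V) (no_relation_infinite nr nz) t.
exists x => e te; apply: contrapT => none; apply: xt.
have rel z : omega V (c *: (x - e)) z + omega' V (d *: (x - e)) z = 0.
  rewrite !formZl; apply: contrapT => /eqP nz'; apply: none; by exists z.
have [/eqP c0 /eqP d0] := nr _ _ rel.
move: c0 d0; rewrite !scaler_eq0; case/orP: cd => /negPf -> /=.
  by rewrite subr_eq0 => /eqP ->.
by rewrite subr_eq0 => _ /eqP ->.
Qed.

(** Back-and-forth with W = 0. *)
Lemma no_relation_universal_homogeneous V : countably_spanned V ->
  no_relation V -> (exists x : V, x != 0) -> universal_homogeneous V.
Proof.
move=> cV nr nz; have fV := no_relation_full nr nz.
split; first by split; [exact: countably_spanned_dim | exact: no_relation_infinite].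
  exact: full_universal.
move=> W /finite_dimP[t tE] sigma tau [sinj sE] [tinj tauE].
have rad0 x : (forall z, omega V x z = 0) -> x = 0.
  by move=> xr; have [z|] // := nr x 0; rewrite xr form0l addr0.
pose s := [seq (tau w, sigma w) | w <- t].
have sP v : in_span s v -> exists w, v = (tau w, sigma w).
  move: v; apply: span_min => [|_ /mapP[w _ ->]]; last by exists w.
  split; first by exists 0; rewrite !linear0.
  by move=> c _ _ [w ->] [w' ->]; exists (c *: w + w'); rewrite !linearP.
have ps w : in_span s (tau w, sigma w).
  move: (tE w); move: w; apply: span_min => [|w wt]; last first.
    by apply: span_mem; apply: (map_f (fun w => (tau w, sigma w))).
  split; first by rewrite !linear0; apply: subspace0 (subspace_span _).
  by move=> c w w' ws w's; rewrite !linearP; apply: (proj2 (subspace_span s)) ws w's.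
have [|||g [gbij g1 g2 gs]] := @back_and_forth _ k2 V (omega V) (omega' V) _ fV _ s cV.
- by move=> x y /nr[].
- exact: (Or31 _ _ rad0).
- move=> v /sP[w ->] /=; have z0 : tau w = 0 <-> sigma w = 0.
    have i0 (f : {linear W -> V}) : injective f -> f w = 0 <-> w = 0.
      by move=> finj; split=> [E|->]; [apply: finj; rewrite E linear0 | exact: linear0].
    by rewrite !i0.
  have radE x : (forall z, omega V x z = 0) <-> x = 0.
    by split=> [/rad0//|-> z]; rewrite form0l.
  by split=> //; rewrite ?radE // /omega /omega' sE tauE.
exists g => [|x]; last by rewrite (gs _ (ps x)).
by split=> //; split; [exact: bij_inj | apply: ord2_ind].
Qed.

End Homogeneity.

(** * Orbits and reflections relative to the kernel of a form *)
Section RelativeTransitivity.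
Variables (k : closedFieldType) (k2 : 2%:R != 0 :> k).
Variables (V : biquadratic k) (p q : point k).
Hypotheses (npq : ~ same_point p q) (cV : countably_spanned V).
Hypothesis fV : full (omega V) (omega' V).
Local Notation a := (omega_at V p).
Local Notation b := (omega_at V q).
Hypothesis rel0 : forall x y, (forall z, a x z + b y z = 0) -> y = 0.
Hypothesis perpW :
  [\/ forall x, (forall z, a x z = 0) -> x = 0,
      forall x, (forall w, (forall z, a w z = 0) -> b x w = 0) -> x = 0 |
      (forall w w', (forall z, a w z = 0) -> (forall z, a w' z = 0) -> b w w' = 0) /\
      (forall x, (forall w, (forall z, a w z = 0) -> b x w = 0) -> forall z, a x z = 0)].

Let aut_pair x y : partial_aut a b [:: (x, y)] ->
  exists2 g : {linear V -> V}, is_aut g & g x = y.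
Proof.
move=> /(back_and_forth k2 rel0 (proj1 (full_at V npq) fV) perpW cV)[g [gbij ga gb gs]].
exists g; first exact: aut_of_at npq gbij ga gb.
exact: (gs (x, y) (span_head _ _)).
Qed.

(** Two vectors outside W = ker a with the same norms are conjugate by
    back-and-forth, and every x outside W is a difference of two vectors
    conjugate to v. *)
Lemma subrep_outside_ker (S : submodClosed V) v :
  subrep S -> v \in S -> v \notin ker_at V p -> forall x, x \in S.
Proof.
move=> rS Sv nWv; have fab := proj1 (full_at V npq) fV.
have conj u : ~ (forall z, a u z = 0) -> a u u = a v v -> b u u = b v v -> u \in S.
  move=> nWu au bu; have nWv' : ~ (forall z, a v z = 0).
    by move=> /ker_atP; apply/negP.
  have nz (x : V) : ~ (forall z, a x z = 0) -> x != 0.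
    by move=> nx; apply/eqP => x0; apply: nx => z; rewrite x0 form0l.
  have [|g gaut <-] := @aut_pair v u; last exact: rS.
  move=> w /span_consP[c [_ [-> ->]]] /=; rewrite !addr0.
  have [->|c0] := eqVneq c 0; first by rewrite !scale0r !form0l.
  have radZ x : (forall z, a (c *: x) z = 0) <-> (forall z, a x z = 0).
    split=> xr z; last by rewrite formZl xr mulr0.
    by apply: (mulfI c0); rewrite -formZl xr mulr0.
  split; try by rewrite !formE ?au ?bu.
  - by split=> /eqP; rewrite scaler_eq0 (negPf c0) /= => /eqP x0;
      [move: (nz v nWv') | move: (nz u nWu)]; rewrite x0 eqxx.
  by rewrite !radZ; split.
have out x : x \notin ker_at V p -> x \in S.
  move=> nWx; have [c d rel|u [[au bu] [aux bux] nu nux]] :=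
      difference_of_conjugates k2 (x := x) (a v v) (b v v) fab.
    have /eqP : d *: x = 0.
      by apply: (@rel0 (c *: x)) => z; rewrite !formZl.
    rewrite scaler_eq0; case: (eqVneq x 0) nWx => [->|_ nWx]; first by rewrite rpred0.
    rewrite orbF => /eqP d0; split=> //; apply: contrapT => /eqP c0.
    move/negP: nWx; apply; apply/ker_atP => z; apply: (mulfI c0).
    by have := rel z; rewrite d0 mul0r addr0 mulr0.
  by rewrite -(addKr u x) addrC; apply: memB; apply: conj.
move=> x; have [Wx|] := boolP (x \in ker_at V p); last exact: out.
rewrite -(memDr x Sv); apply: out; apply: contra nWv => Wvx.
by rewrite -(memDr v Wx) addrC.
Qed.

Lemma subrep_inside_ker (S : submodClosed V) w :
  (forall w w', w \in ker_at V p -> w' \in ker_at V p -> b w w' = 0) ->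
  subrep S -> w \in S -> w \in ker_at V p -> w != 0 -> {subset ker_at V p <= S}.
Proof.
move=> iso rS Sw Ww w0 w' Ww'; have [->|w'0] := eqVneq w' 0; first exact: rpred0.
have [|g gaut <-] := @aut_pair w w'; last exact: rS.
move=> v /span_consP[c [_ [-> ->]]] /=; rewrite !addr0.
have kerE x z : x \in ker_at V p -> a x z = 0 by move=> /ker_atP.
split.
- by split=> /eqP; rewrite scaler_eq0 ?(negPf w0) ?(negPf w'0) orbF => /eqP ->; rewrite scale0r.
- by split=> _ z; rewrite formZl kerE // mulr0.
- by rewrite !formZl !kerE // !mulr0.
by rewrite !formE !iso // !mulr0.
Qed.

End RelativeTransitivity.

Section Reflections.
Variables (k : closedFieldType) (k2 : 2%:R != 0 :> k).

(** Each condition excludes finitely many t. *)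
Lemma anisotropic_perturbation (V : lmodType k) (f : {symmetric V}) x v u :
  f x v != 0 -> f v v != 0 \/ f v u != 0 ->
  exists t, [/\ t != 0, f x (v + t *: u) != 0 & f (v + t *: u) (v + t *: u) != 0].
Proof.
move=> xv vu.
pose L : {poly k} := (f x u) *: 'X + (f x v)%:P.
pose Q : {poly k} := (f u u) *: 'X^2 + (2%:R * f v u) *: 'X + (f v v)%:P.
have L0 : L != 0.
  apply/eqP => E; have := congr1 (fun P : {poly k} => P.[0]) E.
  by rewrite /L hornerD hornerZ hornerX hornerC horner0 mulr0 add0r; apply/eqP.
have Q0 : Q != 0.
  apply/eqP => E; case: vu => /eqP; apply.
    have := congr1 (fun P : {poly k} => P`_0) E.
    by rewrite /Q !coefE /= !mulr0 !add0r.
  have := congr1 (fun P : {poly k} => P`_1) E.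
  rewrite /Q !coefE /= mulr0 add0r addr0 mulr1 => /eqP.
  by rewrite mulf_eq0 (negPf k2) => /eqP.
have X0 : ('X : {poly k}) != 0 by rewrite polyX_eq0.
have /closed_nonrootP[t] : 'X * L * Q != 0 by rewrite !mulf_neq0.
rewrite rootM rootM !negb_or -andbA => /and3P[t0 Lt Qt]; exists t; split.
- by move: t0; rewrite /root hornerX.
- by move: Lt; rewrite /root /L hornerD hornerZ hornerX hornerC !formE addrC mulrC.
move: Qt; rewrite /root /Q !(hornerD, hornerZ, hornerXn, hornerX, hornerC).
by apply: contraNneq => E; apply/eqP; rewrite -[RHS]E !formE (formC f u); ring.
Qed.

Variables (V : biquadratic k) (p q : point k) (npq : ~ same_point p q).
Local Notation a := (omega_at V p).
Local Notation b := (omega_at V q).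

(** The reflection of b in w preserves a as well, because w is in the kernel of
    a. *)
Lemma reflection w : w \in ker_at V p -> b w w != 0 ->
  exists2 g : {linear V -> V}, is_aut g &
    forall x, g x = x - (2%:R * b x w / b w w) *: w.
Proof.
move=> Ww bw; pose f x := x - (2%:R * b x w / b w w) *: w.
have fL : linear f.
  move=> c x y; rewrite /f scalerBr scalerA addrACA -opprD -scalerDl.
  by congr (_ - _ *: w); rewrite !formE; ring.
have fK : involutive f.
  move=> x; rewrite /f -addrA -opprD -scalerDl -[RHS]subr0; congr (_ - _).
  rewrite (_ : _ + _ = 0) ?scale0r // !formE; field; exact: bw.
have kerE z : a w z = 0 by have /ker_atP := Ww.
have kerE' z : a z w = 0 by rewrite formC.
exists (lin_of fL) => //; apply: (aut_of_at npq); first by exists f.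
  by move=> x y; rewrite -[LHS]/(a (f x) (f y)) /f !formE !kerE !kerE'; ring.
by move=> x y; rewrite -[LHS]/(b (f x) (f y)) /f !formE (formC b w y); field.
Qed.

(** If w reflects x to x - c w with c nonzero, then w is in S; such w span ker a
    because they are generic. *)
Lemma subrep_reflection (S : submodClosed V) x :
  (forall w, w \in ker_at V p ->
     (forall w', w' \in ker_at V p -> b w w' = 0) -> w = 0) ->
  subrep S -> x \in S -> x \in ker_at V p -> x != 0 -> {subset ker_at V p <= S}.
Proof.
move=> nd rS Sx Wx x0.
have witness v : v \in ker_at V p -> v != 0 -> exists w, w \in ker_at V p /\ b v w != 0.
  move=> Wv v0; apply: contrapT => none; case/eqP: v0; apply: nd => // w Ww.
  by apply: contrapT => /eqP nz; apply: none; exists w.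
have [w [Ww xw]] := witness x Wx x0.
have good v : v \in ker_at V p -> b x v != 0 -> b v v != 0 -> v \in S.
  move=> Wv xv vv; have [g gaut gE] := reflection Wv vv.
  have c0 : 2%:R * b x v / b v v != 0 by rewrite !mulf_neq0 ?invr_eq0.
  rewrite -(memZ _ _ c0) -[_ *: v](subKr x) -gE.
  by apply: memB => //; apply: rS.
have [v [Wv xv vv]] : exists v, [/\ v \in ker_at V p, b x v != 0 & b v v != 0].
  have [ww|ww] := eqVneq (b w w) 0; last by exists w.
  have [|w' [Ww' ww']] := witness w Ww.
    by apply: contraNneq xw => ->; rewrite form0r.
  have [t [_ h1 h2]] := anisotropic_perturbation xw (or_intror ww').
  by exists (w + t *: w'); split=> //; rewrite rpredD ?rpredZ.
move=> u Wu; have [t [t0 h1 h2]] := anisotropic_perturbation (u := u) xv (or_introl vv).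
rewrite -(memZ _ u t0) -(memDr (t *: u) (good v Wv xv vv)).
by apply: good => //; rewrite rpredD ?rpredZ.
Qed.

End Reflections.

(** * Equivariant operators *)
Section PolynomialAction.
Variables (k : closedFieldType) (U : lmodType k) (T : {linear U -> U}).
Implicit Types (P Q : {poly k}) (x y : U).

Definition poly_act P x : U := \sum_(i < size P) P`_i *: iter i T x.

Lemma poly_act_widen n P x : (size P <= n)%N ->
  poly_act P x = \sum_(i < n) P`_i *: iter i T x.
Proof.
move=> Pn; rewrite /poly_act (big_ord_widen _ (fun i => P`_i *: iter i T x) Pn).
rewrite big_mkcond; apply: eq_bigr => i _; case: ltnP => // /(nth_default 0) ->.
by rewrite scale0r.
Qed.

Lemma poly_actD P Q x : poly_act (P + Q) x = poly_act P x + poly_act Q x.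
Proof.
pose n := maxn (size P) (size Q).
rewrite !(@poly_act_widen n) ?leq_maxl ?leq_maxr //; last exact: size_polyD.
by rewrite -big_split; apply: eq_bigr => i _; rewrite coefD scalerDl.
Qed.

Lemma poly_actZ c P x : poly_act (c *: P) x = c *: poly_act P x.
Proof.
rewrite !(@poly_act_widen (size P)) ?size_scale_leq // scaler_sumr.
by apply: eq_bigr => i _; rewrite coefZ scalerA.
Qed.

Lemma iter_linear n c x y : iter n T (c *: x + y) = c *: iter n T x + iter n T y.
Proof. by elim: n => //= n ->; rewrite linearP. Qed.

Lemma poly_act_linear P c x y :
  poly_act P (c *: x + y) = c *: poly_act P x + poly_act P y.
Proof.
rewrite /poly_act scaler_sumr -big_split; apply: eq_bigr => i _.
by rewrite iter_linear scalerDr !scalerA mulrC.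
Qed.

Lemma poly_act_mulX P x : poly_act (P * 'X) x = poly_act P (T x).
Proof.
rewrite (@poly_act_widen (size P).+1); last first.
  by have [->|P0] := eqVneq P 0; rewrite ?mul0r ?size_poly0 // size_mulX.
rewrite big_ord_recl coefMX scale0r add0r; apply: eq_bigr => i _.
by rewrite coefMX /= -iterS iterSr.
Qed.

Lemma poly_act_factor P c x : poly_act (P * ('X - c%:P)) x = poly_act P (T x - c *: x).
Proof.
rewrite mulrBr mulrC [P * c%:P]mulrC mul_polyC [_ * P]mulrC -scaleNr.
rewrite poly_actD poly_actZ poly_act_mulX.
by rewrite addrC -poly_act_linear scaleNr addrC.
Qed.

(** The polynomial splits into factors 'X - c, each acting injectively. *)
Lemma poly_act_injective P x : (forall c y, T y - c *: y = 0 -> y = 0) ->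
  P != 0 -> poly_act P x = 0 -> x = 0.
Proof.
move=> inj; have [n] := ubnP (size P); elim: n P x => // n IH P x.
rewrite ltnS => Pn P0 Px.
have [sP|sP] := eqVneq (size P) 1%N.
  have /size_poly1P[c c0 PE] : size P == 1%N by rewrite sP.
  move: Px; rewrite /poly_act PE size_polyC c0 big_ord1 coefC /= => /eqP.
  by rewrite scaler_eq0 (negPf c0) => /eqP.
have /closed_rootP[c /factor_theorem[Q PQ]] := sP.
have Q0 : Q != 0 by apply: contraNneq P0 => Q0; rewrite PQ Q0 mul0r.
apply: (inj c); apply: (IH Q) => //; last by rewrite -poly_act_factor -PQ.
by move: Pn; rewrite PQ size_Mmonic ?monicXsubC // size_XsubC addn2.
Qed.

End PolynomialAction.

Section Resolvents.
Variables (k : closedFieldType) (k_uncountable : ~ countable [set: k]).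

(** Otherwise let R c solve (T - c)(R c) = v with v nonzero. Uncountably many
    vectors R c lie in a space of countable dimension, so some n + 1 of them lie
    in an n-dimensional subspace and satisfy a relation with coefficients u_i
    and points l_i. Applying the product of all T - l_j turns it into Q(T) v = 0
    with Q = \sum_i u_i \prod_(j != i) ('X - l_j), which is nonzero, as one sees
    by evaluating at the l_i. This contradicts injectivity of the T - c.

    The embedding into V spares a proof that a subspace has countable
    dimension. *)
Lemma exists_singular_shift (U V : lmodType k) (iota : {linear U -> V}) (T : {linear U -> U}) :
  injective iota -> countably_spanned V -> (exists x : U, x != 0) ->
  (forall c x, T x - c *: x = 0 -> x = 0) ->
  exists c y, forall x, T x - c *: x <> y.
Proof.
move=> iinj [b bE] [v v0] inj; apply: contrapT => surj.
have /choice[R RE] : forall c, exists x, T x - c *: x = v.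
  by move=> c; apply: contrapT => none; apply: surj; exists c, v => x E; apply: none; exists x.
pose A n := [set c : k | in_span (mkseq b n) (iota (R c))].
have [n infA] : exists n, ~ finite_set (A n).
  apply: contrapT => none; apply: k_uncountable.
  have -> : [set: k] = \bigcup_(n in [set: nat]) A n.
    by apply/seteqP; split=> // c _; have [n nE] := bE (iota (R c)); exists n.
  apply: bigcup_countable => [|n _]; first exact: countableP.
  by apply: finite_set_countable; apply: contrapT => nf; apply: none; exists n.
have [B BA sB] := infinite_set_fset n.+1 infA.
pose l (i : 'I_n.+1) := nth 0 (finmap.enum_fset B) i.
have lB i : A n (l i).
  by apply: BA => /=; apply: mem_nth; apply: leq_trans sB.
have linj : injective l.
  have iB (i : 'I_n.+1) : (i < size (finmap.enum_fset B))%N by apply: leq_trans sB.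
  by move=> i j /eqP; rewrite nth_uniq ?finmap.fset_uniq ?iB // => /eqP/val_inj.
have /choice[M ME] : forall i, exists m : 'rV_n, iota (R (l i)) = \sum_j m 0 j *: b j.
  move=> i; have [c cE] := span_nth (lB i); move: c cE; rewrite size_mkseq => c cE.
  exists (\row_j c j); rewrite cE; apply: eq_bigr => j _.
  by rewrite mxE nth_mkseq.
pose C := \matrix_i M i.
have : kermx C != 0.
  by rewrite -mxrank_eq0 mxrank_ker subn_eq0 -ltnNge (leq_ltn_trans (rank_leq_col C)).
move=> /rowV0Pn[u /sub_kermxP uC u0].
have sum0 : \sum_i u 0 i *: R (l i) = 0.
  apply: iinj; rewrite linear0 linear_sum.
  under eq_bigr => i _ do rewrite linearZ /= ME scaler_sumr.
  rewrite exchange_big big1 // => j _.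
  under eq_bigr do rewrite scalerA; rewrite -scaler_suml.
  have := congr1 (fun D : 'rV_ _ => D 0 j) uC; rewrite !mxE => uj.
  by under eq_bigr => i _ do [have -> : M i 0 j = C i j by rewrite mxE]; rewrite uj scale0r.
pose P i := \prod_(j | j != i) ('X - (l j)%:P).
pose Q := \sum_i u 0 i *: P i.
have Q0 : Q != 0.
  apply: contraNneq u0 => Q0; apply/eqP/rowP => i; rewrite mxE.
  have := congr1 (fun D : {poly k} => D.[l i]) Q0.
  rewrite horner_sum (bigD1 i) //= big1 ?addr0 ?horner0 => [|j ji]; last first.
    by rewrite hornerZ /P horner_prod (bigD1 i) 1?eq_sym //= hornerXsubC subrr mul0r mulr0.
  rewrite hornerZ => /eqP; rewrite mulf_eq0 => /orP[/eqP //|].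
  rewrite /P horner_prod prodf_seq_eq0 => /hasP[j _ /andP[ji]].
  by rewrite hornerXsubC subr_eq0 => /eqP/linj E; rewrite E eqxx in ji.
pose Pi := \prod_j ('X - (l j)%:P).
have act_add (D : {poly k}) x y : poly_act T D (x + y) = poly_act T D x + poly_act T D y.
  by have := poly_act_linear T D 1 x y; rewrite !scale1r.
have act0 (D : {poly k}) : poly_act T D 0 = 0.
  by apply: (addIr (poly_act T D 0)); rewrite -act_add !add0r.
have actZ (D : {poly k}) c x : poly_act T D (c *: x) = c *: poly_act T D x.
  by have := poly_act_linear T D c x 0; rewrite !addr0 act0 addr0.
case/eqP: v0; apply: (poly_act_injective inj Q0).
have -> : poly_act T Q v = \sum_i u 0 i *: poly_act T (P i) v.
  rewrite /Q; apply: (big_ind2 (fun D x => poly_act T D v = x)) => [|D x E y <- <-|i _].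
  - by rewrite /poly_act size_poly0 big_ord0.
  - exact: poly_actD.
  exact: poly_actZ.
have -> : \sum_i u 0 i *: poly_act T (P i) v = poly_act T Pi (\sum_i u 0 i *: R (l i)).
  symmetry; apply: (big_ind2 (fun x y => poly_act T Pi x = y)) => [|x1 y1 x2 y2 <- <-|i _].
  - exact: act0.
  - exact: act_add.
  rewrite actZ -[in RHS](RE (l i)) -poly_act_factor; congr (_ *: poly_act T _ _).
  by rewrite /Pi (bigD1 i) //= mulrC.
by rewrite sum0 act0.
Qed.

(** All omega(p) are nondegenerate because their kernels are proper
    subrepresentations. A relation would therefore make omega_x = omega'_(T x)
    define an everywhere defined equivariant operator T without eigenvectors.
    Some T - c is not surjective, and its image is a proper nonzero
    subrepresentation. *)
Lemma irreducible_no_relation (V : biquadratic k) : irreducible V -> countably_spanned V ->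
  (forall p : point k, exists x, x \notin ker_at V p) -> no_relation V.
Proof.
move=> [[v v0] irr] cV nker.
have ker0 p x : x \in ker_at V p -> x = 0.
  have [z0|all] := irr _ (@subrep_ker_at _ V p); first exact: z0.
  by have [y] := nker p; rewrite all.
have omega_inj (c : k) x : (forall z, omega V x z = c * omega' V x z) -> x = 0.
  move=> xr; have h : ((- c : k) != 0) || ((1 : k) != 0) by rewrite oner_eq0 orbT.
  by apply: (ker0 (Point h)); apply/ker_atP => z; rewrite omega_atE /= xr; ring.
have omega'_inj x : (forall z, omega' V x z = 0) -> x = 0.
  move=> xr; have h : ((1 : k) != 0) || ((0 : k) != 0) by rewrite oner_eq0.
  by apply: (ker0 (Point h)); apply/ker_atP => z; rewrite omega_atE /= xr; ring.
suff rel0 x y : (forall z, omega V x z = omega' V y z) -> x = 0 /\ y = 0.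
  move=> x y rel; have [z|-> /eqP] := rel0 x (- y); last by rewrite oppr_eq0 => /eqP.
  by apply/eqP; rewrite formNl -addr_eq0 rel.
move=> rel; suff x0 : x = 0.
  by split=> //; apply: omega'_inj => z; rewrite -rel x0 form0l.
apply: contrapT => /eqP x0.
pose D x := exists y, forall z, omega V x z = omega' V y z.
have sD : subspace D.
  split; first by exists 0 => z; rewrite !form0l.
  by move=> c u u' [w uw] [w' uw']; exists (c *: w + w') => z; rewrite !formE uw uw'.
have rD : subrep (to_submod sD).
  move=> g gaut u /to_submodP[w uw]; apply/to_submodP; exists (g w) => z.
  have [h [_ _ hK]] := aut_inv gaut.
  by rewrite -(hK z) /omega /omega' !gaut.1.2; apply: uw.
have [z0|all] := irr _ rD.
  by case/eqP: x0; apply: z0; apply/to_submodP; exists y.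
pose G (uw : V * V) := forall z, omega V uw.1 z = omega' V uw.2 z.
have [||w wG|T TG Tuniq] := @linear_graph _ V V G.
- split=> [z|c u u' hu hu' z]; first by rewrite !form0l.
  by rewrite /G /= !formE hu hu'.
- by move=> u; have /to_submodP := all u.
- by apply: omega'_inj => z; rewrite -wG form0l.
have Teq g u : is_aut g -> T (g u) = g (T u).
  move=> gaut; symmetry; apply: Tuniq => z /=; have [h [_ _ hK]] := aut_inv gaut.
  by rewrite -(hK z) /omega /omega' !gaut.1.2; apply: (TG u).
have Tinj c u : T u - c *: u = 0 -> u = 0.
  move=> /eqP; rewrite subr_eq0 => /eqP E; apply: (omega_inj c) => z.
  by have := TG u z; rewrite /= E formZl.
have idinj : injective (idfun : {linear V -> V}) by [].
have [c [y' none]] := exists_singular_shift idinj cV (ex_intro _ v v0) Tinj.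
pose I y := exists u, T u - c *: u = y.
have sI : subspace I.
  split; first by exists 0; rewrite linear0 scaler0 subr0.
  move=> d _ _ [u <-] [u' <-]; exists (d *: u + u').
  by rewrite linearP [c *: (_ + _)]scalerDr opprD addrACA scalerBr !scalerA mulrC.
have rI : subrep (to_submod sI).
  move=> g gaut _ /to_submodP[u <-]; apply/to_submodP; exists (g u).
  by rewrite Teq // [RHS]linearB [in RHS]linearZ.
have [z0|allI] := irr _ rI.
  by case/eqP: v0; apply: (Tinj c); apply: z0; apply/to_submodP; exists v.
by have /to_submodP[u] := allI y'; apply: none.
Qed.

End Resolvents.

(** * Restricting automorphisms to a subrepresentation *)
Section Restriction.
Variables (k : fieldType) (r : nat) (V : multiquadratic k r) (U : submodClosed V).
Hypothesis rU : subrep U.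

Lemma restrict_linear (g : {linear V -> V}) : is_aut g ->
  exists2 h : {linear subsp U -> subsp U}, bijective h &
    forall u, subsp_val (h u) = g (subsp_val u).
Proof.
have Uval (u : subsp U) : subsp_val u \in U by exact: valP u.
have mk (f : {linear V -> V}) : is_aut f ->
    exists h : {linear subsp U -> subsp U}, forall u, subsp_val (h u) = f (subsp_val u).
  move=> faut; have hL : linear (fun u : subsp U => Subsp (rU faut (Uval u))).
    move=> c u w; apply: val_inj.
    rewrite -[LHS]/(f (subsp_val (c *: u + w))) linearP linearP; exact: erefl.
  by exists (lin_of hL).
move=> gaut; have [g' [g'aut gK g'K]] := aut_inv gaut.
have [h hE] := mk g gaut; have [h' h'E] := mk g' g'aut.
by exists h => //; exists h' => u; apply: val_inj; rewrite /= ?h'E ?hE ?h'E ?gK ?g'K.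
Qed.

(** Only the automorphisms of U which come from V need to stabilize S; this gives
    irreducibility under any larger group, such as the automorphisms of the four
    forms of type III. *)
Lemma length2_stable (S : submodClosed (subsp U)) : has_length V 2 ->
  (exists x, x \notin U) ->
  (forall (g : {linear V -> V}) (h : {linear subsp U -> subsp U}), is_aut g ->
     bijective h -> (forall u, subsp_val (h u) = g (subsp_val u)) ->
     forall u, u \in S -> h u \in S) ->
  zero_subspace S \/ forall u, u \in S.
Proof.
move=> len nU rS; pose P x := exists2 u : subsp U, u \in S & subsp_val u = x.
have sP : subspace P.
  split; first by exists 0; rewrite ?rpred0.
  by move=> c _ _ [u Su <-] [w Sw <-]; exists (c *: u + w); rewrite ?rpredD ?rpredZ.
have rP : subrep (to_submod sP).
  move=> g gaut _ /to_submodP[u Su <-]; apply/to_submodP.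
  by have [h hbij hE] := restrict_linear gaut; exists (h u) => //; apply: (rS g h).
have PU : {subset to_submod sP <= U}.
  by move=> _ /to_submodP[u _ <-]; exact: valP u.
have [z0|all] := length2_below len rU nU rP PU; [left=> u Su|right=> u].
  by apply: val_inj; apply: z0; apply/to_submodP; exists u.
by have /to_submodP[w Sw /val_inj <-] := all (subsp_val u) (valP u).
Qed.

Lemma restrict_irreducible : has_length V 2 -> nonzero_subspace U ->
  (exists x, x \notin U) -> irreducible (restrict U).
Proof.
move=> len [x Ux x0] nU; split.
  by exists (Subsp Ux); apply: contraNneq x0 => /(congr1 val)/= ->.
move=> S rS; apply: length2_stable => // g h gaut hbij hE u.
apply: (rS h); split=> //; split; first exact: bij_inj.
by move=> i a b; rewrite -[LHS]/(mq_form V i (subsp_val (h a)) (subsp_val (h b))) !hE gaut.1.2.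
Qed.

End Restriction.

(** * Types Ia and Ib have length two *)
Section SplitTypes.
Variables (k : closedFieldType) (k2 : 2%:R != 0 :> k).
Implicit Types (V : biquadratic k) (p q : point k).

Lemma same_point_sym p q : same_point p q -> same_point q p.
Proof.
move=> [c c0 [e0 e1]]; exists c^-1; first by rewrite invr_eq0.
by rewrite e0 e1 !mulKf.
Qed.

Lemma direct_sum_sym (V : lmodType k) (U W : submodClosed V) : direct_sum U W -> direct_sum W U.
Proof.
move=> [dec disj]; split=> [v|x Wx Ux]; last exact: disj.
by have [x [y [Ux Wy ->]]] := dec v; exists y, x; rewrite addrC.
Qed.

(** The form a is nondegenerate on W' = ker b, and for c nonzero c a + d b has
    the same restriction to W' up to the factor c. *)
Lemma infinite_summand V p q c d : direct_sum (ker_at V p) (ker_at V q) ->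
  infinite_dim (subsp (ker_at V q)) -> c != 0 ->
  forall t, exists x, forall e, in_span t e ->
    exists z, c * omega_at V p (x - e) z + d * omega_at V q (x - e) z != 0.
Proof.
move=> dsum inf c0 t; have [f fE] := projection (direct_sum_sym dsum).
have [x xt] := proj1 (infinite_dimP _) inf (map f t).
exists (subsp_val x) => e te; pose y := x - f e.
have y0 : y != 0.
  by apply/eqP => /eqP; rewrite subr_eq0 => /eqP E; apply: xt; rewrite E; apply: span_map.
have [z yz] : exists z, omega_at V p (subsp_val y) z != 0.
  apply: contrapT => none; case/eqP: y0; apply: val_inj => /=; apply: (proj2 dsum).
    apply/ker_atP => z; apply: contrapT => /eqP nz; by apply: none; exists z.
  exact: valP y.
have pE v u : omega_at V p v (subsp_val (f u)) = omega_at V p v u.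
  rewrite -[in RHS](subrK (subsp_val (f u)) u) formDr (formC _ v (_ - _)).
  by have /ker_atP-> := fE u; rewrite add0r.
have pEl v u : omega_at V p (subsp_val (f v)) u = omega_at V p v u.
  by rewrite formC pE formC.
exists (subsp_val (f z)); have /ker_atP q0 : subsp_val (f z) \in ker_at V q by exact: valP (f z).
rewrite (formC (omega_at V q)) q0 mulr0 addr0 mulf_neq0 // pE.
by move: yz; rewrite /y linearB !formDl !formNl pEl.
Qed.

Lemma nonzero_of_infinite (V : lmodType k) (W : submodClosed V) :
  infinite_dim (subsp W) -> nonzero_subspace W.
Proof.
move=> /infinite_dimP/(_ [::])[x /= x0]; exists (subsp_val x); first exact: valP x.
by apply/eqP => E; apply: x0; apply: val_inj.
Qed.

(** Each summand is a nondegenerate quadratic space for one of the two forms, and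
    reflections in its vectors act irreducibly on it. *)
Lemma type_Ia_length2 V : type_Ia V -> universal V /\ has_length V 2.
Proof.
move=> [p [q [npq infp infq dsum]]].
have nqp : ~ same_point q p by move=> /same_point_sym.
have nd p' q' : direct_sum (ker_at V p') (ker_at V q') ->
    forall w, w \in ker_at V p' ->
    (forall w', w' \in ker_at V p' -> omega_at V q' w w' = 0) -> w = 0.
  move=> [dec disj] w Ww ww; apply: disj => //; apply/ker_atP => z.
  have [z1 [z2 [/ww z10 /ker_atP z20 ->]]] := dec z.
  by rewrite formDr z10 formC z20 addr0.
split.
  apply: (full_universal k2); apply/(full_at _ npq) => c d cd.
  apply: (full_of_infinite_rank k2) => t.
  case/orP: cd => h; first exact: infinite_summand.
  have [x xE] := infinite_summand c (direct_sum_sym dsum) infp h t.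
  by exists x => e /xE[z zE]; exists z; rewrite addrC.
have [w Ww w0] := nonzero_of_infinite infp; have [w' Ww' w'0] := nonzero_of_infinite infq.
apply: (length2_intro (@subrep_ker_at _ V p)).
- by exists w.
- by exists w'; apply/negP => Wp; case/eqP: w'0; apply: (proj2 dsum).
- move=> S rS SW [x Sx x0].
  exact: (subrep_reflection k2 npq (nd p q dsum) rS Sx (SW x Sx) x0).
move=> S x rS WS Sx nWx y; have [x1 [x2 [Wx1 Wx2 xE]]] := proj1 dsum x.
have Sx2 : x2 \in S by rewrite -(memDr x2 (WS _ Wx1)) -xE.
have x20 : x2 != 0 by apply: contraNneq nWx => x20; rewrite xE x20 addr0.
have nd' := nd q p (direct_sum_sym dsum).
have W'S := subrep_reflection k2 nqp nd' rS Sx2 Wx2 x20.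
by have [y1 [y2 [/WS Sy1 /W'S Sy2 ->]]] := proj1 dsum y; rewrite rpredD.
Qed.

Lemma orthogonal_summand_aut V (U W : submodClosed V) (h : {linear restrict U -> restrict U}) :
  direct_sum U W -> (forall i u w, u \in U -> w \in W -> mq_form V i u w = 0) ->
  is_aut h -> exists2 g : {linear V -> V}, is_aut g &
    forall u : subsp U, g (subsp_val u) = subsp_val (h u).
Proof.
move=> dsum UW haut; have [f fE] := projection dsum.
have Uval (u : subsp U) : subsp_val u \in U by exact: valP u.
have fval u : f (subsp_val u) = u.
  apply/esym/val_inj/eqP; rewrite -subr_eq0; apply/eqP; apply: (proj2 dsum) => //=.
  by apply: memB.
have f0 w : w \in W -> f w = 0.
  move=> Ww; apply: val_inj => /=; apply: (proj2 dsum) => //.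
  by rewrite -memN -(memDr _ Ww).
have mk (h' : {linear restrict U -> restrict U}) :
    exists g : {linear V -> V}, forall v, g v = subsp_val (h' (f v)) + (v - subsp_val (f v)).
  have gL : linear (fun v => subsp_val (h' (f v)) + (v - subsp_val (f v))).
    move=> c x y; rewrite !linearP /=.
    by rewrite [c *: x + y + _]addrACA -scalerDr addrACA -scalerDr.
  by exists (lin_of gL).
have [h' [h'aut hK h'K]] := aut_inv haut.
have [g gE] := mk h; have [g' g'E] := mk h'.
have fg v : f (g v) = h (f v) by rewrite gE linearD fval (f0 _ (fE v)) addr0.
have fg' v : f (g' v) = h' (f v) by rewrite g'E linearD fval (f0 _ (fE v)) addr0.
exists g; last by move=> u; rewrite gE fval subrr addr0.
have gK : cancel g g'.
  by move=> v; rewrite g'E fg hK gE addrAC subrr add0r addrC subrK.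
have g'K : cancel g' g.
  by move=> v; rewrite gE fg' h'K g'E addrAC subrr add0r addrC subrK.
split; last by exists g'.
split=> [|i x y]; first exact: can_inj gK.
have fUW (u : subsp U) z : mq_form V i (subsp_val u) (z - subsp_val (f z)) = 0.
  by apply: UW; [exact: Uval | exact: fE].
rewrite !gE -[in RHS](subrK (subsp_val (f x)) x) -[in RHS](subrK (subsp_val (f y)) y).
rewrite ![_ - _ + _ in RHS]addrC.
move: (haut.1.2 i (f x) (f y)) => /= hE.
rewrite !(formDr _ _ _ (_ - _)) !(formDl _ _ (_ - _)) !fUW.
rewrite !(formC _ (_ - _) (subsp_val _)) !fUW.
by congr (_ + _ + _).
Qed.

(** Reflections act irreducibly on W, and automorphisms of the universal
    homogeneous summand extend by the identity of W. *)
Lemma type_Ib_length2 V : type_Ib V -> universal V /\ has_length V 2.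
Proof.
move=> [p [[w Ww w0] uh dsum]]; have [q npq] := other_point p.
have [[_ inf] uU _] := uh; have [[u u0] irr] := universal_homogeneous_irreducible k2 uh.
have Uval (u1 : subsp (orth (ker_at V p))) : subsp_val u1 \in orth (ker_at V p) by exact: valP u1.
have nd : forall w, w \in ker_at V p ->
    (forall w', w' \in ker_at V p -> omega_at V q w w' = 0) -> w = 0.
  move=> w1 Ww1 ww; apply: (proj2 dsum) => //; apply/(orthP _ _ npq) => y Wy.
  by split; [have /ker_atP := Ww1 | exact: ww].
split.
  move=> E Efin; have [f [finj fE]] := uU E Efin.
  have fL : linear (fun x => subsp_val (f x)) by move=> c x y; rewrite !linearP.
  exists (lin_of fL); split=> [x y /val_inj/finj //|i x y]; exact: fE.
apply: (length2_intro (@subrep_ker_at _ V p)).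
- by exists w.
- exists (subsp_val u); apply/negP => Wu; case/eqP: u0; apply: val_inj => /=.
  exact: (proj2 dsum).
- move=> S rS SW [x Sx x0].
  exact: (subrep_reflection k2 npq nd rS Sx (SW x Sx) x0).
move=> S x rS WS Sx nWx y; have [x1 [x2 [Ux1 Wx2 xE]]] := proj1 dsum x.
have Sx1 : x1 \in S by rewrite -(memDr x1 (WS _ Wx2)) addrC -xE.
pose P (v : restrict (orth (ker_at V p))) := subsp_val v \in S.
have sP : subspace P.
  split; first exact: rpred0.
  by move=> c v v' Pv Pv'; rewrite /P linearP rpredD ?rpredZ.
have rP : subrep (to_submod sP).
  move=> h haut v /to_submodP Pv; apply/to_submodP.
  have [|g gaut gE] := orthogonal_summand_aut dsum _ haut; last by rewrite /P -gE; apply: rS.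
  by move=> i a b /asboolP aW Wb; apply: aW.
have [z0|all] := irr _ rP.
  move: nWx; rewrite xE; have /(congr1 val)/= -> : Subsp Ux1 = 0 :> subsp _.
    by apply: z0; apply/to_submodP.
  by rewrite add0r Wx2.
have [y1 [y2 [Uy1 /WS Sy2 ->]]] := proj1 dsum y; rewrite rpredD //.
by have /to_submodP := all (Subsp Uy1).
Qed.

End SplitTypes.

(** * Type Ic has length two *)
Section Quotients.
Variables (k : fieldType) (V : lmodType k) (W : submodClosed V).
Local Open Scope quotient_scope.

Lemma quot_pi_linear : linear (\pi_(quotsp W) : V -> quotsp W).
Proof.
move=> c x y; rewrite (raddfD (\pi_(quotsp W))) /=; congr (_ + _).
exact: pi_quot_scale.
Qed.

Definition quot_pi : {linear V -> quotsp W} := lin_of quot_pi_linear.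

Lemma quot_pi_surj (u : quotsp W) : exists x, quot_pi x = u.
Proof. by exists (repr u); rewrite -[RHS]reprK. Qed.

Lemma quot_pi_eq0 x : quot_pi x = 0 <-> x \in W.
Proof.
have E := Quotient.idealrBE (subspace_zmod W) x 0; rewrite subr0 in E.
have pi0 := linear0 quot_pi; split=> [x0|Wx].
  by rewrite -[_ \in _]/(x \in subspace_zmod W) E; apply/eqP; rewrite -[LHS]/(quot_pi x) x0 -pi0.
by rewrite -pi0; apply/eqP; rewrite -[_ == _]E.
Qed.

Lemma quot_section : countably_spanned V ->
  exists f : {linear quotsp W -> V}, forall u, quot_pi (f u) = u.
Proof.
move=> cV; have [C [dec disj]] := complement W cV.
pose G (ux : quotsp W * V) := quot_pi ux.2 = ux.1 /\ ux.2 \in C.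
have [||x [/= /quot_pi_eq0 Wx Cx]|f fG _] := @linear_graph _ (quotsp W) V G.
- split; first by split; rewrite ?linear0 ?rpred0.
  by move=> c ux vy [h1 h2] [h3 h4]; split; rewrite ?linearP ?h1 ?h3 ?rpredD ?rpredZ.
- move=> u; have [x <-] := quot_pi_surj u; have [w [y [Ww Cy ->]]] := dec x.
  by exists y; split=> //=; rewrite linearD (proj2 (quot_pi_eq0 w) Ww) add0r.
- exact: disj.
by exists f => u; have [] := fG u.
Qed.

End Quotients.

Section RadicalType.
Variables (k : closedFieldType) (k2 : 2%:R != 0 :> k).
Implicit Types (V : biquadratic k).

Lemma quot_form_pi V i (x y : V) :
  quot_form V i (quot_pi (mq_ker V) x) (quot_pi (mq_ker V) y) = mq_form V i x y.
Proof. exact: quot_formE. Qed.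

Lemma mq_ker_form V i (x y : V) : x \in mq_ker V -> mq_form V i x y = 0.
Proof. by move=> /forallP/(_ i) /asboolP. Qed.

Lemma subrep_mq_ker V : subrep (mq_ker V).
Proof.
move=> g gaut x xK; have [h [_ _ hK]] := aut_inv gaut.
by apply/forallP => i; apply/asboolP => y; rewrite -(hK y) gaut.1.2 mq_ker_form.
Qed.

(** Transport along a linear section; the forms only see the quotient. *)
Lemma quot_aut_lift V (h : {linear quot_ker V -> quot_ker V}) : countably_spanned V ->
  is_aut h -> exists2 g : {linear V -> V}, is_aut g &
    forall x, quot_pi (mq_ker V) (g x) = h (quot_pi (mq_ker V) x).
Proof.
move=> cV haut; have [f fE] := quot_section (mq_ker V) cV.
pose pi := quot_pi (mq_ker V).
have mk (h' : {linear quot_ker V -> quot_ker V}) :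
    exists g : {linear V -> V}, forall v, g v = f (h' (pi v)) + (v - f (pi v)).
  have gL : linear (fun v => f (h' (pi v)) + (v - f (pi v))).
    move=> c x y; rewrite !linearP /=.
    by rewrite [c *: x + y + _]addrACA -scalerDr addrACA -scalerDr.
  by exists (lin_of gL).
have [h' [h'aut hK h'K]] := aut_inv haut.
have [g gE] := mk h; have [g' g'E] := mk h'.
have pig v : pi (g v) = h (pi v) by rewrite gE /pi linearD linearB !fE subrr addr0.
have pig' v : pi (g' v) = h' (pi v) by rewrite g'E /pi linearD linearB !fE subrr addr0.
exists g => //.
have gK : cancel g g'.
  by move=> v; rewrite g'E pig hK gE addrAC subrr add0r addrC subrK.
have g'K : cancel g' g.
  by move=> v; rewrite gE pig' h'K g'E addrAC subrr add0r addrC subrK.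
split; last by exists g'.
split=> [|i x y]; first exact: can_inj gK.
by rewrite -!quot_form_pi -/pi !pig; apply: haut.1.2.
Qed.

(** For a functional phi and d in ker(V) with phi(d) = 0, the transvection
    v + phi(v) d preserves the forms, and with phi(x) = 1 it moves x by d. So a
    subrepresentation containing a nonzero x of ker(V) contains every such d,
    and these span ker(V) together with x. The quotient is handled by lifting
    automorphisms. *)
Lemma type_Ic_length2 V : countably_spanned V -> type_Ic V -> universal V /\ has_length V 2.
Proof.
move=> cV [[u Ku u0] uh]; have [[_ inf] uQ _] := uh.
have [[w w0] irr] := universal_homogeneous_irreducible k2 uh.
pose pi := quot_pi (mq_ker V).
split.
  move=> E Efin; have [f [finj fE]] := uQ E Efin; have [s sE] := quot_section (mq_ker V) cV.
  have fL : linear (fun x => s (f x)) by move=> c x y; rewrite !linearP.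
  exists (lin_of fL); split=> [x y E0|i x y].
    by apply: finj; rewrite -[f x]sE -[f y]sE; congr (quot_pi _ _).
  by rewrite -fE -[f x in RHS]sE -[f y in RHS]sE; apply/esym/quot_form_pi.
apply: (length2_intro (@subrep_mq_ker V)).
- by exists u.
- have [x xw] := quot_pi_surj w; exists x; apply/negP => /quot_pi_eq0 x0.
  by case/eqP: w0; rewrite -xw.
- move=> S rS SK [x Sx x0] y Ky.
  pose P z := exists c, z = c *: x.
  have sP : subspace P.
    split; first by exists 0; rewrite scale0r.
    by move=> c _ _ [d ->] [e ->]; exists (c * d + e); rewrite scalerDl scalerA.
  have [C dC] := complement (to_submod sP) cV; have [dec disj] := dC.
  pose G (vc : V * k^o) := vc.1 - (vc.2 : k) *: x \in C.
  have [||c|phi phiG phiu] := @linear_graph _ V k^o G.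
  - split; first by rewrite /G /= scale0r subr0 rpred0.
    move=> c v v' Gv Gv'; rewrite /G /=.
    have -> : c *: v.1 + v'.1 - (c * (v.2 : k) + (v'.2 : k)) *: x =
              c *: (v.1 - (v.2 : k) *: x) + (v'.1 - (v'.2 : k) *: x).
      by rewrite scalerBr scalerA scalerDl opprD addrACA.
    by rewrite rpredD ?rpredZ.
  - move=> v; have [_ [z [/to_submodP[c ->] Cz ->]]] := dec v.
    by exists c; rewrite /G /= addrAC subrr add0r.
  - rewrite /G /= sub0r memN => Cc; have /eqP : c *: x = 0 :> V.
      by apply: disj => //; apply/to_submodP; exists c.
    by rewrite scaler_eq0 (negPf x0) orbF => /eqP.
  have phix : phi x = 1 by apply/esym/phiu; rewrite /G /= scale1r subrr rpred0.
  have phiZ c v : phi (c *: v) = c * phi v by exact: linearZ.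
  have trans d : d \in mq_ker V -> phi d = 0 -> d \in S.
    move=> Kd d0; pose f v := v + (phi v : k) *: d.
    have fL : linear f.
      by move=> c v v'; rewrite /f linearP scalerDl scalerDr scalerA addrACA.
    pose f' v := v - (phi v : k) *: d.
    have phif v : phi (f v) = phi v by rewrite linearD phiZ d0 mulr0 addr0.
    have phif' v : phi (f' v) = phi v by rewrite linearB phiZ d0 mulr0 subr0.
    have fK : cancel f f' by move=> v; rewrite /f' phif addrK.
    have f'K : cancel f' f by move=> v; rewrite /f phif' subrK.
    have faut : is_aut (lin_of fL).
      split; last by exists f'.
      split=> [|i a b]; first exact: can_inj fK.
      rewrite -[LHS]/(mq_form V i (f a) (f b)) /f !formE !(mq_ker_form _ _ Kd).
      by rewrite (formC _ a d) (mq_ker_form _ _ Kd) !mulr0 !addr0.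
    have -> : d = f x - x by rewrite /f phix scale1r addrAC subrr add0r.
    by apply: memB => //; apply: (rS _ faut).
  rewrite -(subrK ((phi y : k) *: x) y) rpredD ?rpredZ //.
  apply: trans; last by rewrite linearB phiZ phix mulr1 subrr.
  by apply: memB => //; rewrite rpredZ // SK.
move=> S x rS KS Sx nKx y.
pose P q := exists2 z, z \in S & pi z = q.
have sP : subspace P.
  split; first by exists 0; rewrite ?rpred0 ?linear0.
  by move=> c _ _ [z1 S1 <-] [z2 S2 <-]; exists (c *: z1 + z2); rewrite ?linearP ?rpredD ?rpredZ.
have rP : @subrep k 2 (quot_ker V) (to_submod sP).
  move=> h haut _ /to_submodP[z Sz <-]; apply/to_submodP.
  have [g gaut gE] := quot_aut_lift cV haut.
  by exists (g z); [apply: rS | rewrite gE].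
have [z0|all] := irr _ rP.
  by case/negP: nKx; apply/quot_pi_eq0/z0/to_submodP; exists x.
have /to_submodP[z Sz zy] := all (pi y).
rewrite -(subrK z y) rpredD // KS //; apply/quot_pi_eq0.
by rewrite linearB -/pi zy subrr.
Qed.

End RadicalType.

(** * Types IIa, IIb and IIc have length two *)
Section SelfOrthogonalTypes.
Variables (k : closedFieldType) (k2 : 2%:R != 0 :> k).
Implicit Types (V : biquadratic k) (p q : point k).

Lemma universal_outside_ker V p : universal V -> exists x, x \notin ker_at V p.
Proof.
move=> /(universal_full k2) fV.
have [x _ xx] := fV (pt1 p) (pt0 p) (etrans (orbC _ _) (pt_neq0 p)) [::].
exists x; apply: contraNN xx => /ker_atP xK.
by rewrite -[X in X == _]/(omega_at V p x x) xK.
Qed.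

Section TypeIIa.
Variables (V : biquadratic k) (p q : point k) (npq : ~ same_point p q).
Local Notation a := (omega_at V p).
Local Notation b := (omega_at V q).
Local Notation W := (ker_at V p).
Variable t : {linear V -> V}.
Hypotheses (bt : forall x y, b (t x) y = a x y) (tW : forall x, t x \in W).
Hypotheses (t0 : forall x, x \in W -> t x = 0).

Let at0 x y : a (t x) y = 0. Proof. by have /ker_atP := tW x. Qed.
Let at0r x y : a x (t y) = 0. Proof. by rewrite formC. Qed.
Let btr x y : b x (t y) = a x y. Proof. by rewrite formC bt formC. Qed.

(** With T acting as t, V is a module over the dual numbers R = k[T]/(T^2), and
    a + T b is an R-bilinear form B on it. The reflection
    x - 2 B(x,v') B(v',v')^-1 v' is R-linear and preserves B, that is, a and b.
    Changing v to v' = v - c t(v) makes b(v',v') vanish, so that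
    B(v',v') = a(v,v) is a scalar. *)
Lemma dual_number_reflection v : a v v != 0 -> exists v', exists2 g : {linear V -> V},
  [/\ is_aut g, a v' v' = a v v, v - v' \in W & t v' = t v] &
  forall x, x - g x = (2%:R / a v v) *: (a x v *: v' + b x v' *: t v).
Proof.
move=> av; pose v' := v - (b v v / (2%:R * a v v)) *: t v.
have tv' : t v' = t v by rewrite linearB linearZ /= (t0 (tW v)) scaler0 subr0.
have av' x : a x v' = a x v by rewrite formDr formNr formZr at0r mulr0 subr0.
have bv' : b v' v' = 0.
  by rewrite /v' !formE !btr !bt ?at0r ?at0; field; rewrite av k2.
have bvtv : b v' (t v) = a v v by rewrite btr formC av'.
have vv' : v - v' \in W by rewrite /v' opprB addrC subrK rpredZ.
move: v' tv' av' bv' bvtv vv' => v' tv' av' bv' bvtv vv'.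
pose f x := x - (2%:R / a v v) *: (a x v *: v' + b x v' *: t v).
have fL : linear f.
  move=> c x y; rewrite /f.
  have -> : a (c *: x + y) v *: v' + b (c *: x + y) v' *: t v =
      c *: (a x v *: v' + b x v' *: t v) + (a y v *: v' + b y v' *: t v).
    by rewrite !formDl !formZl ![(c * _ + _) *: _]scalerDl [in RHS]scalerDr !scalerA addrACA.
  rewrite [_ *: (_ + (a y v *: _ + _))]scalerDr scalerA [_ * c]mulrC -[(c * _) *: _]scalerA.
  by rewrite opprD addrACA scalerBr.
have af x : a (f x) v = - a x v.
  by rewrite /f !formE at0 (formC a v' v) av'; field.
have bf x : b (f x) v' = - b x v'.
  by rewrite /f !formE bv' bt av'; field.
have fK : involutive f.
  move=> x; rewrite {1}/f af bf !scaleNr -opprD scalerN opprK /f.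
  by rewrite subrK.
exists v', (lin_of fL); last by move=> x; rewrite -[lin_of fL x]/(f x) subKr.
split=> //; last by rewrite av' formC av'.
apply: (aut_of_at npq); first by exists f.
  move=> x y; rewrite -[LHS]/(a (f x) (f y)) /f !formE !at0 !at0r !av'.
  by rewrite (formC a v' v) (formC a v' y) !av'; field.
move=> x y; rewrite -[LHS]/(b (f x) (f y)) /f !formE !btr !bt bv'.
rewrite (formC a v' v) !av' at0 (formC b v' y) (formC a v y).
by field.
Qed.

End TypeIIa.

(** The reflections move x by a combination of v' and t v: for x outside W this
    is v' modulo W, and for x = t z in W it is a multiple of t v. In both cases
    the vectors v obtained are generic, hence span. *)
Lemma type_IIa_length2 V : type_IIa V -> universal V /\ has_length V 2.
Proof.
move=> [uV [p [[w Ww w0] _ /= hT]]]; split=> //.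
have [q npq] := other_point p; have [T [T' TK T'K] TE] := hT q npq.
have tL : linear (fun x : V => subsp_val (T (quot_pi (ker_at V p) x))).
  by move=> c x y; rewrite !linearP.
pose t := lin_of tL.
have bt x y : omega_at V q (t x) y = omega_at V p x y by apply: TE.
have tW x : t x \in ker_at V p by exact: (valP (T _)).
have t0 x : x \in ker_at V p <-> t x = 0.
  split=> [/quot_pi_eq0 x0|tx].
    by rewrite -[t x]/(subsp_val (T (quot_pi (ker_at V p) x))) x0 linear0.
  apply/quot_pi_eq0/(can_inj TK); rewrite linear0; exact: val_inj.
have tsurj x : x \in ker_at V p -> exists y, t y = x.
  move=> Wx; have [y yE] := quot_pi_surj (T' (Subsp Wx)).
  by exists y; rewrite -[t y]/(subsp_val (T (quot_pi (ker_at V p) y))) yE T'K.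
have good z : z \notin ker_at V p -> exists v, omega_at V p z v != 0 /\ omega_at V p v v != 0.
  move=> nWz; have [y zy] : exists y, omega_at V p z y != 0.
    apply: contrapT => none; case/negP: nWz; apply/ker_atP => y.
    by apply: contrapT => /eqP nz; apply: none; exists y.
  have yz : omega_at V p y z != 0 by rewrite formC.
  have [c [_ h1 h2]] := anisotropic_perturbation k2 zy (or_intror yz).
  by exists (y + c *: z).
have refl := dual_number_reflection npq bt tW (fun x => proj1 (t0 x)).
have c0 v : omega_at V p v v != 0 -> 2%:R / omega_at V p v v != 0.
  by move=> vv; rewrite mulf_neq0 ?invr_eq0.
apply: (length2_intro (@subrep_ker_at _ V p)).
- by exists w.
- exact: universal_outside_ker.
- move=> S rS SW [x Sx x0] u /tsurj[y <-]; have [z zx] := tsurj x (SW x Sx).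
  have nWz : z \notin ker_at V p by apply: contraNN x0 => /t0; rewrite zx => ->.
  have goodS v : omega_at V p z v != 0 -> omega_at V p v v != 0 -> t v \in S.
    move=> zv vv; have [v' [g [gaut _ vv' _] gE]] := refl v vv.
    have := memB Sx (rS _ gaut _ Sx); rewrite gE (memZ _ _ (c0 v vv)).
    have /ker_atP -> := SW x Sx; rewrite scale0r add0r -zx bt memZ //.
    rewrite -(subrK v v') formDr -opprB formNr formC.
    by have /ker_atP -> := vv'; rewrite oppr0 add0r.
  have [v [zv vv]] := good z nWz.
  have [c [cn0 h1 h2]] := anisotropic_perturbation k2 (u := y) zv (or_introl vv).
  by rewrite -(memZ _ _ cn0) -(memDr _ (goodS v zv vv)) -linearZ -linearD; apply: goodS.
move=> S x rS WS Sx nWx y.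
have goodS v : omega_at V p x v != 0 -> omega_at V p v v != 0 -> v \in S.
  move=> xv vv; have [v' [g [gaut _ vv' _] gE]] := refl v vv.
  have := memB Sx (rS _ gaut _ Sx); rewrite gE (memZ _ _ (c0 v vv)) addrC memDr.
    by rewrite (memZ _ _ xv) => Sv'; rewrite -(subrK v' v) rpredD // WS.
  by rewrite rpredZ // WS.
have [v [xv vv]] := good x nWx.
have [c [cn0 h1 h2]] := anisotropic_perturbation k2 (u := y) xv (or_introl vv).
by rewrite -(memZ _ _ cn0) -(memDr _ (goodS v xv vv)); apply: goodS.
Qed.

(** Restricting a relation a_x + b_y = 0 to W gives y = 0, so back-and-forth
    applies outside W, while reflections take care of W, on which b is
    nondegenerate. *)
Lemma type_IIb_length2 V : countably_spanned V -> type_IIb V -> universal V /\ has_length V 2.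
Proof.
move=> cV [uV [p [[w Ww w0] perp0]]]; split=> //; have [q npq] := other_point p.
have nd x : (forall w, w \in ker_at V p -> omega_at V q x w = 0) -> x = 0.
  move=> xW; apply: perp0; apply/(orthP _ _ npq) => y Wy; split; last exact: xW.
  by rewrite formC; have /ker_atP := Wy.
have nWV := universal_outside_ker p uV; have fV := universal_full k2 uV.
apply: (length2_intro (@subrep_ker_at _ V p)) => //; first by exists w.
- move=> S rS SW [x Sx x0].
  by apply: (subrep_reflection k2 npq _ rS Sx (SW x Sx) x0) => y _ /nd.
move=> S x rS _ Sx nWx; apply: (subrep_outside_ker k2 npq cV fV _ _ rS Sx nWx).
  move=> y z rel; apply: nd => u Wu; have := rel u.
  by rewrite formC; have /ker_atP -> := Wu; rewrite add0r.
by apply: Or32 => y yW; apply: nd => u /ker_atP; apply: yW.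
Qed.

(** Restricting a relation a_x + b_y = 0 to W puts y in W. Since the relation is
    proportional, either y = 0 or x is in W too, and then y is in ker(V) = 0.
    So back-and-forth applies both inside and outside W. *)
Lemma type_IIc_length2 V : countably_spanned V -> type_IIc V -> universal V /\ has_length V 2.
Proof.
move=> cV [uV [p [[w Ww w0] perpW dep rad0]]]; split=> //; have [q npq] := other_point p.
have inW x : (forall w, w \in ker_at V p -> omega_at V q x w = 0) -> x \in ker_at V p.
  move=> xW; rewrite -perpW; apply/(orthP _ _ npq) => y Wy; split; last exact: xW.
  by rewrite formC; have /ker_atP := Wy.
have iso x y : x \in ker_at V p -> y \in ker_at V p -> omega_at V q x y = 0.
  by rewrite -{1}perpW => /(orthP _ _ npq) xW /xW[].
have nWV := universal_outside_ker p uV; have fV := universal_full k2 uV.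
have rel0 x y : (forall z, omega_at V p x z + omega_at V q y z = 0) -> y = 0.
  move=> rel; have Wy : y \in ker_at V p.
    apply: inW => u Wu; have := rel u.
    by rewrite formC; have /ker_atP -> := Wu; rewrite add0r.
  have [z|c [d [cd E]]] := dep (pt1 p *: x + pt1 q *: y) (pt0 p *: x + pt0 q *: y).
    by rewrite -[RHS](rel z) !omega_atE !formE; ring.
  pose m := c * pt1 p + d * pt0 p; pose n := c * pt1 q + d * pt0 q.
  have mn : m *: x + n *: y = 0.
    by rewrite -[RHS]E !scalerDr !scalerA addrACA -!scalerDl.
  have [m0|m0] := eqVneq m 0.
    have n0 : n != 0.
      apply: contraTneq cd => n0; rewrite -negb_and negbK.
      by have [-> ->] := point_rows_free npq m0 n0; rewrite eqxx.
    by move/eqP: mn; rewrite m0 scale0r add0r scaler_eq0 (negPf n0) => /eqP.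
  have Wx : x \in ker_at V p.
    rewrite -(memZ _ _ m0); have -> : m *: x = - (n *: y) by apply/eqP; rewrite -addr_eq0 mn.
    by rewrite memN rpredZ.
  apply: rad0; apply/(mq_kerP _ npq); split=> //; apply/ker_atP => z.
  by have := rel z; have /ker_atP -> := Wx; rewrite add0r.
have perp3 : (forall w w', (forall z, omega_at V p w z = 0) ->
      (forall z, omega_at V p w' z = 0) -> omega_at V q w w' = 0) /\
    (forall x, (forall w, (forall z, omega_at V p w z = 0) -> omega_at V q x w = 0) ->
       forall z, omega_at V p x z = 0).
  split=> [x y /ker_atP Wx /ker_atP Wy|x xW]; first exact: iso.
  by apply/ker_atP; apply: inW => u /ker_atP; apply: xW.
apply: (length2_intro (@subrep_ker_at _ V p)) => //; first by exists w.
- move=> S rS SW [x Sx x0].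
  exact: (subrep_inside_ker k2 npq cV fV rel0 (Or33 _ _ perp3) iso rS Sx (SW x Sx) x0).
move=> S x rS _ Sx nWx.
exact: (subrep_outside_ker k2 npq cV fV rel0 (Or33 _ _ perp3) rS Sx nWx).
Qed.

End SelfOrthogonalTypes.

(** * Type III and its four forms *)
Section TypeIII.
Variables (k : closedFieldType) (k2 : 2%:R != 0 :> k).
Variables (V : biquadratic k) (U U' : submodClosed V) (T : {linear subsp U -> subsp U'}).
Hypotheses (dsum : direct_sum U U') (Tbij : bijective T).
Hypothesis rel : forall x y : V, (forall z, omega V x z = omega' V y z) <->
  exists u : subsp U, x = subsp_val u /\ y = subsp_val (T u).

Definition quadruple : multiquadratic k 4 :=
  MultiQuadratic (fun i : 'I_4 =>
    tnth [tuple pullback_form (@subsp_val k V U) (omega V);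
                pullback_form (@subsp_val k V U) (omega' V);
                pullback_form T (pullback_form (@subsp_val k V U') (omega V));
                pullback_form T (pullback_form (@subsp_val k V U') (omega' V))] i).

Local Notation iU := (@subsp_val k V U).
Local Notation iU' := (@subsp_val k V U').

Lemma quadruple_embeddingP (h : {linear quadruple -> quadruple}) :
  is_embedding h <-> injective h /\ forall u w : subsp U,
    [/\ omega V (iU (h u)) (iU (h w)) = omega V (iU u) (iU w),
        omega' V (iU (h u)) (iU (h w)) = omega' V (iU u) (iU w),
        omega V (iU' (T (h u))) (iU' (T (h w))) = omega V (iU' (T u)) (iU' (T w)) &
        omega' V (iU' (T (h u))) (iU' (T (h w))) = omega' V (iU' (T u)) (iU' (T w))].
Proof.
split=> -[hinj hE]; split=> //.
  move=> u w; split; [exact: (hE (@Ordinal 4 0 isT)) | exact: (hE (@Ordinal 4 1 isT)) |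
     exact: (hE (@Ordinal 4 2 isT)) | exact: (hE (@Ordinal 4 3 isT))].
case=> -[|[|[|[|//]]]] lt u w; have [h0 h1 h2 h3] := hE u w;
  [exact: h0 | exact: h1 | exact: h2 | exact: h3].
Qed.

Let relT (u : subsp U) z : omega V (iU u) z = omega' V (iU' (T u)) z.
Proof. by apply: (proj2 (rel _ _)); exists u. Qed.

Let omega'_inj x : (forall z, omega' V x z = 0) -> x = 0.
Proof.
move=> x0; have [z|u [u0 ->]] := proj1 (rel 0 x); first by rewrite form0l x0.
by have -> : u = 0 by [apply: val_inj]; rewrite linear0.
Qed.

Let valU (u : subsp U) : iU u \in U. Proof. exact: valP u. Qed.
Let valU' (u : subsp U') : iU' u \in U'. Proof. exact: valP u. Qed.

Let Tinj (u : subsp U) : T u = 0 -> u = 0.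
Proof. by move=> E; apply: (bij_inj Tbij); rewrite E linear0. Qed.

(** If c omega_x + d omega'_x = 0, then c x is in U and d x in U', which meet in
    0. *)
Lemma pencil_nondegenerate c d x : (c != 0) || (d != 0) ->
  (forall z, c * omega V x z + d * omega' V x z = 0) -> x = 0.
Proof.
move=> cd x0; have [z|u [ux uy]] := proj1 (rel (c *: x) (- d *: x)).
  by apply/eqP; rewrite !formZl mulNr -addr_eq0 x0.
have [c0|c0] := eqVneq c 0.
  move: ux; rewrite c0 scale0r => /esym u0; have {}u0 : u = 0 by apply: val_inj.
  move: uy cd; rewrite u0 linear0 c0 eqxx /= => /eqP.
  by rewrite scaler_eq0 oppr_eq0 => /orP[->//|/eqP].
have Ux : x \in U by rewrite -(memZ _ _ c0) ux.
have [d0|d0] := eqVneq d 0.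
  have {}uy : u = 0 by apply: Tinj; apply: val_inj => /=; rewrite -uy d0 oppr0 scale0r.
  by move/eqP: ux; rewrite uy scaler_eq0 (negPf c0) => /eqP.
apply: (proj2 dsum) => //.
have d0' : - d != 0 by rewrite oppr_eq0.
by rewrite -(memZ _ _ d0') uy.
Qed.

(** In finite dimension omega' is nondegenerate, so every omega_x is some
    omega'_y, which puts all of V in U and leaves nothing for U'. *)
Lemma type_III_infinite : (exists u : subsp U, u != 0) ->
  forall s : seq V, exists x, ~ in_span s x.
Proof.
move=> [u u0] s; apply: contrapT => gen.
have {}gen x : in_span s x by apply: contrapT => nx; apply: gen; exists x.
have all x : x \in U.
  pose B (y u : V) := omega' V y u.
  have Bl v : linear_for *%R (B^~ v) by move=> c y z; rewrite /B /= !formE.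
  have Br y : linear_for *%R (B y) by move=> c v w; rewrite /B /= !formE.
  have lL : linear_for *%R (omega V x) by move=> c y z; rewrite !formE.
  have sT : subspace (fun _ : V => True) by [].
  have [y _ y0|w _ wE] := linear_system Bl Br sT (s := s) lL.
    by rewrite (omega'_inj (fun z => y0 z I)) form0r.
  have [z|v [-> _]] := proj1 (rel x w); last exact: valU.
  by rewrite -wE //; apply: formC.
case/eqP: u0; apply: Tinj; apply: val_inj => /=; apply: (proj2 dsum) => //.
Qed.

(** The two forms on V = U + T(U) are determined by the four forms on U, because
    omega(u, T w) = omega'(T u, T w) and omega'(T u, w) = omega(u, w). *)
Lemma quadruple_aut_lift (h : {linear quadruple -> quadruple}) : is_aut h ->
  exists2 g : {linear V -> V}, is_aut g &
    forall u : subsp U, g (iU u) = iU (h u) /\ g (iU' (T u)) = iU' (T (h u)).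
Proof.
move=> haut; have [T' TK T'K] := Tbij.
have T'L : linear T' by move=> c x y; apply: (bij_inj Tbij); rewrite linearP !T'K.
have [f fE] := projection dsum; have [f' f'E] := projection (direct_sum_sym dsum).
have fU (u : subsp U) : f (iU u) = u.
  apply/esym/val_inj/eqP; rewrite -subr_eq0; apply/eqP; apply: (proj2 dsum) => //=.
  by apply: memB.
have f'U (u : subsp U') : f' (iU' u) = u.
  apply/esym/val_inj/eqP; rewrite -subr_eq0; apply/eqP; apply: (proj2 dsum) => //=.
  by apply: memB.
have f0 (w : subsp U') : f (iU' w) = 0.
  apply: val_inj => /=; apply: (proj2 dsum) => //.
  by rewrite -memN -(memDr _ (valU' w)).
have f'0 (w : subsp U) : f' (iU w) = 0.
  apply: val_inj => /=; apply: (proj2 dsum) => //.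
  by rewrite -memN -(memDr _ (valU w)).
have dec x : exists u w : subsp U, x = iU u + iU' (T w).
  have [y [z [Uy Uz ->]]] := proj1 dsum x.
  by exists (Subsp Uy), (T' (Subsp Uz)); rewrite T'K.
have mk (h' : {linear quadruple -> quadruple}) : exists g : {linear V -> V},
    forall u w : subsp U, g (iU u + iU' (T w)) = iU (h' u) + iU' (T (h' w)).
  have gL : linear (fun v => iU (h' (f v)) + iU' (T (h' (lin_of T'L (f' v))))).
    move=> c x y; rewrite !linearP /=.
    by rewrite [LHS]addrACA -scalerDr.
  exists (lin_of gL) => u w; rewrite -[LHS]/(iU (h' (f _)) + iU' (T (h' (T' (f' _))))).
  by rewrite (linearD f) fU f0 addr0 (linearD f') f'U f'0 add0r TK.
have [h' [h'aut hK h'K]] := aut_inv haut.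
have [g gE] := mk h; have [g' g'E] := mk h'.
have gK : cancel g g' by move=> x; have [u [w ->]] := dec x; rewrite gE g'E !hK.
have g'K : cancel g' g by move=> x; have [u [w ->]] := dec x; rewrite g'E gE !h'K.
exists g; last first.
  move=> u; have := gE u 0; have := gE 0 u.
  have -> : h 0 = 0 by exact: linear0.
  by rewrite !linear0 !addr0 !add0r.
split; last by exists g'.
have [_ hE] := proj1 (quadruple_embeddingP h) haut.1.
apply: (embedding_of_forms k2); first exact: can_inj gK.
- move=> x; have [u [w ->]] := dec x; rewrite gE !formE.
  rewrite !(formC (omega V) (iU' (T _)) (iU _)) !relT.
  have [e1 _ _ _] := hE u u; have [_ _ e3 _] := hE w w; have [_ _ _ e4] := hE u w.
  by rewrite -!relT e1 e3 !relT e4.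
move=> x; have [u [w ->]] := dec x; rewrite gE !formE.
rewrite !(formC (omega' V) (iU _) (iU' (T _))) -!relT.
have [_ e2 _ _] := hE u u; have [_ _ _ e4] := hE w w; have [e1 _ _ _] := hE w u.
by rewrite -!relT in e4; rewrite e1 e2 e4.
Qed.

Lemma type_III_equivariant (g : {linear V -> V}) (u : subsp U) : is_aut g ->
  exists w : subsp U, g (iU u) = iU w /\ g (iU' (T u)) = iU' (T w).
Proof.
move=> gaut; apply: (proj1 (rel _ _)) => z; have [h [_ _ hK]] := aut_inv gaut.
by rewrite -(hK z) /omega /omega' !gaut.1.2; apply: relT.
Qed.

Lemma type_III_subrep : subrep U.
Proof.
move=> g gaut x Ux; have [w [-> _]] := type_III_equivariant (Subsp Ux) gaut.
exact: valU.
Qed.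

(** As T commutes with every automorphism of V, the subspaces U and U' are
    isomorphic representations, irreducible because every automorphism of the
    four forms lifts. *)
Lemma type_III_length2 : irreducible quadruple -> universal V /\ has_length V 2.
Proof.
move=> [[u u0] irr]; have inf := type_III_infinite (ex_intro _ u u0).
split.
  apply: (full_universal k2) => c d cd; apply: (full_of_infinite_rank k2) => t.
  have [x xt] := inf t; exists x => e te; apply: contrapT => none; apply: xt.
  suff /eqP : x - e = 0 by rewrite subr_eq0 => /eqP ->.
  apply: (pencil_nondegenerate cd) => z; apply: contrapT => /eqP nz; apply: none.
  by exists z.
have [T' TK T'K] := Tbij.
apply: (length2_intro type_III_subrep).
- by exists (iU u) => //; apply: contraNneq u0 => E; apply/eqP/val_inj.
- exists (iU' (T u)); apply: contraNN u0 => UTu; apply/eqP; apply: Tinj.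
  by apply: val_inj; apply: (proj2 dsum); [exact: UTu | exact: valU'].

- move=> S rS SU [x Sx x0] y Uy.
  pose P (v : quadruple) := iU v \in S.
  have sP : subspace P.
    split; first exact: rpred0.
    by move=> c v v' Pv Pv'; rewrite /P linearP rpredD ?rpredZ.
  have rP : subrep (to_submod sP).
    move=> h haut v /to_submodP Pv; apply/to_submodP.
    have [g gaut gE] := quadruple_aut_lift haut.
    by have [gv _] := gE v; rewrite /P -gv; apply: rS.
  have [z0|all] := irr _ rP; last by have /to_submodP := all (Subsp Uy).
  have Ux := SU x Sx; case/eqP: x0; have /(congr1 val) : Subsp Ux = 0 :> subsp U.
    by apply: z0; apply/to_submodP.
  by [].
move=> S x rS US Sx nUx y.
pose P (v : quadruple) := iU' (T v) \in S.
have sP : subspace P.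
  split; first by rewrite /P !linear0 rpred0.
  by move=> c v v' Pv Pv'; rewrite /P !linearP rpredD ?rpredZ.
have rP : subrep (to_submod sP).
  move=> h haut v /to_submodP Pv; apply/to_submodP.
  have [g gaut gE] := quadruple_aut_lift haut.
  by have [_ gv] := gE v; rewrite /P -gv; apply: rS.
have [x1 [x2 [Ux1 Ux2 xE]]] := proj1 dsum x.
have [z0|all] := irr _ rP.
  have T0 : T' (Subsp Ux2) = 0.
    apply: z0; apply/to_submodP; rewrite /P T'K /= -(memDr x2 (US _ Ux1)) -xE //.
  have /(congr1 val) /= x20 : Subsp Ux2 = 0 :> subsp U' by rewrite -[LHS]T'K T0 linear0.
  by move: nUx; rewrite xE x20 addr0 Ux1.
have [y1 [y2 [/US Sy1 Uy2 ->]]] := proj1 dsum y; rewrite rpredD //.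
by have /to_submodP := all (T' (Subsp Uy2)); rewrite /P T'K.
Qed.

Lemma quadruple_irreducible : has_length V 2 -> irreducible quadruple.
Proof.
move=> len; have [T' TK T'K] := Tbij.
have [x0 [_ [x _ xn0] _]] := length2_proper len.
have [u u0] : exists u : subsp U, u != 0.
  apply: contrapT => none; case/eqP: xn0.
  have allU (u : subsp U) : u = 0 by apply: contrapT => /eqP nz; apply: none; exists u.
  have [y [z [Uy Uz ->]]] := proj1 dsum x.
  have /(congr1 val)/= -> := allU (Subsp Uy); rewrite add0r.
  have /(congr1 val)/= -> // : Subsp Uz = 0 :> subsp U'.
  by rewrite -[LHS]T'K (allU (T' _)) linear0.
have nU : exists x, x \notin U.
  exists (iU' (T u)); apply: contraNN u0 => UTu; apply/eqP; apply: Tinj.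
  by apply: val_inj; apply: (proj2 dsum); [exact: UTu | exact: valU'].
split; first by exists u.
move=> S rS; apply: (length2_stable type_III_subrep len nU) => g h gaut hbij hE v Sv.
apply: (rS h) => //; split=> //; apply/quadruple_embeddingP; split; first exact: bij_inj.
have hT w : iU' (T (h w)) = g (iU' (T w)).
  have [w' [gw gTw]] := type_III_equivariant w gaut.
  by rewrite gTw; congr (iU' (T _)); apply: val_inj; rewrite /= -[LHS]/(iU _) hE gw.
move=> a b; rewrite !hE !hT; split; exact: gaut.1.2.
Qed.

End TypeIII.

(** * Spaces of length two with a degenerate form in the pencil *)
Section LengthTwo.
Variables (k : closedFieldType) (k_uncountable : ~ countable [set: k]).
Variable k2 : 2%:R != 0 :> k.
Variable V : biquadratic k.
Hypotheses (cV : countably_spanned V) (uV : universal V) (len : has_length V 2).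
Implicit Types p q : point k.

Lemma subspace_meet (S S' : submodClosed V) : subspace (fun x => x \in S /\ x \in S').
Proof.
split=> [|c x y [x1 x2] [y1 y2]]; first by split; apply: rpred0.
by split; rewrite rpredD ?rpredZ.
Qed.

Lemma subrep_meet (S S' : submodClosed V) : subrep S -> subrep S' ->
  subrep (to_submod (subspace_meet S S')).
Proof.
move=> rS rS' g gaut x /to_submodP[Sx S'x]; apply/to_submodP.
by split; [apply: rS | apply: rS'].
Qed.

Lemma subspace_join (S S' : submodClosed V) :
  subspace (fun x => exists y z, [/\ y \in S, z \in S' & x = y + z]).
Proof.
split=> [|c _ _ [y1 [z1 [Sy1 Sz1 ->]]] [y2 [z2 [Sy2 Sz2 ->]]]].
  by exists 0, 0; rewrite !rpred0 addr0.
exists (c *: y1 + y2), (c *: z1 + z2); split; try by rewrite rpredD ?rpredZ.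
by rewrite scalerDr addrACA.
Qed.

Lemma subrep_join (S S' : submodClosed V) : subrep S -> subrep S' ->
  subrep (to_submod (subspace_join S S')).
Proof.
move=> rS rS' g gaut _ /to_submodP[y [z [Sy Sz ->]]]; apply/to_submodP.
by exists (g y), (g z); split; [apply: rS | apply: rS' | rewrite linearD].
Qed.

(** Both are simple as representations, with simple quotients. *)
Lemma length2_dichotomy (S S' : submodClosed V) :
  subrep S -> nonzero_subspace S -> (exists x, x \notin S) ->
  subrep S' -> nonzero_subspace S' -> (exists x, x \notin S') ->
  S' =i S \/ direct_sum S S'.
Proof.
move=> rS nzS pS rS' nzS' pS'.
have [|z0|SI] := length2_below len rS pS (subrep_meet rS rS').
- by move=> x /to_submodP[].
- have [|J|all] := length2_above len rS nzS (subrep_join rS rS').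
  - by move=> x Sx; apply/to_submodP; exists x, 0; rewrite rpred0 addr0.
  - have [x S'x /eqP[]] := nzS'; apply: z0; apply/to_submodP; split=> //.
    by apply: J; apply/to_submodP; exists 0, x; rewrite rpred0 add0r.
  right; split=> [x|x Sx S'x]; first by have /to_submodP := all x.
  by apply: z0; apply/to_submodP.
have SS' : {subset S <= S'} by move=> x /SI/to_submodP[].
left; have [S'S|all] := length2_above len rS nzS rS' SS'.
  by move=> x; apply/idP/idP => [/S'S|/SS'].
by have [x] := pS'; rewrite all.
Qed.

Lemma quot_aut_descend (g : {linear V -> V}) : is_aut g ->
  exists2 h : {linear quot_ker V -> quot_ker V}, is_aut h &
    forall x, h (quot_pi (mq_ker V) x) = quot_pi (mq_ker V) (g x).
Proof.
pose pi := quot_pi (mq_ker V).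
have mk (f : {linear V -> V}) : is_aut f ->
    exists h : {linear quot_ker V -> quot_ker V}, forall x, h (pi x) = pi (f x).
  move=> faut; pose G (uv : quot_ker V * quot_ker V) := exists2 x, pi x = uv.1 & pi (f x) = uv.2.
  have [||u [x /= /quot_pi_eq0 Kx <-]|h hG _] := @linear_graph _ (quot_ker V) (quot_ker V) G.
  - split; first by exists 0; rewrite ?linear0.
    by move=> c u v [x x1 x2] [y y1 y2]; exists (c *: x + y); rewrite !linearP ?x1 ?y1 ?x2 ?y2.
  - by move=> u; have [x xu] := quot_pi_surj u; exists (pi (f x)), x.
  - by apply/quot_pi_eq0; apply: (subrep_mq_ker faut).
  exists h => x; have [y yx yhx] := hG (pi x); rewrite -[LHS]yhx.
  apply/eqP; rewrite -subr_eq0 -linearB -linearB; apply/eqP/quot_pi_eq0.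
  apply: (subrep_mq_ker faut); apply/quot_pi_eq0; by rewrite linearB -/pi yx subrr.
move=> gaut; have [g' [g'aut gK g'K]] := aut_inv gaut.
have [h hE] := mk g gaut; have [h' h'E] := mk g' g'aut.
have hK : cancel h h' by move=> u; have [x <-] := quot_pi_surj u; rewrite -/pi hE h'E gK.
have h'K : cancel h' h by move=> u; have [x <-] := quot_pi_surj u; rewrite -/pi h'E hE g'K.
exists h => //; split; last by exists h'.
split=> [|i u v]; first exact: can_inj hK.
have [x <-] := quot_pi_surj u; have [y <-] := quot_pi_surj v.
rewrite -/pi !hE; rewrite [LHS]quot_form_pi [RHS]quot_form_pi; exact: gaut.1.2.
Qed.

(** V / ker(V) is irreducible, and no omega(p) vanishes on it because V is
    universal, so it has no relations. *)
Lemma length2_type_Ic : nonzero_subspace (mq_ker V) -> type_Ic V.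
Proof.
move=> nzK; split=> //; pose pi := quot_pi (mq_ker V).
have cQ : countably_spanned (quot_ker V).
  exact: countably_spanned_image (@quot_pi_surj _ _ _) cV.
have out p : exists x, x \notin ker_at (quot_ker V) p.
  have [x nx] := universal_outside_ker k2 p uV; exists (pi x).
  apply: contraNN nx => /ker_atP px; apply/ker_atP => y; have := px (pi y).
  have E i : mq_form (quot_ker V) i (pi x) (pi y) = mq_form V i x y := quot_form_pi i x y.
  by rewrite !omega_atE /omega /omega' !E.
have nz : exists u : quot_ker V, u != 0.
  have h : ((1 : k) != 0) || ((0 : k) != 0) by rewrite oner_eq0.
  have [u nu] := out (Point h); exists u; apply: contraNneq nu => ->; exact: rpred0.
have irr : irreducible (quot_ker V).
  split=> // S rS; pose P x := pi x \in S.
  have sP : subspace P.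
    split; first by rewrite /P linear0 rpred0.
    by move=> c x y Px Py; rewrite /P linearP rpredD ?rpredZ.
  have rP : subrep (to_submod sP).
    move=> g gaut x /to_submodP Px; apply/to_submodP.
    by have [h haut hE] := quot_aut_descend gaut; rewrite /P -hE; apply: rS.
  have [|PK|all] := length2_above len (@subrep_mq_ker _ V) nzK rP.
  - by move=> x /quot_pi_eq0 x0; apply/to_submodP; rewrite /P /pi x0 rpred0.
  - left=> u; have [x <-] := quot_pi_surj u => Sx; apply/quot_pi_eq0; apply: PK.
    exact/to_submodP.
  by right=> u; have [x <-] := quot_pi_surj u; have /to_submodP := all x.
have nr := irreducible_no_relation k_uncountable irr cQ out.
exact: no_relation_universal_homogeneous.
Qed.

(** If W = ker a were spanned by s, a vector x orthogonal to s would have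
    b(x,x) = 0, since the component of x outside W is in ker b. *)
Lemma summand_infinite p q : ~ same_point p q -> direct_sum (ker_at V p) (ker_at V q) ->
  infinite_dim (subsp (ker_at V p)).
Proof.
move=> npq dsum; apply/infinite_dimP => s; apply: contrapT => gen.
have {}gen (w : subsp (ker_at V p)) : in_span s w.
  by apply: contrapT => nw; apply: gen; exists w.
have fpq := proj1 (full_at V npq) (universal_full k2 uV).
pose iota : {linear subsp (ker_at V p) -> V} := @subsp_val k V (ker_at V p).
have [|x xF] := fpq 0 1 _ [seq iota w | w <- s]; first by rewrite oner_eq0 orbT.
rewrite mul0r add0r mul1r => /eqP; apply.
have [y [z [Wy /ker_atP z0 xE]]] := proj1 dsum x.
have [_ yx] := perp_span xF (span_map iota (gen (Subsp Wy))).
by rewrite {1}xE formDl z0 addr0; apply: yx.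
Qed.

(** The complement O of W is irreducible. Either it has no relations and is
    universal homogeneous, or some omega(p') vanishes on it, in which case
    O = ker omega(p'). *)
Lemma length2_split p q : ~ same_point p q -> nonzero_subspace (ker_at V p) ->
  direct_sum (ker_at V p) (orth (ker_at V p)) -> nonzero_subspace (orth (ker_at V p)) ->
  type_Ia V \/ type_Ib V.
Proof.
move=> npq nzW dsum nzO; pose W := ker_at V p; pose O := orth W.
have rO : subrep O := subrep_orth (@subrep_ker_at _ V p).
have pO : exists x, x \notin O.
  have [w Ww w0] := nzW; exists w; apply: contraNN w0 => Ow; apply/eqP.
  exact: (proj2 dsum).
have irr := restrict_irreducible rO len nzO pO.
have Oval (u : subsp O) : subsp_val u \in O by exact: valP u.
have cO : countably_spanned (restrict O).
  have [f fE] := projection (direct_sum_sym dsum).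
  apply: (@countably_spanned_image _ V (subsp O) f _ cV) => u; exists (subsp_val u).
  apply/esym/val_inj/eqP; rewrite -subr_eq0; apply/eqP; apply: (proj2 dsum) => //=.
  by apply: memB.
have [out|] := pselect (forall p', exists x, x \notin ker_at (restrict O) p').
  right; exists p; split=> //; last exact: direct_sum_sym.
  have nr := irreducible_no_relation k_uncountable irr cO out.
  by apply: no_relation_universal_homogeneous => //; case: irr.
move=> /existsNP[p' nout]; left.
have O0 u v : u \in O -> v \in O -> omega_at V p' u v = 0.
  move=> Ou Ov; have /ker_atP/(_ (Subsp Ov)) : Subsp Ou \in ker_at (restrict O) p'.
    by apply: contrapT => /negP nx; apply: nout; exists (Subsp Ou).
  by [].
have npp' : ~ same_point p p'.
  move=> [c c0 [e0 e1]]; have [x] := universal_outside_ker k2 p uV => /negP; apply.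
  have [w [o [Ww Oo ->]]] := proj1 dsum x; rewrite memDr //; apply/ker_atP => z.
  have [w' [o' [Ww' Oo' ->]]] := proj1 dsum z; rewrite formDr (formC _ _ w').
  have /ker_atP -> := Ww'; rewrite add0r; apply: (mulfI c0); rewrite mulr0 -(O0 _ _ Oo Oo').
  by rewrite !omega_atE e0 e1; ring.
have OK o : o \in O -> o \in ker_at V p'.
  move=> Oo; apply/ker_atP => z; have [w [o' [Ww Oo' ->]]] := proj1 dsum z.
  rewrite formDr (O0 _ _ Oo Oo') addr0.
  by have /(orthP _ _ npp')/(_ w Ww)[] := Oo.
have dsum' : direct_sum (ker_at V p) (ker_at V p').
  split=> [v|x Wx Kx].
    by have [w [o [Ww /OK Ko ->]]] := proj1 dsum v; exists w, o.
  apply: (proj2 dsum) => //; apply/(orthP _ _ npp') => y _.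
  by have /ker_atP -> := Wx; have /ker_atP -> := Kx.
exists p, p'; split=> //; first exact: (summand_infinite npp' dsum').
apply: summand_infinite (direct_sum_sym dsum'); by move=> /same_point_sym.
Qed.

(** For q' other than p let D be the space of all x for which a_x = omega(q')_y
    has a solution y. It contains W, so it is W or V. If it is V for every q',
    then y, unique and in W, defines the isomorphism of type IIa, which is onto
    because its image is a nonzero subrepresentation of W. If it is W for some
    q', then every relation comes from a vector of W. *)
Lemma length2_self_orthogonal p : nonzero_subspace (ker_at V p) ->
  (exists x, x \notin orth (ker_at V p)) ->
  orth (ker_at V p) =i ker_at V p -> type_IIa V \/ type_IIc V.
Proof.
move=> nzW pO OW; pose W := ker_at V p.
have rW : subrep W := @subrep_ker_at _ V p.
have pW : exists x, x \notin W by exact: universal_outside_ker.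
have [q npq] := other_point p.
have rad0 : zero_subspace (mq_ker V).
  have [|//|WK] := length2_below len rW pW (@subrep_mq_ker _ V).
    by move=> x /(mq_kerP _ npq)[].
  have [x /negP[]] := pO; apply/asboolP => i y /WK yK.
  by rewrite formC mq_ker_form.
have radq q' y : ~ same_point p q' -> y \in W -> (forall z, omega_at V q' y z = 0) -> y = 0.
  by move=> npq' Wy y0; apply: rad0; apply/(mq_kerP _ npq'); split=> //; apply/ker_atP.
have relW q' x y : ~ same_point p q' ->
    (forall z, omega_at V p x z = omega_at V q' y z) -> y \in W.
  move=> npq' rel; rewrite -OW; apply/(orthP _ _ npq') => w Ww; have /ker_atP w0 := Ww.
  by rewrite -rel !(formC _ _ w) w0.
have [h|] := pselect (forall q', ~ same_point p q' ->
    exists2 T : {linear quotsp W -> subsp W}, bijective T & forall x y : V,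
      omega_at V q' (subsp_val (T (quot_pi W x))) y = omega_at V p x y).
  by left; split=> //; exists p.
move=> /existsNP[q' /not_implyP[npq' noT]]; right.
pose D x := exists y, forall z, omega_at V p x z = omega_at V q' y z.
have sD : subspace D.
  split; first by exists 0 => z; rewrite !form0l.
  by move=> c x x' [y yE] [y' y'E]; exists (c *: y + y') => z; rewrite !formDl !formZl yE y'E.
have rD : subrep (to_submod sD).
  move=> g gaut x /to_submodP[y yE]; apply/to_submodP; exists (g y) => z.
  by have [h [_ _ hK]] := aut_inv gaut; rewrite -(hK z) !aut_at.
have [|DW|all] := length2_above len rW nzW rD.
  by move=> x /ker_atP x0; apply/to_submodP; exists 0 => z; rewrite form0l x0.
  split=> //; exists p; split=> // x y rel.
  have d := point_det npq'.
  have rel' z : omega_at V p (pt0 q' *: x - pt1 q' *: y) z =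
                omega_at V q' (pt0 p *: x - pt1 p *: y) z.
    apply/eqP; rewrite -subr_eq0; apply/eqP.
    rewrite (_ : _ - _ =
        (pt1 p * pt0 q' - pt0 p * pt1 q') * (omega V x z + omega' V y z)); last first.
      by rewrite !omega_atE !formDl !formNl !formZl; ring.
    by rewrite rel mulr0.
  have Wy := relW _ _ _ npq' rel'.
  have /DW/ker_atP X0 : pt0 q' *: x - pt1 q' *: y \in to_submod sD.
    by apply/to_submodP; exists (pt0 p *: x - pt1 p *: y).
  exists (pt0 p), (- pt1 p); split; first by rewrite oppr_eq0 pt_neq0.
  by rewrite scaleNr; apply: (radq q') => // z; rewrite -rel'.
case: noT; pose pi := quot_pi W.
pose G (uw : quotsp W * subsp W) :=
  exists2 x, pi x = uw.1 & forall z, omega_at V p x z = omega_at V q' (subsp_val uw.2) z.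
have Wval (u : subsp W) : subsp_val u \in W by exact: valP u.
have GT x w : G (pi x, w) -> forall z, omega_at V q' (subsp_val w) z = omega_at V p x z.
  move=> [y yx yw] z; rewrite -[LHS]yw; apply/eqP; rewrite -subr_eq0 -formNl -formDl; apply/eqP.
  by move: z; apply/ker_atP/quot_pi_eq0; rewrite linearB -/pi yx subrr.
have [||w [x /= /quot_pi_eq0/ker_atP x0 xw]|T TG Tu] := @linear_graph _ (quotsp W) (subsp W) G.
- split; first by exists 0; rewrite ?linear0 // => z; rewrite !form0l.
  move=> c u v [x xu xE] [y yv yE]; exists (c *: x + y); first by rewrite linearP xu yv.
  by move=> z; rewrite -[subsp_val _]/(c *: subsp_val u.2 + subsp_val v.2) !formDl !formZl xE yE.
- move=> u; have [x <-] := quot_pi_surj u; have /to_submodP[y yE] := all x.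
  by exists (Subsp (relW _ _ _ npq' yE)), x.
- by apply: val_inj; apply: (radq q') => [||z]; [ | exact: Wval | rewrite -[LHS]xw x0].
exists T => [|x y]; last exact: GT.
apply: bijective_of_surj; first apply: lin_injective => u.
  have [x <-] := quot_pi_surj u => Tx; apply/quot_pi_eq0/ker_atP => z.
  by rewrite -(GT _ _ (TG (pi x))) Tx form0l.
pose E y := y \in W /\ exists x, forall z, omega_at V p x z = omega_at V q' y z.
have sE : subspace E.
  split; first by split; [exact: rpred0 | exists 0 => z; rewrite !form0l].
  move=> c x x' [Wx [y yE]] [Wx' [y' y'E]]; split; first by rewrite rpredD ?rpredZ.
  by exists (c *: y + y') => z; rewrite !formDl !formZl yE y'E.
have rE : subrep (to_submod sE).
  move=> g gaut x /to_submodP[Wx [y yE]]; apply/to_submodP; split; first exact: rW.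
  exists (g y) => z.
  by have [h [_ _ hK]] := aut_inv gaut; rewrite -(hK z) !aut_at.
have [|z0|WE] := length2_below len rW pW rE.
- by move=> x /to_submodP[].
- have [x nWx] := pW; case/negP: nWx; have /to_submodP[y yE] := all x.
  have y0 : y = 0 by apply: z0; apply/to_submodP; split; [exact: relW yE | exists x].
  by apply/ker_atP => z; rewrite yE y0 form0l.
move=> w; have /to_submodP[_ [x xE]] := WE _ (Wval w).
by exists (pi x); apply/esym/Tu; exists x.
Qed.

End LengthTwo.

(** * Spaces of length two with a nondegenerate pencil *)
Section Nondegenerate.
Variables (k : closedFieldType) (k_uncountable : ~ countable [set: k]).
Variable k2 : 2%:R != 0 :> k.
Variable V : biquadratic k.
Hypotheses (cV : countably_spanned V) (len : has_length V 2).

(** Some S - c is injective but not surjective, so the images of its powers form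
    an infinite strictly descending chain of subrepresentations. *)
Lemma length2_no_shift (S : {linear V -> V}) :
  (forall g u, is_aut g -> S (g u) = g (S u)) ->
  (forall c u, S u - c *: u = 0 -> u = 0) -> False.
Proof.
move=> Seq Sinj; have [_ [_ [v _ v0] _]] := length2_proper len.
have idinj : injective (idfun : {linear V -> V}) by [].
have [c [y none]] := exists_singular_shift k_uncountable idinj cV (ex_intro _ v v0) Sinj.
have fL : linear (fun u => S u - c *: u).
  move=> d u u'; rewrite /= linearP [c *: (_ + _)]scalerDr opprD addrACA scalerBr.
  by rewrite !scalerA mulrC.
(* [f] is S - c, and [y] is not in its image. *)
pose f := lin_of fL; have finj : injective f by apply: lin_injective => u; apply: Sinj.
pose I n x := exists u, iter n f u = x.
have sI n : subspace (I n).
  split; first by exists 0; elim: n => [|n IH] /=; rewrite ?IH ?linear0.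
  by move=> d _ _ [u <-] [u' <-]; exists (d *: u + u'); rewrite iter_linear.
have rI n : subrep (to_submod (sI n)).
  move=> g gaut _ /to_submodP[u <-]; apply/to_submodP; exists (g u).
  elim: n => //= n ->; rewrite -[LHS]/(S (g _) - c *: g _) Seq //.
  by rewrite -[f _]/(S _ - c *: _) [RHS]linearB [in RHS]linearZ.
have pI n : proper_subspace (to_submod (sI n.+1)) (to_submod (sI n)).
  split=> [_ /to_submodP[u <-]|].
    by apply/to_submodP; exists (f u); rewrite -iterSr.
  exists (iter n f y); first by apply/to_submodP; exists y.
  have itinj : injective (iter n f) by elim: (n) => [//|m IH] x x' /= /finj/IH.
  by apply/negP => /to_submodP[u]; rewrite iterSr => /itinj; apply: none.
exact: (length2_no_chain3 len (rI 3%N) (rI 2%N) (rI 1%N) (rI 0%N)).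
Qed.

Hypothesis ker0 : forall p x, x \in ker_at V p -> x = 0.

Let omega_shift (c : k) x : (forall z, omega V x z = c * omega' V x z) -> x = 0.
Proof.
move=> xr; have h : ((- c : k) != 0) || ((1 : k) != 0) by rewrite oner_eq0 orbT.
by apply: (ker0 (p := Point h)); apply/ker_atP => z; rewrite omega_atE /= xr; ring.
Qed.

Let omega'_shift (c : k) x : (forall z, omega' V x z = c * omega V x z) -> x = 0.
Proof.
move=> xr; have h : ((1 : k) != 0) || ((- c : k) != 0) by rewrite oner_eq0.
by apply: (ker0 (p := Point h)); apply/ker_atP => z; rewrite omega_atE /= xr; ring.
Qed.

Let omega_inj x : (forall z, omega V x z = 0) -> x = 0.
Proof. by move=> x0; apply: (@omega_shift 0) => z; rewrite x0 mul0r. Qed.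

Let omega'_inj x : (forall z, omega' V x z = 0) -> x = 0.
Proof. by move=> x0; apply: (@omega'_shift 0) => z; rewrite x0 mul0r. Qed.

Definition omega_related x y := forall z, omega V x z = omega' V y z.

Lemma omega_related_linear c x y x' y' : omega_related x y -> omega_related x' y' ->
  omega_related (c *: x + x') (c *: y + y').
Proof. by move=> xy xy' z; rewrite !formDl !formZl xy xy'. Qed.

Lemma omega_related0 : omega_related 0 0. Proof. by move=> z; rewrite !form0l. Qed.

Lemma omega_related_aut g x y : is_aut g -> omega_related x y -> omega_related (g x) (g y).
Proof.
move=> gaut xy z; have [h [_ _ hK]] := aut_inv gaut.
by rewrite -(hK z) /omega /omega' !gaut.1.2; apply: xy.
Qed.

Lemma omega_related_fun x y y' : omega_related x y -> omega_related x y' -> y = y'.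
Proof.
move=> xy xy'; apply/eqP; rewrite -subr_eq0; apply/eqP; apply: omega'_inj => z.
by rewrite formDl formNl -xy -xy' subrr.
Qed.

Lemma omega_related_inj x x' y : omega_related x y -> omega_related x' y -> x = x'.
Proof.
move=> xy xy'; apply/eqP; rewrite -subr_eq0; apply/eqP; apply: omega_inj => z.
by rewrite formDl formNl xy xy' subrr.
Qed.

Let sD : subspace (fun x => exists y, omega_related x y).
Proof.
split; first by exists 0; apply: omega_related0.
by move=> c x x' [y xy] [y' xy']; exists (c *: y + y'); apply: omega_related_linear.
Qed.

Let sD' : subspace (fun y => exists x, omega_related x y).
Proof.
split; first by exists 0; apply: omega_related0.
by move=> c y y' [x xy] [x' xy']; exists (c *: x + x'); apply: omega_related_linear.
Qed.

Let D := to_submod sD.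
Let D' := to_submod sD'.

Let rD : subrep D.
Proof.
move=> g gaut x /to_submodP[y xy]; apply/to_submodP; exists (g y).
exact: omega_related_aut.
Qed.

Let rD' : subrep D'.
Proof.
move=> g gaut y /to_submodP[x xy]; apply/to_submodP; exists (g x).
exact: omega_related_aut.
Qed.

(** The domain D and the image D' of the partial operator T defined by
    omega_x = omega'_(T x) are proper by [length2_no_shift], applied to T and
    to its inverse. If D = D', then some T - c maps D onto a proper nonzero
    subrepresentation of D, which is impossible. So V is the direct sum of D
    and D'. *)
Lemma length2_nondegenerate : type_III V.
Proof.
have [x0 [y0 [xy0 x0n y0n]]] : exists x y, [/\ omega_related x y, x != 0 & y != 0].
  have nnr : ~ no_relation V.
    move=> nr; have [S [rS [x Sx xn0] [y nSy]]] := length2_proper len.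
    have uh : universal_homogeneous V.
      by apply: (no_relation_universal_homogeneous k2 cV nr); exists x.
    have [_ /(_ S rS)[z0|all]] := universal_homogeneous_irreducible k2 uh.
      by case/eqP: xn0; apply: z0.
    by rewrite all in nSy.
  apply: contrapT => none; apply: nnr => x y rel.
  have xy : omega_related x (- y).
    by move=> z; apply/eqP; rewrite formNl -addr_eq0 rel.
  have [x0|x0] := eqVneq x 0.
    split=> //; apply: omega'_inj => z; have := rel z; by rewrite x0 form0l add0r.
  have [yn0|yn0] := eqVneq (- y) 0; last by case: none; exists x, (- y).
  case/eqP: x0; apply: omega_inj => z; by rewrite xy yn0 form0l.
have nzD : nonzero_subspace D by exists x0 => //; apply/to_submodP; exists y0.
have nzD' : nonzero_subspace D' by exists y0 => //; apply/to_submodP; exists x0.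
have pD : exists x, x \notin D.
  apply: contrapT => all; have [||y /= y0' |T TG Tu] :=
      @linear_graph _ V V (fun v => omega_related v.1 v.2).
  - split; first exact: omega_related0.
    by move=> c v v'; apply: omega_related_linear.
  - move=> x; suff /to_submodP : x \in D by [].
    by apply: contrapT => /negP nx; apply: all; exists x.
  - exact: omega_related_fun y0' omega_related0.
  apply: (length2_no_shift (S := T)) => [g u gaut|c u].
    by apply/esym/Tu; apply: omega_related_aut => //; apply: TG.
  move=> /eqP; rewrite subr_eq0 => /eqP E; apply: (omega_shift (c := c)) => z.
  by have := TG u z; rewrite /= E formZl.
have pD' : exists x, x \notin D'.
  apply: contrapT => all; have [||x /= x0' |T TG Tu] :=
      @linear_graph _ V V (fun v => omega_related v.2 v.1).
  - split; first exact: omega_related0.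
    by move=> c v v'; apply: omega_related_linear.
  - move=> x; suff /to_submodP : x \in D' by [].
    by apply: contrapT => /negP nx; apply: all; exists x.
  - exact: omega_related_inj x0' omega_related0.
  apply: (length2_no_shift (S := T)) => [g u gaut|c u].
    by apply/esym/Tu; apply: omega_related_aut => //; apply: TG.
  move=> /eqP; rewrite subr_eq0 => /eqP E; apply: (omega'_shift (c := c)) => z.
  by have := TG u z; rewrite /= E formZl => <-.
have Dval (u : subsp D) : subsp_val u \in D by exact: valP u.
have [||w /= /omega_related_fun w0|T TG Tu] :=
    @linear_graph _ (subsp D) (subsp D') (fun v => omega_related (subsp_val v.1) (subsp_val v.2)).
- split; first exact: omega_related0.
  by move=> c v v' /(omega_related_linear c) h /h.
- move=> u; have /to_submodP[y xy] := Dval u.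
  have D'y : y \in D' by apply/to_submodP; exists (subsp_val u).
  by exists (Subsp D'y).
- by apply: val_inj; apply: w0; exact: omega_related0.
have Tbij : bijective T.
  apply: bijective_of_surj => [|w].
    apply: lin_injective => u Tu0; apply: val_inj => /=; apply: omega_inj => z.
    by have := TG u z; rewrite /= Tu0 form0l.
  have /to_submodP[x xy] : subsp_val w \in D' by exact: valP w.
  have Dx : x \in D by apply/to_submodP; exists (subsp_val w).
  by exists (Subsp Dx); apply/esym/Tu.
have [DD|dsum] := length2_dichotomy len rD nzD pD rD' nzD' pD'; last first.
  have rel x y : (forall z, omega V x z = omega' V y z) <->
      exists u : subsp D, x = subsp_val u /\ y = subsp_val (T u).
    split=> [xy|[u [-> ->]]]; last exact: (TG u).
    have Dx : x \in D by apply/to_submodP; exists y.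
    exists (Subsp Dx); split=> //; apply: (omega_related_fun xy); exact: (TG (Subsp Dx)).
  exists D, D', T; split=> //.
  exact: (quadruple_irreducible dsum Tbij rel len).
have D'D (w : subsp D') : subsp_val w \in D by rewrite -DD; exact: valP w.
have SL : linear (fun u : subsp D => Subsp (D'D (T u))).
  move=> c u w; apply: val_inj; rewrite -[LHS]/(subsp_val (T (c *: u + w))) linearP.
  exact: erefl.
pose S := lin_of SL.
have SG u : omega_related (subsp_val u) (subsp_val (S u)) by apply: (TG u).
have Sinj c u : S u - c *: u = 0 -> u = 0.
  move=> /eqP; rewrite subr_eq0 => /eqP E; apply: val_inj => /=.
  apply: (omega_shift (c := c)) => z.
  by rewrite (SG u z) E -[subsp_val _]/(c *: subsp_val u) formZl.
have iinj : injective (@subsp_val k V D : {linear subsp D -> V}) by exact: val_inj.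
have nzu : exists u : subsp D, u != 0.
  have [x Dx xn0] := nzD; exists (Subsp Dx).
  by apply: contraNneq xn0 => /(congr1 val)/= ->.
have [c [y none]] := exists_singular_shift k_uncountable iinj cV nzu Sinj.
have fL : linear (fun u => S u - c *: u).
  move=> d u u'; rewrite /= linearP [c *: (_ + _)]scalerDr opprD addrACA scalerBr.
  by rewrite !scalerA mulrC.
pose I x := exists u, subsp_val (lin_of fL u) = x.
have sI : subspace I.
  split; first by exists 0; rewrite linear0.
  by move=> d _ _ [u <-] [w <-]; exists (d *: u + w); rewrite linearP.
have rI : subrep (to_submod sI).
  move=> g gaut _ /to_submodP[u <-]; apply/to_submodP.
  have [h _ hE] := restrict_linear rD gaut; exists (h u).
  have hS : subsp_val (S (h u)) = g (subsp_val (S u)).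
    apply: (omega_related_fun (SG _)); rewrite hE; exact: (omega_related_aut gaut (SG u)).
  rewrite -[LHS]/(subsp_val (S (h u)) - c *: subsp_val (h u)) hS hE.
  rewrite -[subsp_val (lin_of fL u)]/(subsp_val (S u) - c *: subsp_val u).
  by rewrite [RHS]linearB [in RHS]linearZ.
have [|z0|DI] := length2_below len rD pD rI.
- by move=> _ /to_submodP[u <-]; apply: Dval.
- have [u u0] := nzu; case/eqP: u0; apply: (Sinj c); apply: val_inj => /=.
  by apply: z0; apply/to_submodP; exists u.
by have /to_submodP[u /val_inj E] := DI _ (Dval y); case: (none u).
Qed.

End Nondegenerate.

Theorem theorem1p1 (k : closedFieldType)
    (k_uncountable : ~ countable [set: k]%classic)
    (k_pchar0 : [pchar k] =i pred0)
    (V : biquadratic k) (V_dim : countable_dim V) :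
  universal V /\ has_length V 2 <->
  type_Ia V \/ type_Ib V \/ type_Ic V \/ type_IIa V \/ type_IIb V \/
  type_IIc V \/ type_III V.
Proof.
have k2 : 2%:R != 0 :> k by rewrite (proj1 (pcharf0P k) k_pchar0).
have cV := countable_dim_spanned V_dim.
split; last first.
  case=> [|[|[|[|[|[|]]]]]].
  - exact: type_Ia_length2.
  - exact: type_Ib_length2.
  - exact: type_Ic_length2.
  - exact: type_IIa_length2.
  - exact: type_IIb_length2.
  - exact: type_IIc_length2.
  by move=> [U [U' [T [dsum Tbij rel irr]]]]; apply: (type_III_length2 k2 dsum Tbij rel).
move=> [uV len].
have [[p nzW]|none] := pselect (exists p, nonzero_subspace (ker_at V p)); last first.
  do 6!right; apply: (length2_nondegenerate k_uncountable k2 cV len) => p x px.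
  by apply: contrapT => /eqP x0; apply: none; exists p, x.
have rW := @subrep_ker_at _ V p; have rO := subrep_orth rW.
have [q npq] := other_point p.
have [allO|/existsNP[o /negP nOo]] := pselect (forall x, x \in orth (ker_at V p)).
  right; right; left; apply: (length2_type_Ic k_uncountable k2 cV uV len).
  have [w Ww w0] := nzW; exists w => //; apply/(mq_kerP _ npq); split=> //.
  apply/ker_atP => x; rewrite formC.
  by have /(orthP _ _ npq)/(_ w Ww)[] := allO x.
have [z0|nzO] := pselect (zero_subspace (orth (ker_at V p))).
  by do 4!right; left; split=> //; exists p.
have {}nzO := nonzero_subspaceP nzO.
have pW := universal_outside_ker k2 p uV.
have pO : exists x, x \notin orth (ker_at V p) by exists o.
have [OW|dsum] := length2_dichotomy len rW nzW pW rO nzO pO.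
  have [IIa|IIc] := length2_self_orthogonal k2 uV len nzW pO OW; first by do 3!right; left.
  by do 5!right; left.
have [Ia|Ib] := length2_split k_uncountable k2 cV uV len npq nzW dsum nzO; first by left.
by right; left.
Qed.
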